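(* For all $\varepsilon>0$, for all $\ell\in(\sqrt2,2]$, there exists $\alpha=\alpha(\ell)\ge 0$ small enough and infinitely many integers $n$ such that $$\left|\frac{\mathbb E\left[\mathcal N(f_n,[0,2\pi])\right]}{n}-\ell\right|\le\varepsilon,$$ where the Gaussian entries $(a_k)_{k\ge1}$ and $(b_k)_{k\ge1}$ of $f_n$ admit $\frac{\delta_\alpha+\delta_{-\alpha}}{2}$ as spectral measure.
   Context: For $n\ge 1$ and $t\in\mathbb R$ set $f_n(t)=\frac{1}{\sqrt n}\sum_{k=1}^n\big(a_k\cos(kt)+b_k\sin(kt)\big)$, where $(a_k)_{k\ge1}$ and $(b_k)_{k\ge1}$ are two independent centered stationary Gaussian processes with the same correlation function. For $\alpha\ge 0$, saying that they admit $\frac12(\delta_\alpha+\delta_{-\alpha})$ (half the sum of the Dirac masses at $\alpha$ and $-\alpha$) as spectral measure means that $\mathbb E[a_ka_l]=\mathbb E[b_kb_l]=\cos((k-l)\alpha)$ and $\mathbb E[a_kb_l]=0$ for all $k,l\ge1$. $\mathcal N(f_n,[0,2\pi])$ denotes the number of real zeros of $f_n$ in the interval $[0,2\pi]$. *)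

(* Defs.v *)
From HB Require Import structures.
From mathcomp Require Import all_boot all_order all_algebra.
From mathcomp Require Import all_classical all_reals all_analysis.

Set Implicit Arguments.
Unset Strict Implicit.
Unset Printing Implicit Defensive.

Import Order.TTheory GRing.Theory Num.Theory.
Import numFieldNormedType.Exports.

Local Open Scope classical_set_scope.
Local Open Scope ring_scope.

(* Processes are indexed by k >= 1: for [a : nat -> {RV P >-> R}] the value
   [a 0] is irrelevant, and no definition below refers to it. *)

Section gaussian_processes.
Context d (T : measurableType d) (R : realType) (P : probability T R).

(* The degenerate case is separate because [normal_prob m 0] is the uniform
   law on [0, 1], not the Dirac mass at m. *)
Definition gaussian_rv (X : T -> R) : Prop :=
  exists m s : R, forall A : set R, measurable A ->
    P (X @^-1` A) = if s == 0 then \d_m A else normal_prob m s A.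

Definition gaussian_process (a : nat -> {RV P >-> R}) : Prop :=
  forall (n : nat) (c : nat -> R),
    gaussian_rv (fun w => \sum_(1 <= k < n.+1) c k * a k w).

Definition centered_process (a : nat -> {RV P >-> R}) : Prop :=
  forall k, (0 < k)%N -> ('E_P[a k] = 0)%E.

Definition stationary_process (a : nat -> {RV P >-> R}) : Prop :=
  forall (n h : nat) (A : nat -> set R), (forall k, measurable (A k)) ->
    P [set w | forall k, (1 <= k <= n)%N -> A k (a (k + h)%N w)] =
    P [set w | forall k, (1 <= k <= n)%N -> A k (a k w)].

Definition process_sigma_algebra (a : nat -> {RV P >-> R}) : set (set T) :=
  <<s \bigcup_(k in [set k | (0 < k)%N])
        preimage_set_system setT (a k) measurable >>.

Definition independent_processes (a b : nat -> {RV P >-> R}) : Prop :=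
  forall A B : set T,
    process_sigma_algebra a A -> process_sigma_algebra b B ->
    P (A `&` B) = (P A * P B)%E.

Definition admit_dirac_pair_spectral_measure (alpha : R)
    (a b : nat -> {RV P >-> R}) : Prop :=
  forall k l, (0 < k)%N -> (0 < l)%N ->
    [/\ 'E_P[a k \* a l]%E = (cos ((k%:R - l%:R) * alpha))%:E,
        'E_P[b k \* b l]%E = (cos ((k%:R - l%:R) * alpha))%:E
      & 'E_P[a k \* b l]%E = 0%E].

Definition gaussian_entries (alpha : R) (a b : nat -> {RV P >-> R}) : Prop :=
  [/\ gaussian_process a /\ gaussian_process b,
      centered_process a /\ centered_process b,
      stationary_process a /\ stationary_process b,
      independent_processes a b
    & admit_dirac_pair_spectral_measure alpha a b].

End gaussian_processes.

Definition trig_poly (R : realType) (a b : nat -> R) (n : nat) (t : R) : R :=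
  (Num.sqrt n%:R)^-1 *
  \sum_(1 <= k < n.+1) (a k * cos (k%:R * t) + b k * sin (k%:R * t)).

(* Number of distinct zeros, +oo if there are infinitely many. *)
Definition nb_zeros (R : realType) (f : R -> R) (I : set R) : \bar R :=
  counting [set t | I t /\ f t = 0].

Definition expected_nb_zeros d (T : measurableType d) (R : realType)
    (P : probability T R) (a b : nat -> {RV P >-> R}) (n : nat) : \bar R :=
  (\int[P]_w nb_zeros (trig_poly (a ^~ w) (b ^~ w) n) `[0%R, (2 * pi)%R])%E.

(* Main.v *)
(** Almost surely a_k = x1 cos(k alpha) + x2 sin(k alpha) and
    b_k = y1 cos(k alpha) + y2 sin(k alpha), with (x1, x2, y1, y2) standard Gaussian.
    Multiplying the sum by 2 (cos alpha - cos t) telescopes it to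
    A(t) cos(nt) + B(t) sin(nt) - V(t), where A, B, V do not oscillate with n; A and B
    depend on n only through n alpha modulo 2 pi.  Where D = A^2 + B^2 - V^2 > 0 the
    zeros have density n / pi, where D < 0 there are none, and by Rolle's theorem there
    are always O(1) zeros per interval of length 1 / n.  So if n alpha is close to beta
    modulo 2 pi, then E[N] / n is close to 2 p(alpha, beta), p being the probability that
    D > 0 at a uniform point t.  One has p(alpha, 0) = 1 and p(0, pi / 2) = 1 / sqrt 2,
    and p is continuous since D vanishes almost nowhere.  For alpha = 1 / (m + 1) small
    the intermediate value theorem gives beta with 2 p(alpha, beta) = l, and since pi is
    irrational n alpha approaches beta modulo 2 pi for infinitely many n. *)

Require Import Defs.
From HB Require Import structures.
From mathcomp Require Import all_boot all_order all_algebra.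
From mathcomp Require Import all_classical all_reals all_analysis.
From mathcomp Require Import measurable_realfun finmap ring lra.

Set Implicit Arguments.
Unset Strict Implicit.
Unset Printing Implicit Defensive.

Import Order.TTheory GRing.Theory Num.Theory.
Import numFieldNormedType.Exports.

Local Open Scope classical_set_scope.
Local Open Scope ring_scope.

(** * The standard Gaussian measure *)

(** The sign of D decides because, with its amplitudes frozen, A cos(nt) + B sin(nt) is a sinusoid
    of amplitude sqrt(A^2 + B^2): it crosses the level V twice per period 2 pi / n when V^2 < A^2 +
    B^2 and never when V^2 > A^2 + B^2. On a circle of length 2 pi this gives the factor 2 in 2 n p.
    This picture is uniform only while the four coordinates stay below a constant K and |D| is not
    small. What is left has small probability but might carry many zeros, so it needs a
    deterministic bound of order n; that is the use of Rolle's theorem. The circle is cut into cells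
    whose number does not depend on n, so that an error O(1) per cell disappears after division by
    n. The hypotheses on the entries give covariances and the Gaussian law of each linear
    combination, not the joint law of (x1, x2, y1, y2). That law is rebuilt in the manner of Cramer
    and Wold, from the means of cosines of linear forms. Recovering x1 and x2 divides by sin alpha,
    so alpha = 0 enters only as a limit. The parameters n and beta are fixed before the probability
    space, hence the estimates depend on the entries through their law only. *)

Section density.
Local Open Scope ereal_scope.
Import HBNNSimple.

(** The usual ascent: indicators by hypothesis, simple functions by linearity, then monotone
    convergence along [nnsfun_approx]. *)
Lemma ge0_integral_density d (T : measurableType d) (R : realType)
    (mu nu : {measure set T -> \bar R}) (g : T -> R) :
  measurable_fun setT g -> (forall x, 0 <= g x)%R ->
  (forall A, measurable A -> nu A = \int[mu]_(x in A) (g x)%:E) ->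
  forall f : T -> \bar R, measurable_fun setT f -> (forall x, 0 <= f x) ->
  \int[nu]_x f x = \int[mu]_x (f x * (g x)%:E).
Proof.
move=> mg g0 nuE f mf f0.
have mgE : measurable_fun setT (EFin \o g) by exact/measurable_EFinP.
have indE (A : set T) : measurable A ->
    \int[nu]_x (\1_A x)%:E = \int[mu]_x ((\1_A x)%:E * (g x)%:E).
  move=> mA; rewrite integral_indic// setIT nuE// integral_mkcond.
  apply: eq_integral => x _; rewrite patchE indicE.
  by case: (x \in A); rewrite ?mul1e ?mul0e.
have nnE (h : {nnsfun T >-> R}) :
    \int[nu]_x (h x)%:E = \int[mu]_x ((h x)%:E * (g x)%:E).
  have h0 x r : 0 <= (r * \1_(h @^-1` [set r]) x)%:E by rewrite EFinM nnfun_muleindic_ge0.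
  under eq_integral do rewrite fimfunE -fsumEFin//.
  rewrite ge0_integral_fsum//; last first.
    by move=> r; exact/measurable_EFinP/measurableT_comp.
  under [RHS]eq_integral do rewrite fimfunE -fsumEFin// ge0_mule_fsuml//.
  rewrite ge0_integral_fsum//; last 2 first.
  - move=> r; apply: emeasurable_funM => //; exact/measurable_EFinP/measurableT_comp.
  - by move=> r x _; rewrite mule_ge0// lee_fin.
  apply: eq_fsbigr => r /set_mem [y _ ry].
  have r0 : (0 <= r)%R by rewrite -ry.
  under eq_integral do rewrite EFinM.
  rewrite ge0_integralZl//; last by exact/measurable_EFinP.
  under [RHS]eq_integral do rewrite EFinM -muleA.
  rewrite ge0_integralZl//; last 2 first.
  - by apply: emeasurable_funM => //; exact/measurable_EFinP.
  - by move=> x _; rewrite mule_ge0// lee_fin.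
  by rewrite indE.
pose f_ := nnsfun_approx measurableT mf.
transitivity (limn (fun n => \int[nu]_x (f_ n x)%:E)).
  rewrite -monotone_convergence//=.
  - by apply: eq_integral => x _; apply/esym/cvg_lim => //; exact: cvg_nnsfun_approx.
  - by move=> n; exact/measurable_EFinP/measurable_funTS.
  - by move=> n x _; rewrite lee_fin.
  - by move=> x _ m n mn; rewrite lee_fin; exact/lefP/nd_nnsfun_approx.
transitivity (limn (fun n => \int[mu]_x ((f_ n x)%:E * (g x)%:E))).
  by apply: congr_lim; apply/funext => n; exact: nnE.
rewrite -monotone_convergence//=.
- apply: eq_integral => x _; apply/cvg_lim => //.
  apply: cvgeZr => //; exact: cvg_nnsfun_approx.
- by move=> n; apply: emeasurable_funM => //; exact/measurable_EFinP.
- by move=> n x _; rewrite mule_ge0// lee_fin.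
- move=> x _ m n mn; apply: lee_wpmul2r; rewrite ?lee_fin//.
  exact/lefP/nd_nnsfun_approx.
Qed.

End density.

Definition image_measure d d' (T : measurableType d) (T' : measurableType d') (R : realType)
    (m : {measure set T -> \bar R}) (f : T -> T') (mf : measurable_fun setT f) :
    {measure set T' -> \bar R} :=
  measure_function_pushforward__canonical__measure_function_Measure m mf.

(* The library has two measurable structures on [R] that differ by their display:
   [lebesgue_measure] lives on [measurableTypeR R], random variables on [R]. *)
Definition to_real (R : realType) (x : measurableTypeR R) : R := x.

Lemma measurable_to_real (R : realType) : measurable_fun setT (@to_real R).
Proof. exact: measurable_id. Qed.

HB.instance Definition _ (R : realType) :=
  isMeasurableFun.Build _ _ _ _ (@to_real R) (@measurable_to_real R).

Definition leb (R : realType) : set R -> \bar R := pushforward lebesgue_measure (@to_real R).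

HB.instance Definition _ (R : realType) :=
  Measure.copy (@leb R) (image_measure lebesgue_measure (@measurable_to_real R)).

Lemma leb_sigma_finite (R : realType) : sigma_finite setT (@leb R).
Proof. exact: (sigma_finiteT (@lebesgue_measure R)). Qed.

HB.instance Definition _ (R : realType) :=
  @Measure_isSigmaFinite.Build _ _ _ (@leb R) (@leb_sigma_finite R).

Definition gauss (R : realType) : probability R R :=
  distribution (normal_prob 0 1 : probability (measurableTypeR R) R) (@to_real R).

Definition affine (R : realType) (a b x : R) : R := a * x + b.

Lemma measurable_affine (R : realType) (a b : R) : measurable_fun setT (affine a b).
Proof. by apply: measurable_funD => //; exact: measurable_funM. Qed.

Section lebesgue_affine.
Local Open Scope ereal_scope.
Variable R : realType.
Local Notation mu := (@leb R).

(** Both measures give half-open intervals the same length, and Lebesgue measure is determined by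
    those. *)
Lemma lebesgue_measure_affine (a b : R) (a0 : (0 < a)%R) (A : set R) :
  measurable A -> mu A = mscale (NngNum (ltW a0)) (image_measure mu (measurable_affine a b)) A.
Proof.
move=> mA.
pose nu : {measure set (measurableTypeR R) -> \bar R} :=
  mscale (NngNum (ltW a0)) (image_measure lebesgue_measure
    (measurable_affine a b : measurable_fun setT (affine a b : measurableTypeR R -> measurableTypeR R))).
apply: (@lebesgue_measure_unique R nu) => //= _ [[p q]] _ <-.
rewrite /nu/= /mscale/= /image_measure/= /pushforward.
have -> : affine a b @^-1` `]p, q] = `]((p - b) / a)%R, ((q - b) / a)%R]%classic.
  apply/seteqP; split => x; rewrite /= !in_itv/= /affine.
    by rewrite ltr_pdivrMr// ler_pdivlMr// ltrBlDr lerBrDr mulrC.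
  by rewrite ltr_pdivrMr// ler_pdivlMr// ltrBlDr lerBrDr mulrC.
rewrite !lebesgue_measure_itv/= !lte_fin ltr_pM2r ?invr_gt0// ltrD2r.
case: ifPn => _; last by rewrite mule0.
by rewrite -!EFinB -EFinM; congr EFin; field; rewrite gt_eqF.
Qed.

Lemma ge0_integral_affine (a b : R) (f : R -> \bar R) : (0 < a)%R ->
  measurable_fun setT f -> (forall x, 0 <= f x) ->
  \int[mu]_x f x = a%:E * \int[mu]_x f (a * x + b)%R.
Proof.
move=> a0 mf f0.
transitivity (\int[mscale (NngNum (ltW a0)) (image_measure mu (measurable_affine a b))]_x f x).
  by apply: eq_measure_integral => A mA _; exact: lebesgue_measure_affine.
rewrite ge0_integral_mscale//; congr (_ * _).
exact: (ge0_integral_pushforward (measurable_affine a b)).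
Qed.

Lemma ge0_integral_opp (f : R -> \bar R) :
  measurable_fun setT f -> (forall x, 0 <= f x) ->
  \int[mu]_x f x = \int[mu]_x f (- x)%R.
Proof.
move=> mf f0.
have mN : measurable_fun setT (-%R : R -> R) by exact: measurable_funN.
transitivity (\int[image_measure mu mN]_x f x).
  by apply: eq_measure_integral => A mA _; exact/esym/lebesgue_measureN.
exact: (ge0_integral_pushforward mN).
Qed.

End lebesgue_affine.

Section gauss.
Local Open Scope ereal_scope.
Variable R : realType.
Local Notation mu := (@leb R).
Local Notation gauss := (gauss R).
Local Notation phi := (@normal_pdf R 0 1).

Lemma phiE (x : R) : phi x = (normal_peak 1 * expR (- x ^+ 2 / 2))%R.
Proof. by rewrite normal_pdfE ?oner_eq0// /normal_fun subr0 expr1n. Qed.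

Lemma measurable_phi : measurable_fun setT phi.
Proof. exact: measurable_normal_pdf. Qed.

Lemma measurable_phiE : measurable_fun setT (fun x : R => (phi x)%:E).
Proof. by apply/measurable_EFinP; exact: measurable_phi. Qed.

Lemma phi_ge0 (x : R) : (0 <= phi x)%R.
Proof. exact: normal_pdf_ge0. Qed.

Lemma ge0_integral_gauss (f : R -> \bar R) : measurable_fun setT f -> (forall x, 0 <= f x) ->
  \int[gauss]_x f x = \int[mu]_x (f x * (phi x)%:E).
Proof.
move=> mf f0; apply: ge0_integral_density => //; [exact: measurable_phi|exact: phi_ge0|].
move=> A mA; apply/esym.
transitivity (\int[@lebesgue_measure R]_(x in A) (phi x)%:E) => //.
by apply: (ge0_integral_pushforward (@measurable_to_real R)) => // [|x _];
  [apply: measurable_funTS; exact: measurable_phiE|rewrite lee_fin phi_ge0].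
Qed.

(** Passes to an iterated Lebesgue integral, where shears and dilations of a single variable can be
    applied. *)
Lemma ge0_integral_gauss2 (H : R * R -> \bar R) :
  measurable_fun setT H -> (forall x, 0 <= H x) ->
  \int[gauss \x gauss]_z H z = \int[mu]_x \int[mu]_y (H (x, y) * (phi x * phi y)%:E).
Proof.
move=> mH H0.
have mHx x : measurable_fun setT (fun y => H (x, y)) by exact: measurableT_comp.
transitivity (\int[gauss]_x \int[gauss]_y H (x, y)); first exact: (@fubini_tonelli1 _ _ _ _ R gauss gauss H mH H0).
rewrite ge0_integral_gauss//; last 2 first.
- exact: measurable_fun_fubini_tonelli_F.
- by move=> x; exact: integral_ge0.
apply: eq_integral => x _; rewrite ge0_integral_gauss// -ge0_integralZr//.
- by apply: eq_integral => y _; rewrite -muleA -EFinM mulrC.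
- by apply: emeasurable_funM => //; exact: measurable_phiE.
- by move=> y _; rewrite mule_ge0// lee_fin phi_ge0.
- by rewrite lee_fin phi_ge0.
Qed.

Let J (K : R * R -> \bar R) := \int[mu]_x \int[mu]_y K (x, y).

Let shearr (k : R) (K : R * R -> \bar R) : measurable_fun setT K -> (forall z, 0 <= K z) ->
  J (fun z => K (z.1, z.2 + k * z.1)%R) = J K.
Proof.
move=> mK K0; apply: eq_integral => x _ /=.
have := @ge0_integral_affine R 1 (k * x) (fun y => K (x, y)) ltr01.
rewrite mul1e => -> //; last exact: measurableT_comp.
by apply: eq_integral => y _; rewrite mul1r.
Qed.

Let shearl (k : R) (K : R * R -> \bar R) : measurable_fun setT K -> (forall z, 0 <= K z) ->
  J (fun z => K (z.1 + k * z.2, z.2)%R) = J K.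
Proof.
move=> mK K0; rewrite /J.
have mKk : measurable_fun setT (fun z : R * R => K (z.1 + k * z.2, z.2)%R).
  apply: (measurableT_comp mK); apply: measurable_fun_pair => //=.
  by apply: measurable_funD => //; exact: measurable_funM.
transitivity (\int[mu]_y \int[mu]_x K (x + k * y, y)%R).
  exact: (@fubini_tonelli _ _ _ _ R mu mu (fun z : R * R => K (z.1 + k * z.2, z.2)%R)).
transitivity (\int[mu]_y \int[mu]_x K (x, y)); last first.
  by apply/esym; exact: (@fubini_tonelli _ _ _ _ R mu mu K mK K0).
apply: eq_integral => y _ /=.
have := @ge0_integral_affine R 1 (k * y) (fun x => K (x, y)) ltr01.
rewrite mul1e => -> //; last exact: measurableT_comp.
by apply: eq_integral => x _; rewrite mul1r.
Qed.

Let rot (c s : R) (z : R * R) : R * R := (c * z.1 - s * z.2, s * z.1 + c * z.2)%R.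

(* A rotation is a product of three shears, each of which preserves Lebesgue measure. *)
Lemma gauss2_rotation (c s : R) (H : R * R -> \bar R) : (s != 0)%R -> (c ^+ 2 + s ^+ 2 = 1)%R ->
  measurable_fun setT H -> (forall x, 0 <= H x) ->
  \int[gauss \x gauss]_z H (c * z.1 - s * z.2, s * z.1 + c * z.2)%R = \int[gauss \x gauss]_z H z.
Proof.
move=> s0 cs mH H0.
have mrot : measurable_fun setT (rot c s).
  apply: measurable_fun_pair => /=.
    by apply: measurable_funB; exact: measurable_funM.
  by apply: measurable_funD; exact: measurable_funM.
have mHr : measurable_fun setT (H \o rot c s) by exact: measurableT_comp.
rewrite [RHS]ge0_integral_gauss2//.
transitivity (\int[mu]_x \int[mu]_y ((H \o rot c s) (x, y) * (phi x * phi y)%:E)).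
  by apply: (@ge0_integral_gauss2 (H \o rot c s)) => // z; exact: H0.
pose G z := H z * (phi z.1 * phi z.2)%:E.
have mphi2 : measurable_fun setT (fun z : R * R => (phi z.1 * phi z.2)%:E).
  by apply/measurable_EFinP/measurable_funM; apply: (measurableT_comp measurable_phi).
have mG : measurable_fun setT G by exact: emeasurable_funM.
have G0 z : 0 <= G z by rewrite mule_ge0// lee_fin mulr_ge0// phi_ge0.
have phirot z : (phi z.1 * phi z.2 = phi (rot c s z).1 * phi (rot c s z).2)%R.
  rewrite !phiE !mulrA ![(normal_peak 1 * _ * normal_peak 1)%R]mulrAC -!mulrA -!expRD.
  congr (_ * (_ * expR _))%R; rewrite /rot/=.
  transitivity (- ((c ^+ 2 + s ^+ 2) * (z.1 ^+ 2 + z.2 ^+ 2)) / 2)%R; last by ring.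
  by rewrite cs mul1r; ring.
transitivity (J (G \o rot c s)).
  rewrite /J; under [RHS]eq_integral => x _.
    under eq_integral => y _ do rewrite /G/= -(phirot (x, y))/=.
    over.
  by [].
(* For a rotation by theta this is - tan(theta / 2): shearing by [k], then by [s] in the other
   direction, then by [k] again gives the rotation. The division is the reason for the hypothesis on
   [s]. *)
pose k := ((c - 1) / s)%R.
change (J (G \o rot c s) = J G).
rewrite -[RHS](@shearl k G mG G0).
have mG1 : measurable_fun setT (fun z : R * R => G (z.1 + k * z.2, z.2)%R).
  apply: (measurableT_comp mG); apply: measurable_fun_pair => //=.
  by apply: measurable_funD => //; exact: measurable_funM.
rewrite -[RHS](@shearr s _ mG1 (fun=> G0 _)).
have mG2 : measurable_fun setT (fun z : R * R => G (z.1 + k * (z.2 + s * z.1), z.2 + s * z.1)%R).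
  apply: (measurableT_comp mG); apply: measurable_fun_pair => //=.
    apply: measurable_funD => //; apply: measurable_funM => //.
    by apply: measurable_funD => //; exact: measurable_funM.
  by apply: measurable_funD => //; exact: measurable_funM.
rewrite -[RHS](@shearl k _ mG2 (fun=> G0 _)).
apply: (congr1 J); apply/funext => -[x y]; apply: (congr1 G).
have s2 : (s ^+ 2 = 1 - c ^+ 2)%R by rewrite -cs; ring.
rewrite /rot /=; congr (_, _); rewrite /k.
  have -> : (x + (c - 1) / s * y + (c - 1) / s * (y + s * (x + (c - 1) / s * y)) =
    c * x + (c ^+ 2 - 1) / s * y)%R by field.
  have -> : (c ^+ 2 - 1 = - s * s)%R by rewrite mulNr -expr2 s2; ring.
  by rewrite mulfK// mulNr.
by field.
Qed.

Let integral_gauss_cst (a : \bar R) : \int[gauss]_x a = a.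
Proof.
rewrite integral_cst//; transitivity (a * 1); last exact: mule1.
by congr (_ * _); exact: probability_setT.
Qed.

(** A unit linear form is a coordinate after a rotation, and the other coordinate integrates out. *)
Lemma gauss2_linear (c s : R) (g : R -> \bar R) : (c ^+ 2 + s ^+ 2 = 1)%R ->
  measurable_fun setT g -> (forall x, 0 <= g x) ->
  \int[gauss \x gauss]_z g (c * z.1 + s * z.2)%R = \int[gauss]_x g x.
Proof.
move=> cs mg g0.
have fst_int : \int[gauss \x gauss]_z g z.1 = \int[gauss]_x g x.
  rewrite (fubini_tonelli1 (fun z : R * R => g z.1))//; last exact: measurableT_comp.
  by apply: eq_integral => x _; exact: (integral_gauss_cst (g x)).
have snd_int : \int[gauss \x gauss]_z g z.2 = \int[gauss]_x g x.
  rewrite (fubini_tonelli2 (fun z : R * R => g z.2))//; last exact: measurableT_comp.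
  by apply: eq_integral => x _; exact: (integral_gauss_cst (g x)).
(* The rotation lemma excludes a zero sine. If [s] is zero, then [c] is not, and the form is read as
   the second coordinate of the rotation with cosine [s] and sine [c]. *)
have [s0|s0] := eqVneq s 0%R.
  have c0 : (c != 0)%R.
    by apply/eqP => c0; move: cs; rewrite s0 c0 !expr0n addr0 => /esym/eqP; rewrite oner_eq0.
  have sc : (s ^+ 2 + c ^+ 2 = 1)%R by rewrite addrC.
  rewrite -snd_int -(@gauss2_rotation s c (fun z => g z.2) c0 sc)//.
  exact: measurableT_comp.
have cs' : (c ^+ 2 + (- s) ^+ 2 = 1)%R by rewrite sqrrN.
have s0' : (- s != 0)%R by rewrite oppr_eq0.
rewrite -fst_int -(@gauss2_rotation c (- s) (fun z => g z.1) s0' cs')//; last first.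
  exact: measurableT_comp.
by apply: eq_integral => z _ /=; rewrite mulNr opprK.
Qed.

Let one_u2 (u : R) : (0 < 1 + u ^+ 2)%R.
Proof. by rewrite ltr_pwDl// sqr_ge0. Qed.

(** The radial density of the plane Gaussian up to a constant, extended evenly to the whole line. *)
Let g0 (x : R) := (`|x| * (normal_peak 1 ^+ 2 * expR (- x ^+ 2 / 2)))%R.

Let mg0 : measurable_fun setT g0.
Proof.
apply: measurable_funM; first exact: normr_measurable.
apply: measurable_funM => //; apply: measurableT_comp => //.
by apply: measurable_funM => //; apply: measurable_funN; exact: measurable_funX.
Qed.

Let g0_ge0 x : (0 <= g0 x)%R.
Proof. by rewrite /g0 mulr_ge0// mulr_ge0 ?expR_ge0// exprn_ge0// normal_peak_ge0. Qed.

(* Substitute [z.2 = |z.1| * u]: this replaces polar coordinates. *)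
Let polar_slice (h : R -> \bar R) : measurable_fun setT h -> (forall x, 0 <= h x) ->
  \int[gauss \x gauss]_z h (z.1 ^+ 2 + z.2 ^+ 2)%R =
  (\int[mu]_u ((1 + u ^+ 2)^-1)%:E) * \int[mu]_x (h (x ^+ 2)%R * (g0 x)%:E).
Proof.
move=> mh h0.
have mh2 : measurable_fun setT (fun z : R * R => h (z.1 ^+ 2 + z.2 ^+ 2)%R).
  apply: (measurableT_comp mh); apply: measurable_funD; apply: measurable_funX.
    exact: measurable_fst.
  exact: measurable_snd.
rewrite ge0_integral_gauss2//.
pose F (z : R * R) := h (z.1 ^+ 2 * (1 + z.2 ^+ 2))%R * (`|z.1| * (normal_peak 1 ^+ 2
   * expR (- (z.1 ^+ 2 * (1 + z.2 ^+ 2)) / 2)))%:E.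
have m1 : measurable_fun setT (fun z : R * R => z.1 ^+ 2 * (1 + z.2 ^+ 2))%R.
  apply: measurable_funM; first by apply: measurable_funX; exact: measurable_fst.
  by apply: measurable_funD => //; apply: measurable_funX; exact: measurable_snd.
have mF : measurable_fun setT F.
  apply: emeasurable_funM; first exact: measurableT_comp.
  apply/measurable_EFinP; apply: measurable_funM.
    by apply: measurableT_comp => //; exact: measurable_fst.
  apply: measurable_funM => //; apply: measurableT_comp => //.
  by apply: measurable_funM => //; exact: measurable_funN.
have F0 z : 0 <= F z.
  by rewrite mule_ge0// lee_fin mulr_ge0// mulr_ge0 ?expR_ge0// exprn_ge0// normal_peak_ge0.
have mH : measurable_fun setT (fun z : R * R => h (z.1 ^+ 2 + z.2 ^+ 2)%R * (phi z.1 * phi z.2)%:E).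
  apply: emeasurable_funM => //; apply/measurable_EFinP.
  by apply: measurable_funM; apply: (measurableT_comp measurable_phi).
have H0 (z : R * R) : 0 <= h (z.1 ^+ 2 + z.2 ^+ 2)%R * (phi z.1 * phi z.2)%:E.
  by rewrite mule_ge0// lee_fin mulr_ge0// phi_ge0.
transitivity (\int[mu]_x \int[mu]_u F (x, u)).
  apply: ge0_ae_eq_integral => //.
  - exact: (measurable_fun_fubini_tonelli_F _ mH).
  - exact: (measurable_fun_fubini_tonelli_F _ mF).
  - by move=> x _; apply: integral_ge0 => y _; exact: (H0 (x, y)).
  - by move=> x _; apply: integral_ge0 => y _; exact: (F0 (x, y)).
  (* The dilation by [|x|] degenerates at [x = 0], which is a null set. *)
  exists [set 0%R]; split => //; first exact: lebesgue_measure_set1.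
  move=> x /= hx; apply: contrapT => x0; apply: hx => _.
  have ax : (0 < `|x|)%R by rewrite normr_gt0; exact/eqP.
  have mHx : measurable_fun setT (fun y : R => h (x ^+ 2 + y ^+ 2)%R * (phi x * phi y)%:E).
    exact: (measurableT_comp mH (measurable_pair1 x)).
  rewrite (@ge0_integral_affine R `|x|%R 0%R (fun y => h (x ^+ 2 + y ^+ 2)%R * (phi x * phi y)%:E) ax mHx (fun y => H0 (x, y))).
  rewrite -ge0_integralZl//; last 2 first.
  - exact: (measurableT_comp mHx (measurable_affine `|x|%R 0%R)).
  - by move=> y _; exact: (H0 (x, (`|x| * y + 0)%R)).
  apply: eq_integral => u _; rewrite addr0 /F/= exprMn real_normK ?num_real//.
  rewrite (_ : (x ^+ 2 + x ^+ 2 * u ^+ 2 = x ^+ 2 * (1 + u ^+ 2))%R); last by ring.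
  rewrite muleCA -EFinM; congr (_ * (_ * _)%:E); rewrite !phiE expr2.
  rewrite mulrACA -expRD; congr (_ * expR _)%R.
  by rewrite exprMn real_normK ?num_real//; ring.
rewrite (fubini_tonelli F)//.
have mk : measurable_fun setT (fun u : R => ((1 + u ^+ 2)^-1)%:E).
  apply/measurable_EFinP; apply: continuous_measurable_fun => u.
  apply: cvgV; first by rewrite gt_eqF.
  by apply: cvgD; [exact: cvg_cst|exact: exprn_continuous].
rewrite -ge0_integralZr//; last 2 first.
- by move=> u _; rewrite lee_fin invr_ge0 ltW.
- by apply: integral_ge0 => x _; rewrite mule_ge0// lee_fin.
apply: eq_integral => u _.
have k0 := one_u2 u; set k := (1 + u ^+ 2)%R in k0 *.
(* On a line of fixed slope [u], rescale the other variable by sqrt(1 + u^2). One factor [q] comes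
   from dx and one from [|x|], so each slope has weight 1 / (1 + u^2). *)
pose q : R := Num.sqrt k; have q0 : (0 < q)%R by rewrite sqrtr_gt0.
have qk : (q ^+ 2 = k)%R by rewrite sqr_sqrtr// ltW.
have mhg : measurable_fun setT (fun x : R => h (x ^+ 2)%R * (g0 x)%:E).
  apply: emeasurable_funM; first by apply: measurableT_comp => //; exact: measurable_funX.
  exact/measurable_EFinP.
have hg0 (x : R) : 0 <= h (x ^+ 2)%R * (g0 x)%:E by rewrite mule_ge0// lee_fin.
rewrite [in RHS](ge0_integral_affine 0 q0 mhg hg0) muleA -EFinM.
rewrite -ge0_integralZl//; last 2 first.
- exact: (measurableT_comp mhg (measurable_affine q 0)).
- by rewrite lee_fin mulr_ge0 ?invr_ge0// ltW.
apply: eq_integral => x _; rewrite addr0 /F/= -/k exprMn qk [(k * _)%R]mulrC.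
rewrite muleCA -EFinM; congr (_ * _%:E); rewrite /g0 normrM (gtr0_norm q0).
rewrite exprMn qk [(k * _)%R]mulrC !mulrA; congr (_ * _ * _)%R.
by rewrite -[(k^-1 * q * q)%R]mulrA -expr2 qk mulVf ?mul1r// gt_eqF.
Qed.

Let even_half (f : R -> \bar R) : measurable_fun setT f -> (forall x, 0 <= f x) ->
  (forall x, f (- x)%R = f x) ->
  \int[mu]_x f x = \int[@lebesgue_measure R]_(x in `[0%R, +oo[) f x +
                   \int[@lebesgue_measure R]_(x in `[0%R, +oo[) f x.
Proof.
move=> mf f0 fN.
transitivity (\int[@lebesgue_measure R]_x f x).
  exact: (ge0_integral_pushforward (@measurable_to_real R)).
rewrite -(setUv `[0%R, +oo[) setCitvr ge0_integral_setU//=; last 2 first.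
- exact: measurable_funTS.
- by rewrite -setCitvr; exact/disj_setPCl.
congr (_ + _); rewrite ge0_integration_by_substitution0//.
have -> : (fun r => f (- r)%R) = f by exact/funext.
by rewrite -integral_itv_bndo_bndc//; exact: measurable_funTS.
Qed.

(** Gives antiderivatives their limit at infinity. The threshold 4 is the point from which x^2 / 4
    is at least x. *)
Let cvg_exp_bound (F : R -> R) (C : R) :
  (forall x, 4 <= x -> `|F x| <= C * expR (- x))%R -> F x @[x --> +oo%R] --> 0%R.
Proof.
move=> FC; apply/norm_cvg0P.
apply: (@squeeze_cvgr _ _ _ _ (cst 0%R) (fun x => C * expR (- x))%R).
- by near=> x; rewrite normr_ge0/= FC//; near: x; exact: nbhs_pinfty_ge.
- exact: cvg_cst.
- rewrite -[X in _ --> X](mulr0 C); apply: cvgM; first exact: cvg_cst.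
  exact: cvgr_expR.
Unshelve. all: by end_near. Qed.

Let is_derive_expsq (x : R) :
  is_derive x 1%R (fun x : R => expR (- x ^+ 2 / 2)) (- x * expR (- x ^+ 2 / 2))%R.
Proof.
by apply: is_derive_eq; rewrite /GRing.scale/=; field.
Qed.

Let expsq_bound (x : R) : (4 <= x -> expR (- x ^+ 2 / 4) <= expR (- x))%R.
Proof. by move=> x4; rewrite ler_expR; nra. Qed.

Let tail_integral (w : R) : (0 <= w)%R ->
  \int[@lebesgue_measure R]_(x in `[w, +oo[) (x * expR (- x ^+ 2 / 2))%:E = (expR (- w ^+ 2 / 2))%:E.
Proof.
move=> w0.
pose F (x : R) := (- expR (- x ^+ 2 / 2))%R.
have dF (x : R) : is_derive x 1%R F (x * expR (- x ^+ 2 / 2))%R.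
  have := is_derive_expsq x => ?; apply: is_derive_eq; ring.
rewrite (@ge0_continuous_FTC2y _ (fun x => x * expR (- x ^+ 2 / 2))%R F w 0%R).
- by rewrite sub0e /F EFinN oppeK.
- by move=> x wx; rewrite mulr_ge0 ?expR_ge0// (le_trans w0).
- apply: derivable_within_continuous => x _.
  have := is_derive_expsq x => ?; exact: ex_derive.
- apply: (@cvg_exp_bound F 1%R) => x x4; rewrite mul1r normrN ger0_norm ?expR_ge0//.
  by rewrite ler_expR; nra.
- by move=> x _; exact: ex_derive.
- apply: cvg_at_right_filter; apply: differentiable_continuous.
  exact/derivable1_diffP/ex_derive.
- by move=> x _; rewrite derive1E; exact: derive_val.
Qed.

(** An antiderivative is -(x^2 + 2) exp(-x^2 / 2). This is the mean of the squared norm in the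
    plane, hence twice the second moment of [gauss]. *)
Let cubic_integral :
  \int[@lebesgue_measure R]_(x in `[0%R, +oo[) (x ^+ 2 * (x * expR (- x ^+ 2 / 2)))%:E = 2%:E.
Proof.
pose F (x : R) := (- (x ^+ 2 + 2) * expR (- x ^+ 2 / 2))%R.
have dF (x : R) : is_derive x 1%R F (x ^+ 2 * (x * expR (- x ^+ 2 / 2)))%R.
  have := is_derive_expsq x => ?; apply: is_derive_eq; rewrite /GRing.scale/=; ring.
rewrite (@ge0_continuous_FTC2y _ (fun x => x ^+ 2 * (x * expR (- x ^+ 2 / 2)))%R F 0%R 0%R).
- have -> : F 0%R = (- 2)%R by rewrite /F expr0n/= add0r oppr0 mul0r expR0 mulr1.
  by rewrite -EFinB sub0r opprK.
- by move=> x x0; rewrite mulr_ge0 ?sqr_ge0// mulr_ge0 ?expR_ge0.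
- apply: derivable_within_continuous => x _.
  have := is_derive_expsq x => ?; exact: ex_derive.
(* Half of the exponent absorbs the polynomial: y exp(-y) <= 1 at y = x^2 / 4 gives (x^2 + 2)
   exp(-x^2 / 4) <= 4 + 2. The other half is at most exp(-x). *)
- apply: (@cvg_exp_bound F 6%R) => x x4.
  rewrite /F mulNr normrN ger0_norm ?mulr_ge0 ?expR_ge0 ?addr_ge0 ?sqr_ge0//.
  have -> : (- x ^+ 2 / 2 = - x ^+ 2 / 4 + - x ^+ 2 / 4)%R by field.
  rewrite expRD mulrA; apply: ler_pM; rewrite ?mulr_ge0 ?expR_ge0 ?addr_ge0 ?sqr_ge0//.
    have e1 : (x ^+ 2 / 4 <= expR (x ^+ 2 / 4))%R.
      by apply: le_trans (expR_ge1Dx _); rewrite lerDr.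
    have e2 : (expR (- x ^+ 2 / 4) <= 1)%R.
      by rewrite -expR0 ler_expR mulNr oppr_le0 divr_ge0 ?sqr_ge0.
    have e3 : (expR (x ^+ 2 / 4) * expR (- x ^+ 2 / 4) = 1)%R.
      by rewrite -expRD mulNr subrr expR0.
    have e4 : (0 <= expR (- x ^+ 2 / 4))%R by exact: expR_ge0.
    have e5 : (x ^+ 2 / 4 * expR (- x ^+ 2 / 4) <= 1)%R.
      by rewrite -[leRHS]e3; exact: ler_wpM2r.
    by move: e5 e2; lra.
  exact: expsq_bound.
- by move=> x _; exact: ex_derive.
- apply: cvg_at_right_filter; apply: differentiable_continuous.
  exact/derivable1_diffP/ex_derive.
- by move=> x _; rewrite derive1E; exact: derive_val.
Qed.

Let polar_half (h : R -> \bar R) : measurable_fun setT h -> (forall x, 0 <= h x) ->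
  \int[mu]_x (h (x ^+ 2)%R * (g0 x)%:E) = (2 * normal_peak 1 ^+ 2)%:E *
    \int[@lebesgue_measure R]_(x in `[0%R, +oo[) (h (x ^+ 2)%R * (x * expR (- x ^+ 2 / 2))%:E).
Proof.
move=> mh h0.
have mh2 : measurable_fun setT (fun x : R => h (x ^+ 2)%R).
  by apply: measurableT_comp => //; exact: measurable_funX.
have hg0 (x : R) : 0 <= h (x ^+ 2)%R * (g0 x)%:E by rewrite mule_ge0// lee_fin.
rewrite even_half//; last 2 first.
- by apply: emeasurable_funM => //; exact/measurable_EFinP.
- by move=> x; rewrite /g0 normrN sqrrN.
have mexp : measurable_fun setT (fun x : R => (x * expR (- x ^+ 2 / 2))%R).
  apply: measurable_funM => //; apply: measurableT_comp => //.
  by apply: measurable_funM => //; apply: measurable_funN; exact: measurable_funX.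
have e : \int[@lebesgue_measure R]_(x in `[0%R, +oo[) (h (x ^+ 2)%R * (g0 x)%:E) =
   (normal_peak 1 ^+ 2)%:E *
    \int[@lebesgue_measure R]_(x in `[0%R, +oo[) (h (x ^+ 2)%R * (x * expR (- x ^+ 2 / 2))%:E).
  rewrite -ge0_integralZl//.
  - apply: eq_integral => x /set_mem; rewrite /= in_itv/= andbT => x0.
    by rewrite muleCA -EFinM /g0 ger0_norm// mulrCA.
  - apply: measurable_funTS; apply: emeasurable_funM => //; exact/measurable_EFinP.
  - move=> x; rewrite /= in_itv/= andbT => x0.
    by rewrite mule_ge0// lee_fin mulr_ge0// expR_ge0.
  - by rewrite lee_fin exprn_ge0// normal_peak_ge0.
rewrite e -ge0_muleDl ?lee_fin ?exprn_ge0 ?normal_peak_ge0//.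
by rewrite -EFinD mulr_natl mulr2n.
Qed.

Lemma gauss2_polar (h : R -> \bar R) : measurable_fun setT h -> (forall x, 0 <= h x) ->
  \int[gauss \x gauss]_z h (z.1 ^+ 2 + z.2 ^+ 2)%R =
  \int[@lebesgue_measure R]_(x in `[0%R, +oo[) (h (x ^+ 2)%R * (x * expR (- x ^+ 2 / 2))%:E).
Proof.
move=> mh h0; rewrite polar_slice// polar_half// muleA.
(* The angular constant is found by testing with the constant function 1, so the integral of 1 / (1
   + u^2) is never evaluated. *)
set C := (X in X * _); suff -> : C = 1 by rewrite mul1e.
have hc : measurable_fun [set: R] (fun=> 1 : \bar R) by exact: measurable_cst.
have := polar_slice hc (fun=> lee01).
rewrite (polar_half hc (fun=> lee01)) muleA -/C.
under [X in _ = _ * X]eq_integral do rewrite mul1e.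
rewrite tail_integral// expr0n/= oppr0 mul0r expR0 mule1 => <-.
rewrite integral_cst// mul1e; exact: probability_setT.
Qed.

(** The squared norm of a plane Gaussian is exponentially distributed. This turns the probability of
    a positive discriminant into a one-dimensional Gaussian integral. *)
Lemma gauss2_tail (w : R) :
  \int[gauss \x gauss]_z (\1_[set r | w ^+ 2 < r] (z.1 ^+ 2 + z.2 ^+ 2)%R)%:E = (expR (- w ^+ 2 / 2))%:E.
Proof.
wlog w0 : w / (0 <= w)%R.
  move=> W; case: (leP 0%R w) => [|/ltW w0]; first exact: W.
  by rewrite -sqrrN; apply: W; rewrite oppr_ge0.
have mS : measurable [set r | w ^+ 2 < r]%R.
  rewrite (_ : [set r | w ^+ 2 < r]%R = `](w ^+ 2)%R, +oo[%classic)//.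
  by apply/seteqP; split => x; rewrite /= in_itv/= andbT.
rewrite (gauss2_polar (h := fun r => (\1_[set r | w ^+ 2 < r]%R r)%:E))//; last first.
  by apply/measurable_EFinP; exact: measurable_indic.
rewrite -tail_integral//.
have mexp : measurable_fun setT (fun x : R => (x * expR (- x ^+ 2 / 2))%:E).
  apply/measurable_EFinP; apply: measurable_funM => //; apply: measurableT_comp => //.
  by apply: measurable_funM => //; apply: measurable_funN; exact: measurable_funX.
rewrite -integral_itv_obnd_cbnd//; last exact: measurable_funTS.
rewrite integral_mkcond [RHS]integral_mkcond; apply: eq_integral => x _.
rewrite !patchE; have [x0|x0] := lerP 0%R x; last first.
  rewrite !memNset//= ?in_itv/= ?andbT; first by move=> /(le_lt_trans w0); rewrite ltNge (ltW x0).
  by rewrite leNgt x0.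
rewrite mem_set/= ?in_itv/= ?x0// indicE.
have [wx|xw] := ltrP w x.
  rewrite !mem_set/= ?mul1e ?in_itv/= ?wx//.
  by rewrite ltr_pXn2r// nnegrE.
rewrite !memNset ?mul0e//=; first by rewrite in_itv/= andbT ltNge xw.
by rewrite ltr_pXn2r// ?nnegrE// ltNge xw.
Qed.

Lemma gauss_second_moment : \int[gauss]_x (x ^+ 2)%:E = 1.
Proof.
have mX : measurable_fun setT (fun x : R => (x ^+ 2)%:E).
  by apply/measurable_EFinP; exact: measurable_funX.
have X0 (x : R) : 0 <= (x ^+ 2)%:E by rewrite lee_fin sqr_ge0.
have : \int[gauss \x gauss]_z (z.1 ^+ 2 + z.2 ^+ 2)%:E = 2%:E.
  rewrite -cubic_integral.
  have mN : measurable_fun setT (fun r : R => `|r|%:E).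
    by apply/measurable_EFinP; exact: normr_measurable.
  have N0 (r : R) : 0 <= `|r|%:E by rewrite lee_fin.
  have := gauss2_polar mN N0.
  under eq_integral => z _ do rewrite ger0_norm ?addr_ge0 ?sqr_ge0//.
  move=> ->; apply: eq_integral => x _.
  by rewrite -EFinM ger0_norm// sqr_ge0.
have mfst : measurable_fun setT (fun z : R * R => (z.1 ^+ 2)%:E).
  by apply: (measurableT_comp mX); exact: measurable_fst.
have msnd : measurable_fun setT (fun z : R * R => (z.2 ^+ 2)%:E).
  by apply: (measurableT_comp mX); exact: measurable_snd.
under eq_integral do rewrite EFinD.
rewrite (ge0_integralD _ measurableT (fun z _ => X0 z.1) mfst (fun z _ => X0 z.2) msnd).
have e1 : \int[gauss \x gauss]_z (z.1 ^+ 2)%:E = \int[gauss]_x (x ^+ 2)%:E.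
  rewrite -(gauss2_linear (c := 1%R) (s := 0%R) _ mX X0); last by rewrite expr1n expr0n addr0.
  by apply: eq_integral => z _; rewrite mul1r mul0r addr0.
have e2 : \int[gauss \x gauss]_z (z.2 ^+ 2)%:E = \int[gauss]_x (x ^+ 2)%:E.
  rewrite -(gauss2_linear (c := 0%R) (s := 1%R) _ mX X0); last by rewrite expr1n expr0n add0r.
  by apply: eq_integral => z _; rewrite mul1r mul0r add0r.
rewrite e1 e2; case: (integral _ _ _) => [r|//|//] /=.
by rewrite -EFinD => -[] r2; congr EFin; lra.
Qed.

(** The integrand and the density combine into exp(-x^2), whose integral is sqrt(pi). This value is
    the origin of the bound sqrt(2) on [l]. *)
Lemma gauss_exp_half : \int[gauss]_x (expR (- x ^+ 2 / 2))%:E = ((Num.sqrt 2)^-1)%:E.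
Proof.
have mE : measurable_fun setT (fun x : R => (expR (- x ^+ 2 / 2))%:E).
  apply/measurable_EFinP; apply: measurableT_comp => //.
  by apply: measurable_funM => //; apply: measurable_funN; exact: measurable_funX.
rewrite ge0_integral_gauss//.
have pk : normal_peak 1 = ((Num.sqrt pi)^-1 * (Num.sqrt 2)^-1 :> R)%R.
  by rewrite /normal_peak expr1n mul1r -mulr_natr sqrtrM ?pi_ge0// invfM.
transitivity (\int[mu]_x ((normal_peak 1)%:E * (gauss_fun x)%:E)).
  apply: eq_integral => x _; rewrite phiE -EFinM mulrCA -expRD /gauss_fun.
  by congr (_ * expR _)%:E; field.
rewrite ge0_integralZl//; last 3 first.
- by apply/measurable_EFinP; exact: measurable_gauss_fun.
- by move=> x _; rewrite lee_fin gauss_fun_ge0.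
- by rewrite lee_fin normal_peak_ge0.
transitivity ((normal_peak 1)%:E * \int[@lebesgue_measure R]_x (gauss_fun x)%:E).
  congr (_ * _); apply: (ge0_integral_pushforward (@measurable_to_real R)) => //.
    by apply/measurable_EFinP; exact: measurable_gauss_fun.
  by move=> x _; rewrite lee_fin gauss_fun_ge0.
rewrite integralT_gauss -EFinM pk mulrAC mulVf ?mul1r//.
by rewrite gt_eqF// sqrtr_gt0 pi_gt0.
Qed.

End gauss.

(** * Counting zeros *)

Section counting_points.
Variable R : realType.
Implicit Types (S : set R) (s : seq R).

(** Cardinality bounds are phrased with duplicate-free lists, so that unions and Rolle's theorem can
    be used before finiteness of the set is known. *)
Definition at_most S k :=
  forall s, uniq s -> (forall x, x \in s -> S x) -> (size s <= k)%N.

Definition at_least S k :=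
  exists s, [/\ uniq s, forall x, x \in s -> S x & (k <= size s)%N].

Lemma at_most_sub S S' k : S `<=` S' -> at_most S' k -> at_most S k.
Proof. by move=> SS' h s us hs; apply: h => // x /hs /SS'. Qed.

Lemma at_least_sub S S' k : S `<=` S' -> at_least S k -> at_least S' k.
Proof. by move=> SS' [s [us hs ks]]; exists s; split => // x /hs /SS'. Qed.

Lemma at_least0 S : at_least S 0.
Proof. by exists [::]. Qed.

Lemma at_mostU S S' k k' : at_most S k -> at_most S' k' ->
  at_most (S `|` S') (k + k').
Proof.
move=> h h' s us hs.
rewrite -(count_predC (fun x => `[< S x >])) leq_add// -size_filter.
  by apply: h; [exact: filter_uniq|move=> x; rewrite mem_filter => /andP[/asboolP]].
apply: h'; first exact: filter_uniq.
by move=> x; rewrite mem_filter/= => /andP[/asboolPn nSx /hs[]].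
Qed.

Lemma at_leastU S S' k k' : S `&` S' = set0 -> at_least S k -> at_least S' k' ->
  at_least (S `|` S') (k + k').
Proof.
move=> SS' [s [us hs ks]] [s' [us' hs' ks']]; exists (s ++ s'); split.
- rewrite cat_uniq us us' andbT/=; apply/hasPn => x /hs' S'x; apply/negP => /hs Sx.
  by have : (S `&` S') x by []; rewrite SS'.
- by move=> x; rewrite mem_cat => /orP[/hs|/hs'] ?; [left|right].
- by rewrite size_cat leq_add.
Qed.

Lemma at_most_bigcup (F : nat -> set R) (k : nat) m :
  (forall i, at_most (F i) k) -> at_most (\bigcup_(i < m) F i) (m * k).
Proof.
move=> h; elim: m => [|m IH].
  by case=> [//|x s] _ /(_ x); rewrite mem_head => /(_ isT)[].
apply: (@at_most_sub _ (\bigcup_(i < m) F i `|` F m)).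
  move=> x [i /=]; rewrite ltnS leq_eqVlt => /orP[/eqP ->|im] Fx; [by right|].
  by left; exists i.
by rewrite mulSn addnC; exact: at_mostU.
Qed.

Lemma at_least_bigcup (F : nat -> set R) m :
  (forall i, (i < m)%N -> at_least (F i) 1) -> trivIset setT F ->
  at_least (\bigcup_(i < m) F i) m.
Proof.
move=> + tF; elim: m => [|m IH] h; first exact: at_least0.
have {}IH := IH (fun i im => h i (ltnW im)).
apply: (@at_least_sub (\bigcup_(i < m) F i `|` F m)).
  by move=> x [[i /= im Fx]|Fx]; [exists i => //=; rewrite ltnS ltnW|exists m => /=].
rewrite -addn1; apply: at_leastU => //; last exact: h.
rewrite -subset0 => x [[i /= im Fi] Fm].
have iE : i = m by apply: tF => //; exists x.
by rewrite iE ltnn in im.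
Qed.

Lemma counting_at_most S k : at_most S k -> (counting S <= k%:R%:E :> \bar R)%E.
Proof.
move=> h; have [fS|iS] := pselect (finite_set S).
  rewrite /counting asboolT// lee_fin ler_nat.
  apply: h; first exact: fset_uniq.
  by move=> x; rewrite -[_ \in _]/(x \in fset_set S) in_fset_set// => /set_mem.
have [C CS Ck] := infinite_set_fset k.+1 iS.
have : (#|` C| <= k)%N by apply: h; [exact: fset_uniq|move=> x; exact: CS].
by move=> /(leq_trans Ck); rewrite ltnn.
Qed.

Lemma counting_at_least S k : at_least S k -> (k%:R%:E <= counting S :> \bar R)%E.
Proof.
move=> [s [us hs ks]]; rewrite /counting; case: asboolP => [fS|_]; last exact: leey.
rewrite lee_fin ler_nat (leq_trans ks)//.
by apply: uniq_leq_size => // x xs; rewrite -[_ \in _]/(x \in fset_set S) in_fset_set//; exact/mem_set/hs.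
Qed.

End counting_points.

(** * Zeros of a sum of few frequencies, by repeated use of Rolle's theorem *)

Section rolle.
Variable R : realType.
Implicit Types (f : R -> R) (I : set R).

(** Once the zeros are sorted, each gap contains a zero of the derivative in its interior, so these
    are strictly increasing and one fewer. *)
Lemma rolle_at_most f (df : R -> R) I k : is_interval I ->
  (forall x, I x -> is_derive x 1 f (df x)) ->
  at_most (I `&` [set x | df x = 0]) k -> at_most (I `&` [set x | f x = 0]) k.+1.
Proof.
move=> itvI dfI h s us hs.
pose s1 := sort <=%R s.
have sz : size s1 = size s by rewrite size_sort.
have ss1 : sorted <%R s1 by rewrite sort_lt_sorted.
have hs1 x : x \in s1 -> I x /\ f x = 0 by rewrite mem_sort => /hs.
rewrite -sz; case: s1 ss1 hs1 {sz} => [//|x s1] /= ss1 hs1.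
suff [s2 [s2p s2s hs2]] : exists s2, [/\ path <%R x s2, size s2 = size s1 &
    forall y, y \in s2 -> I y /\ df y = 0].
  rewrite ltnS -s2s; apply: h; last exact: hs2.
  by apply: (sorted_uniq lt_trans ltxx); exact: path_sorted s2p.
elim: s1 x ss1 hs1 => [x _ _|y s1 IH x /= /andP[xy ys1] hs1]; first by exists [::].
have [|s2 [s2p s2s hs2]] := IH y ys1; first by move=> z zs; apply: hs1; rewrite inE zs orbT.
have [Ix fx] : I x /\ f x = 0 by apply: hs1; rewrite mem_head.
have [Iy fy] : I y /\ f y = 0 by apply: hs1; rewrite !inE eqxx orbT.
have Ixy z : x <= z <= y -> I z by exact: itvI.
have [|||c cxy dc] := @Rolle _ f x y xy.
- move=> z /[!in_itv]/= /andP[xz zy].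
  by have [] : is_derive z 1 f (df z) by apply: dfI; apply: Ixy; rewrite !ltW.
- apply: derivable_within_continuous => z /[!in_itv]/= zxy.
  by have [] : is_derive z 1 f (df z) by apply: dfI; exact: Ixy.
- by rewrite fx fy.
move: cxy; rewrite in_itv/= => /andP[xc cy].
have Ic : I c by apply: Ixy; rewrite !ltW.
exists (c :: s2); split => /=.
- rewrite xc; case: s2 s2p {s2s hs2} => [//|z s2] /= /andP[yz ->].
  by rewrite (lt_trans cy yz).
- by rewrite s2s.
- move=> z; rewrite inE => /orP[/eqP ->|/hs2//]; split => //.
  have dfc := dfI _ Ic.
  by rewrite -(@derive_val _ _ _ _ _ _ _ dfc) (@derive_val _ _ _ _ _ _ _ dc).
Qed.

(** With u = cos(w (x - m)), positive on [I], one has u (f'' + w^2 f) = (u^2 (f / u)')'. Two uses of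
    Rolle's theorem thus pass from f to f'' + w^2 f. This operator kills the frequency [w] at the
    cost of two zeros, whereas differentiation kills only constants. *)
Lemma rolle_harmonic f (df ddf : R -> R) I (m w : R) k : is_interval I ->
  (forall x, I x -> `|w * (x - m)| < pi / 2) ->
  (forall x, I x -> is_derive x 1 f (df x)) ->
  (forall x, I x -> is_derive x 1 df (ddf x)) ->
  at_most (I `&` [set x | ddf x + w ^+ 2 * f x = 0]) k ->
  at_most (I `&` [set x | f x = 0]) k.+2.
Proof.
move=> itvI Iw dfI ddfI h.
pose u x := cos (w * (x - m)); pose v x := sin (w * (x - m)).
have u0 x : I x -> 0 < u x.
  by move=> /Iw; rewrite ltr_norml => /andP[? ?]; apply: cos_gt0_pihalf; apply/andP; split.
have du (x : R) : is_derive x 1 u (- w * v x).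
  by apply: is_derive_eq; rewrite /v /GRing.scale/=; ring.
have dv (x : R) : is_derive x 1 v (w * u x).
  by apply: is_derive_eq; rewrite /u /GRing.scale/=; ring.
pose q x := df x * u x + w * (f x * v x).
have dq (x : R) : I x -> is_derive x 1 q ((ddf x + w ^+ 2 * f x) * u x).
  move=> Ix; have := dfI _ Ix; have := ddfI _ Ix => ? ?.
  by apply: is_derive_eq; rewrite /GRing.scale/=; ring.
have dfu (x : R) : I x -> is_derive x 1 (fun x => f x / u x) (q x / u x ^+ 2).
  move=> Ix; have := dfI _ Ix => ?; have ux : u x != 0 by rewrite gt_eqF ?u0.
  have := is_deriveV ux => ?.
  by apply: is_derive_eq; rewrite /GRing.scale/= /q; field.
apply: (@at_most_sub _ _ (I `&` [set x | f x / u x = 0])).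
  by move=> x [Ix /= ->]; rewrite mul0r.
apply: rolle_at_most dfu _ => //.
apply: (@at_most_sub _ _ (I `&` [set x | q x = 0])).
  move=> x [Ix /= /eqP]; rewrite mulf_eq0 invr_eq0 sqrf_eq0 (gt_eqF (u0 _ Ix)) orbF.
  by move=> /eqP.
apply: rolle_at_most dq _ => //.
apply: at_most_sub h => x [Ix /= /eqP]; rewrite mulf_eq0 (gt_eqF (u0 _ Ix)) orbF.
by move=> /eqP.
Qed.

Definition osc (w c s : R) (x : R) : R := c * cos (w * x) + s * sin (w * x).

Lemma is_derive_osc (w c s x : R) : is_derive x 1 (osc w c s) (osc w (s * w) (- c * w) x).
Proof.
rewrite /osc; apply: is_derive_eq; rewrite !scaler1 /GRing.scale/=; ring.
Qed.

(** Two zeros make (c, s) a solution of a homogeneous linear system with determinant sin(w (x2 -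
    x1)), and this is nonzero because the two points are less than pi / w apart. *)
Lemma osc_at_most1 (w c s m : R) I : 0 < w -> (c != 0) || (s != 0) ->
  (forall x, I x -> `|w * (x - m)| < pi / 2) ->
  at_most (I `&` [set x | osc w c s x = 0]) 1.
Proof.
move=> w0 cs Iw [//|x1 [//|x2 r]] /= /andP[]; rewrite inE negb_or => /andP[x12 _] _ h.
exfalso.
have [I1 z1] : I x1 /\ osc w c s x1 = 0 by apply: h; rewrite mem_head.
have [I2 z2] : I x2 /\ osc w c s x2 = 0 by apply: h; rewrite !inE eqxx orbT.
have d0 : sin (w * x2 - w * x1) != 0.
  wlog lt12 : x1 x2 x12 h I1 I2 z1 z2 / x1 < x2.
    move=> W; case: (ltgtP x1 x2) => [?|?|x12E]; first exact: W.
      rewrite -opprB sinN oppr_eq0; apply: W => //; first by rewrite eq_sym.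
      by move=> x; rewrite !inE orbCA => ?; apply: h; rewrite !inE.
    by rewrite x12E eqxx in x12.
  rewrite gt_eqF// sin_gt0_pi//; move: (Iw _ I1) (Iw _ I2); rewrite !ltr_norml.
  move=> /andP[a1 a2] /andP[a3 a4]; have : w * x1 < w * x2 by rewrite ltr_pM2l.
  by move: a1 a2 a3 a4; rewrite !mulrBr => *; apply/andP; split; lra.
have eq1 : c * sin (w * x2 - w * x1) = 0.
  rewrite sinB; move: z1 z2; rewrite /osc => z1 z2.
  transitivity ((c * cos (w * x1) + s * sin (w * x1)) * sin (w * x2) -
    (c * cos (w * x2) + s * sin (w * x2)) * sin (w * x1)); first by ring.
  by rewrite z1 z2 !mul0r subr0.
have eq2 : s * sin (w * x2 - w * x1) = 0.
  rewrite sinB; move: z1 z2; rewrite /osc => z1 z2.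
  transitivity ((c * cos (w * x2) + s * sin (w * x2)) * cos (w * x1) -
    (c * cos (w * x1) + s * sin (w * x1)) * cos (w * x2)); first by ring.
  by rewrite z1 z2 !mul0r subr0.
move: eq1 eq2 cs => /eqP; rewrite mulf_eq0 (negbTE d0) orbF => /eqP -> /eqP.
by rewrite mulf_eq0 (negbTE d0) orbF => /eqP ->; rewrite eqxx.
Qed.

(** Here 6 = 1 + 2 + 2 + 1: a derivative removes the constant, two harmonic operators remove the
    frequencies 1 and n, and what remains at frequency n + 1 has at most one zero. *)
Lemma osc_sum_at_most6 (n : nat) (c0 c1 s1 c2 s2 c3 s3 m : R) I : (1 < n)%N ->
  is_interval I -> (c3 != 0) || (s3 != 0) ->
  (forall x, I x -> `|n.+1%:R * (x - m)| < pi / 2) ->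
  at_most (I `&` [set x | c0 + osc 1 c1 s1 x + osc n%:R c2 s2 x
                             + osc n.+1%:R c3 s3 x = 0]) 6.
Proof.
move=> n1 itvI c3s3 Iw; set N : R := n%:R; set M : R := n.+1%:R.
have M0 : 0 < M by rewrite ltr0n.
have MN : M = N + 1 by rewrite /M -natr1.
have N1 : 1 < N by rewrite ltr1n.
have Iw' w : 0 <= w <= M -> forall x, I x -> `|w * (x - m)| < pi / 2.
  move=> /andP[w0 wM] x /Iw; apply: le_lt_trans; rewrite !normrM.
  by rewrite ler_wpM2r// !ger0_norm// ltW.
pose D1 x := osc 1 s1 (- c1) x + osc N (s2 * N) (- c2 * N) x
   + osc M (s3 * M) (- c3 * M) x.
have oscD := @is_derive_osc.
apply: (@rolle_at_most _ D1 I) => //.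
  move=> x _; have := oscD 1 c1 s1 x; have := oscD N c2 s2 x; have := oscD M c3 s3 x => ? ? ?.
  by apply: is_derive_eq; rewrite /D1 !mulr1 add0r mul1r.
pose D2 x := osc 1 (- c1) (- s1) x + osc N (- c2 * N * N) (- (s2 * N) * N) x
   + osc M (- c3 * M * M) (- (s3 * M) * M) x.
pose D3 x := osc 1 (- s1) (- - c1) x + osc N (- (s2 * N) * N * N) (- (- c2 * N * N) * N) x
   + osc M (- (s3 * M) * M * M) (- (- c3 * M * M) * M) x.
apply: (@rolle_harmonic D1 D2 D3 I m 1) => //.
- by apply: Iw'; rewrite ler01 MN lerDr ltW// (lt_trans _ N1).
- move=> x _; have := oscD 1 s1 (- c1) x; have := oscD N (s2 * N) (- c2 * N) x.
  have := oscD M (s3 * M) (- c3 * M) x => ? ? ?.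
  by apply: is_derive_eq; rewrite /D2 !mulr1.
- move=> x _; have := oscD 1 (- c1) (- s1) x.
  have := oscD N (- c2 * N * N) (- (s2 * N) * N) x.
  have := oscD M (- c3 * M * M) (- (s3 * M) * M) x => ? ? ?.
  by apply: is_derive_eq; rewrite /D3 !mulr1.
(* Adding the second derivative multiplies a term of frequency w by 1 - w^2; the next operator
   multiplies the top term by [r] = N^2 - M^2. As [q] and [r] are nonzero, the top term survives. *)
pose p := 1 - N ^+ 2; pose q := 1 - M ^+ 2.
apply: (@at_most_sub _ _ (I `&` [set x | osc N (p * s2 * N) (p * - c2 * N) x
    + osc M (q * s3 * M) (q * - c3 * M) x = 0])).
  move=> x [Ix /= h]; split => //=; rewrite -h /D3 /D1 /osc /p /q; ring.
pose F1 x := osc N (p * - c2 * N * N) (- (p * s2 * N) * N) x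
    + osc M (q * - c3 * M * M) (- (q * s3 * M) * M) x.
pose F2 x := osc N (- (p * s2 * N) * N * N) (- (p * - c2 * N * N) * N) x
    + osc M (- (q * s3 * M) * M * M) (- (q * - c3 * M * M) * M) x.
apply: (@rolle_harmonic _ F1 F2 I m N) => //.
  by apply: Iw'; rewrite MN lerDl ler01 andbT ltW// (lt_trans _ N1).
pose r := N ^+ 2 - M ^+ 2.
apply: (@at_most_sub _ _ (I `&` [set x | osc M (r * q * s3 * M) (r * q * - c3 * M) x = 0])).
  move=> x [Ix /= h]; split => //=; rewrite -h /F2 /osc /r; ring.
apply: osc_at_most1 => //; last by apply: Iw'; rewrite lexx ltW.
have r0 : r != 0 by rewrite /r MN lt_eqF//; nra.
have q0 : q != 0 by rewrite /q MN lt_eqF//; nra.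
by rewrite !mulf_eq0 oppr_eq0 (negbTE r0) (negbTE q0) (gt_eqF M0) !orbF/= orbC.
Qed.

End rolle.

(** * Zeros of a sinusoid with slowly varying amplitude, minus a slowly varying level *)

Section good_cell.
Variable R : realType.

Lemma sin_cos_alternate (i : nat) (z : R) :
  cos (i%:R * pi + z) = (-1) ^+ i * cos z /\ sin (i%:R * pi + z) = (-1) ^+ i * sin z.
Proof.
elim: i => [|i [IHc IHs]]; first by rewrite mul0r add0r expr0 !mul1r.
have -> : i.+1%:R * pi + z = i%:R * pi + z + pi :> R by rewrite -natr1; ring.
by rewrite cosDpi sinDpi IHc IHs exprS !mulN1r !mulNr.
Qed.

Lemma abs_cos_alternate (i : nat) (z : R) : `|cos (i%:R * pi + z)| = `|cos z|.
Proof. by have [-> _] := sin_cos_alternate i z; rewrite normrM normr_sign mul1r. Qed.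

(** A cos + B sin is written as r cos(. - phi) with a signed [r], so the phase matters only modulo
    pi and can be placed just below any given [x]. It is a zero of A sin - B cos, which changes sign
    over a half period. *)
Lemma polar_phase (A0 B0 x : R) : exists r phi,
  [/\ A0 = r * cos phi, B0 = r * sin phi, r ^+ 2 = A0 ^+ 2 + B0 ^+ 2
    & 0 <= x - phi < pi].
Proof.
pose f z : R := A0 * sin z - B0 * cos z.
suff [phi fphi xphi] : exists2 phi, f phi = 0 & 0 <= x - phi < pi.
  have sc := sin2cos2 phi : sin phi ^+ 2 = 1 - cos phi ^+ 2.
  move: fphi; rewrite /f => /eqP; rewrite subr_eq0 => /eqP h.
  exists (A0 * cos phi + B0 * sin phi), phi; split => //.
  - transitivity (A0 * (cos phi ^+ 2 + sin phi ^+ 2)); first by rewrite sc; ring.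
    transitivity (A0 * cos phi ^+ 2 + (A0 * sin phi) * sin phi); first by ring.
    by rewrite h; ring.
  - transitivity (B0 * (cos phi ^+ 2 + sin phi ^+ 2)); first by rewrite sc; ring.
    transitivity ((B0 * cos phi) * cos phi + B0 * sin phi ^+ 2); first by ring.
    by rewrite -h; ring.
  - transitivity ((A0 ^+ 2 + B0 ^+ 2) * (cos phi ^+ 2 + sin phi ^+ 2)
       - (A0 * sin phi - B0 * cos phi) ^+ 2); first by ring.
    by rewrite h subrr sc; ring.
have fx : f (x - pi) = - f x by rewrite /f sinB cosB cospi sinpi; ring.
have [fx0|fx0] := eqVneq (f x) 0.
  by exists x => //; rewrite subrr lexx pi_gt0.
have [|||phi] := @IVT R f (x - pi) x 0.
- by rewrite gerBl pi_ge0.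
- apply: derivable_within_continuous => z _.
  by apply: ex_derive; exact: is_derive_eq.
- rewrite fx ge_min le_max oppr_le0 oppr_ge0.
  by case/orP: (le_total 0 (f x)) => ->; rewrite ?orbT.
rewrite in_itv/= => /andP[p1 p2] fphi; exists phi => //.
rewrite subr_ge0 p2/= lt_neqAle; apply/andP; split; last by lra.
apply/eqP => e; have e' : phi = x - pi by lra.
by move: fphi; rewrite e' fx => /eqP; rewrite oppr_eq0 (negbTE fx0).
Qed.

(** Cosine is monotone on the half period. Between two zeros in one half period the cosine therefore
    stays small, which forces the sine to be large. *)
Lemma abs_cos_between (z1 z z2 c : R) : 0 <= z1 -> z1 <= z -> z <= z2 -> z2 <= pi ->
  `|cos z1| <= c -> `|cos z2| <= c -> `|cos z| <= c.
Proof.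
move=> z10 z1z zz2 z2p; rewrite !ler_norml => /andP[_ c1] /andP[c2 _].
have I (a : R) : 0 <= a -> a <= pi -> a \in `[0, pi] by move=> *; rewrite in_itv/=; apply/andP.
have h (a b : R) : 0 <= a -> a <= b -> b <= pi -> cos b <= cos a.
  move=> a0 ab bp; have aI := I _ a0 (le_trans ab bp); have bI := I _ (le_trans a0 ab) bp.
  by rewrite leNgt ltr_cos// -leNgt.
apply/andP; split.
  by apply: (le_trans c2); apply: h => //; exact: le_trans z1z.
by apply: le_trans c1; apply: h => //; exact: le_trans z2p.
Qed.

Lemma opposite_signs (x y s v e : R) : `|x - (s - v)| <= e -> `|y - (- s - v)| <= e ->
  `|v| + e < `|s| -> x < 0 < y \/ y < 0 < x.
Proof.
have := ler_norm v; have := ler_norm (- v); rewrite normrN => v1 v2.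
rewrite !ler_norml => /andP[g1 g2] /andP[g3 g4].
by case: (ger0P s) => ? ?; [right|left]; apply/andP; split; lra.
Qed.

Variables (A B V dA dB dV : R -> R) (n : nat) (p h A0 B0 V0 e K c : R).
Hypothesis n0 : (0 < n)%N.
Hypothesis h0 : 0 < h.
Hypothesis derA : forall t : R, is_derive t 1 A (dA t).
Hypothesis derB : forall t : R, is_derive t 1 B (dB t).
Hypothesis derV : forall t : R, is_derive t 1 V (dV t).
Hypothesis closeA : forall t, p <= t <= p + h -> `|A t - A0| <= e.
Hypothesis closeB : forall t, p <= t <= p + h -> `|B t - B0| <= e.
Hypothesis closeV : forall t, p <= t <= p + h -> `|V t - V0| <= e.
Hypothesis bndA : forall t, p <= t <= p + h -> `|dA t| <= K.
Hypothesis bndB : forall t, p <= t <= p + h -> `|dB t| <= K.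
Hypothesis bndV : forall t, p <= t <= p + h -> `|dV t| <= K.
Hypothesis c0 : 0 < c.
Hypothesis cD : c ^+ 2 + (`|V0| + 3 * e) ^+ 2 <= A0 ^+ 2 + B0 ^+ 2.
Hypothesis cn : 2 * e * n%:R + 3 * K < n%:R * c.

Let G t := A t * cos (n%:R * t) + B t * sin (n%:R * t) - V t.
Let dG t := dA t * cos (n%:R * t) + dB t * sin (n%:R * t) - dV t
  + n%:R * (B t * cos (n%:R * t) - A t * sin (n%:R * t)).

Let derG (t : R) : is_derive t 1 G (dG t).
Proof.
have := derA t; have := derB t; have := derV t => ? ? ?.
by rewrite /G; apply: is_derive_eq; rewrite /GRing.scale/= /dG; ring.
Qed.

Let N0 : 0 < n%:R :> R. Proof. by rewrite ltr0n. Qed.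

Let mulcos (x y : R) : `|x * cos y| <= `|x|.
Proof. by rewrite normrM ler_piMr// ler_norml cos_geN1 cos_le1. Qed.

Let mulsin (x y : R) : `|x * sin y| <= `|x|.
Proof. by rewrite normrM ler_piMr// ler_norml sin_geN1 sin_le1. Qed.

Let e0 : 0 <= e.
Proof. by apply: le_trans (closeA (t := p) _) => //; rewrite lexx lerDl ltW. Qed.

(** On the cell, [G] is within 3e of r cos(nt - phi) - V0, its derivative is close to - n r sin(nt -
    phi), and |r| exceeds |V0| + 3e. So each half period holds one zero, apart from boundary
    effects, and the cell contains n h / pi half periods up to rounding. *)
Lemma good_cell_zeros : exists k l : nat,
  [/\ at_most (`[p, p + h[ `&` [set t | G t = 0]) k,
      k%:R <= n%:R * h / pi + 2,
      at_least (`[p, p + h[ `&` [set t | G t = 0]) l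
    & n%:R * h / pi - 2 <= l%:R].
Proof.
have [r [phi [Ar Br r2 /andP[xp0 xppi]]]] := polar_phase A0 B0 (n%:R * p).
have pi0 := @pi_gt0 R.
have Gr t : p <= t <= p + h -> `|G t - (r * cos (n%:R * t - phi) - V0)| <= 3 * e.
  move=> tJ; rewrite cosB.
  have -> : G t - (r * (cos (n%:R * t) * cos phi + sin (n%:R * t) * sin phi) - V0) =
    (A t - A0) * cos (n%:R * t) + (B t - B0) * sin (n%:R * t) - (V t - V0).
    by rewrite /G Ar Br; ring.
  have := le_trans (mulcos (A t - A0) (n%:R * t)) (closeA tJ).
  have := le_trans (mulsin (B t - B0) (n%:R * t)) (closeB tJ).
  have := closeV tJ; rewrite !ler_norml => /andP[? ?] /andP[? ?] /andP[? ?].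
  by apply/andP; split; lra.
have dGr t : p <= t <= p + h ->
    `|dG t + n%:R * (r * sin (n%:R * t - phi))| <= 2 * e * n%:R + 3 * K.
  move=> tJ; rewrite sinB.
  have -> : dG t + n%:R * (r * (sin (n%:R * t) * cos phi - cos (n%:R * t) * sin phi)) =
    dA t * cos (n%:R * t) + dB t * sin (n%:R * t) - dV t
    + n%:R * ((B t - B0) * cos (n%:R * t)) - n%:R * ((A t - A0) * sin (n%:R * t)).
    by rewrite /dG Ar Br; ring.
  have := le_trans (mulcos (dA t) (n%:R * t)) (bndA tJ).
  have := le_trans (mulsin (dB t) (n%:R * t)) (bndB tJ).
  have := bndV tJ.
  have : `|n%:R * ((B t - B0) * cos (n%:R * t))| <= n%:R * e.
    by rewrite normrM gtr0_norm// ler_pM2l// (le_trans (mulcos _ _))// closeB.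
  have : `|n%:R * ((A t - A0) * sin (n%:R * t))| <= n%:R * e.
    by rewrite normrM gtr0_norm// ler_pM2l// (le_trans (mulsin _ _))// closeA.
  rewrite !ler_norml => /andP[? ?] /andP[? ?] /andP[? ?] /andP[? ?] /andP[? ?].
  by apply/andP; split; lra.
have rV : `|V0| + 3 * e < `|r|.
  rewrite -(@ltr_pXn2r _ 2)// ?nnegrE ?addr_ge0 ?mulr_ge0//.
  by rewrite real_normK ?num_real// r2; apply: lt_le_trans cD; rewrite ltrDr exprn_gt0.
(* The extrema of cos(nt - phi), which delimit the half periods. By the choice of [phi], the first
   one is at or before [p] and the second one after it. *)
pose tau (i : nat) := (i%:R * pi + phi) / n%:R.
have ntau i : n%:R * tau i - phi = i%:R * pi.
  by rewrite /tau mulrC divfK ?gt_eqF// addrK.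
have tauS i : tau i < tau i.+1.
  by rewrite /tau ltr_pM2r ?invr_gt0// ltrD2r ltr_pM2r// ltr_nat.
have le_tau i j : (i <= j)%N -> tau i <= tau j.
  by move=> ij; rewrite /tau ler_pM2r ?invr_gt0// lerD2r ler_pM2r// ler_nat.
have taup t i : tau i <= t < tau i.+1 -> 0 <= n%:R * t - phi - i%:R * pi < pi.
  move=> /andP[it ti]; move: (ntau i) (ntau i.+1); rewrite -natr1 => e1 e2.
  have h1 : n%:R * tau i <= n%:R * t by rewrite ler_pM2l.
  have h2 : n%:R * t < n%:R * tau i.+1 by rewrite ltr_pM2l.
  by apply/andP; split; lra.
have tau0 : tau 0%N <= p by rewrite /tau mul0r add0r ler_pdivrMr// mulrC; lra.
(* Between two zeros of the same half period |r cos| is at most |V0| + 3e, hence |r sin| is at least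
   [c] by [cD]. By [cn] the derivative of [G] cannot vanish there, against Rolle's theorem. *)
have one_zero i : at_most (`[p, p + h[ `&` `[tau i, tau i.+1[ `&` [set t | G t = 0]) 1.
  have two t1 t2 : t1 < t2 -> (`[p, p + h[ `&` `[tau i, tau i.+1[ `&` [set t | G t = 0]) t1 ->
      (`[p, p + h[ `&` `[tau i, tau i.+1[ `&` [set t | G t = 0]) t2 -> False.
    move=> t12 [[/= J1 H1] G1] [[/= J2 H2] G2]; rewrite !in_itv/= in J1 H1 J2 H2.
    have Jt t : t1 <= t <= t2 -> p <= t <= p + h.
      by move=> /andP[? ?]; move/andP: J1 => [? ?]; move/andP: J2 => [? ?]; apply/andP; split; lra.
    have cosle t : p <= t <= p + h -> G t = 0 -> `|r * cos (n%:R * t - phi)| <= `|V0| + 3 * e.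
      move=> tJ Gt; move: (Gr _ tJ); rewrite Gt sub0r opprB.
      have := ler_norm V0; have := ler_norm (- V0); rewrite normrN => v1 v2.
      by rewrite !ler_norml => /andP[g1 g2]; apply/andP; split; lra.
    have r0 : 0 < `|r| by apply: le_lt_trans rV; rewrite addr_ge0 ?mulr_ge0.
    have zE t : n%:R * t - phi = i%:R * pi + (n%:R * t - phi - i%:R * pi) by ring.
    have cosle' t : t1 <= t <= t2 -> `|r * cos (n%:R * t - phi)| <= `|V0| + 3 * e.
      move=> /andP[t1t tt2].
      have := cosle _ (Jt t1 _) G1; rewrite lexx (ltW t12) => /(_ isT).
      have := cosle _ (Jt t2 _) G2; rewrite lexx (ltW t12) => /(_ isT).
      rewrite !normrM (zE t) (zE t1) (zE t2) !abs_cos_alternate.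
      rewrite -!ler_pdivlMl// => c2 c1.
      have /andP[z10 _] := taup _ _ H1; have /andP[_ /ltW z2p] := taup _ _ H2.
      apply: (abs_cos_between z10 _ _ z2p) => //.
        by rewrite !lerD2r ler_pM2l.
      by rewrite !lerD2r ler_pM2l.
    suff at0 : at_most (`[t1, t2] `&` [set t | dG t = 0]) 0.
      have /(_ [:: t1; t2]) := rolle_at_most (@interval_is_interval _ _) (fun t _ => derG t) at0.
      rewrite /= inE lt_eqF// => /(_ isT) hh; suff : false by []; apply: hh => t.
      by rewrite in_cons mem_seq1 => /orP[] /eqP ->; split => //=; rewrite in_itv/= lexx (ltW t12).
    move=> [//|t s] _ /(_ t (mem_head _ _))[/=]; rewrite in_itv/= => tt dGt; exfalso.
    have := dGr _ (Jt _ tt); rewrite dGt add0r normrM gtr0_norm// => hh.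
    have : c <= `|r * sin (n%:R * t - phi)|.
      rewrite -(@ler_pXn2r _ 2)// ?nnegrE ?(ltW c0)//.
      rewrite real_normK ?num_real// exprMn sin2cos2 mulrBr mulr1 -exprMn r2.
      rewrite lerBrDr (le_trans _ cD)// lerD2l -real_normK ?num_real//.
      by rewrite ler_pXn2r ?nnegrE ?addr_ge0 ?mulr_ge0//; exact: cosle'.
    rewrite -(ler_pM2l N0) => /le_trans /(_ hh) /le_lt_trans /(_ cn).
    by rewrite ltxx.
  move=> [//|t1 [//|t2 s]] /= /andP[]; rewrite inE negb_or => /andP[t12 _] _ hs.
  have h1 := hs t1 (mem_head _ _); have h2 := hs t2; rewrite !inE eqxx orbT in h2.
  by move: t12; case: ltgtP => // /two => [/(_ h1 (h2 isT))|/(_ (h2 isT) h1)].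
(* At consecutive extrema the sinusoid takes the values r and -r, up to order, and these outweigh
   the level and the errors, so [G] changes sign. Being nonzero at both ends, it has its zero inside
   the half-open window. *)
have some_zero i : p < tau i -> tau i.+1 <= p + h ->
    at_least (`[p, p + h[ `&` `[tau i, tau i.+1[ `&` [set t | G t = 0]) 1.
  move=> pi1 pi2; have ti := tauS i.
  have cosi j : cos (n%:R * tau j - phi) = (-1) ^+ j.
    by rewrite ntau -[j%:R * pi]addr0 (sin_cos_alternate j 0).1 cos0 mulr1.
  have b0 : `|G (tau i) - (r * (-1) ^+ i - V0)| <= 3 * e.
    rewrite -cosi.
    by apply: Gr; apply/andP; split; lra.
  have b1 : `|G (tau i.+1) - (- (r * (-1) ^+ i) - V0)| <= 3 * e.
    rewrite -mulrN -mulN1r -exprS -cosi.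
    by apply: Gr; apply/andP; split; lra.
  have : `|V0| + 3 * e < `|r * (-1) ^+ i| by rewrite normrM normr_sign mulr1.
  move: (r * (-1) ^+ i) b0 b1 => s b0 b1 sV.
  have sgn := opposite_signs b0 b1 sV.
  have [|||z] := @IVT R G (tau i) (tau i.+1) 0.
  - exact: ltW.
  - by apply: derivable_within_continuous => z _; apply: ex_derive.
  - rewrite ge_min le_max.
    by case: sgn => /andP[/ltW -> /ltW ->]; rewrite ?orbT.
  rewrite in_itv/= => /andP[z1 z2] Gz; exists [:: z]; split => // y.
  rewrite inE => /eqP ->; split => //=.
  have [g1 g2] : G (tau i) != 0 /\ G (tau i.+1) != 0.
    by case: sgn => /andP[u v]; rewrite (lt_eqF u) (gt_eqF v).
  have zn1 : tau i != z by apply: contra_neq g1 => ->.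
  have zn2 : z != tau i.+1 by apply: contra_neq g2 => <-.
  rewrite !in_itv/=; split; apply/andP; split => //.
  - by lra.
  - by apply: lt_le_trans pi2; rewrite lt_neqAle zn2.
  - by rewrite lt_neqAle zn2.
pose x := (n%:R * (p + h) - phi) / pi.
have nh0 : 0 < n%:R * h by rewrite mulr_gt0.
have x0 : 0 <= x by rewrite /x divr_ge0 ?ltW// mulrDr; lra.
have xE : x = n%:R * h / pi + (n%:R * p - phi) / pi by rewrite /x -mulrDl; congr (_ / _); ring.
have q0 : 0 <= (n%:R * p - phi) / pi by rewrite divr_ge0 // ltW.
have q1 : (n%:R * p - phi) / pi < 1 by rewrite ltr_pdivrMr// mul1r.
have /andP[mx xm] := truncn_itv x0; set m := Num.truncn x in mx xm.
(* Windows 0 to m cover the cell, and windows 1 to m - 1 lie inside it. For m = 0 the truncated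
   predecessor gives the trivial lower bound 0. *)
exists m.+1, m.-1; split.
- rewrite -[m.+1]muln1; apply: at_most_sub (at_most_bigcup one_zero) => t [/= tJ Gt].
  have tJ' := tJ; move: tJ'; rewrite in_itv/= => /andP[pt tp].
  have y0 : 0 <= (n%:R * t - phi) / pi.
    have : n%:R * p <= n%:R * t by rewrite ler_pM2l.
    by move=> ?; rewrite divr_ge0 ?(ltW pi0)//; lra.
  have /andP[iy yi] := truncn_itv y0; set i := Num.truncn _ in iy yi.
  exists i => /=.
    rewrite -(ltr_nat R) (le_lt_trans iy)// (le_lt_trans _ xm)//.
    by rewrite /x ler_pM2r ?invr_gt0// lerD2r ler_pM2l// ltW.
  split => //; split => //=; rewrite in_itv/= /tau.
  move: iy yi; rewrite ler_pdivlMr// ltr_pdivrMr// => iy yi.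
  by rewrite ler_pdivrMr// ltr_pdivlMr// [t * _]mulrC; apply/andP; split; lra.
- by rewrite -natr1; lra.
- apply: (@at_least_sub _ (\bigcup_(i < m.-1) (`[p, p + h[ `&` `[tau i.+1, tau i.+2[
      `&` [set t | G t = 0]))); first by move=> t [i _ [[]]].
  apply: at_least_bigcup.
    move=> i im; apply: some_zero.
      rewrite /tau ltr_pdivlMr// mulrC -ltrBlDr (lt_le_trans xppi)//.
      by rewrite ler_peMl ?(ltW pi0)// ler1n.
    apply: (@le_trans _ _ (tau m)).
      by apply: le_tau; case: (m) im.
    by rewrite /tau ler_pdivrMr// -lerBrDr -ler_pdivlMr// [_ * n%:R]mulrC.
  apply/trivIsetP => i j _ _; wlog ij : i j / (i < j)%N.
    move=> W nij; case: (ltngtP i j) => [lt|lt|/eqP]; first exact: W.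
      by rewrite setIC; apply: W => //; rewrite eq_sym.
    by rewrite (negbTE nij).
  move=> _; rewrite -subset0 => t [[[_ /= h1] _] [[_ /= h2] _]].
  move: h1 h2; rewrite !in_itv/= => /andP[_ h1] /andP[h2 _].
  by have := lt_le_trans h1 (le_trans (le_tau i.+2 j.+1 ij) h2); rewrite ltxx.
- have : m%:R - 1 <= m.-1%:R :> R by case: (m) => [|k] /=; rewrite ?sub0r ?oppr_le0// -natr1 addrK.
  lra.
Qed.

End good_cell.

(** * The telescoped sum *)

Section two_frequency.
Variable R : realType.
Implicit Types (x : R * R) (z : (R * R) * (R * R)) (alpha beta t : R).

Definition lin x beta := x.1 * cos beta + x.2 * sin beta.

(** The boundary terms at both ends of the telescoped sum have the same shape: A is taken at the
    angle n alpha, and V is the same expression at the angle 0. *)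
Definition amp_cos alpha beta z t :=
  lin z.1 (beta + alpha) - lin z.1 beta * cos t - lin z.2 beta * sin t.

Definition amp_sin alpha beta z t :=
  lin z.2 (beta + alpha) + lin z.1 beta * sin t - lin z.2 beta * cos t.

Definition disc alpha beta z t :=
  amp_cos alpha beta z t ^+ 2 + amp_sin alpha beta z t ^+ 2 - amp_cos alpha 0 z t ^+ 2.

Definition trig_sum alpha z n t :=
  \sum_(1 <= k < n.+1) (lin z.1 (k%:R * alpha) * cos (k%:R * t)
                      + lin z.2 (k%:R * alpha) * sin (k%:R * t)).

Lemma lin_rec x alpha beta :
  lin x (beta + alpha + alpha) = 2 * cos alpha * lin x (beta + alpha) - lin x beta.
Proof.
have -> : beta = (beta + alpha) - alpha by ring.
move: (beta + alpha) => b; rewrite subrK /lin cosB sinB cosD sinD.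
have := cos2Dsin2 alpha => h.
transitivity (2 * cos alpha * (x.1 * cos b + x.2 * sin b) -
  (x.1 * (cos b * cos alpha + sin b * sin alpha) +
   x.2 * (sin b * cos alpha - cos b * sin alpha))); last by ring.
ring.
Qed.

(** The entries satisfy the recurrence u(k+1) + u(k-1) = 2 cos(alpha) u(k) ([lin_rec]), while
    cos(kt) and sin(kt) satisfy it with [t] in place of [alpha]. Multiplication by the difference of
    the two factors leaves boundary terms only. *)
Lemma trig_sum_telescope alpha z n t :
  2 * (cos alpha - cos t) * trig_sum alpha z n t =
  amp_cos alpha (n%:R * alpha) z t * cos (n%:R * t)
  + amp_sin alpha (n%:R * alpha) z t * sin (n%:R * t) - amp_cos alpha 0 z t.
Proof.
elim: n => [|n IH].
  by rewrite /trig_sum big_geq// !mul0r cos0 sin0 !mulr0 mulr1 addr0 subrr.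
rewrite /trig_sum big_nat_recr//= mulrDr -/(trig_sum _ _ _ _) {}IH /amp_cos /amp_sin.
have -> : n.+1%:R * alpha = n%:R * alpha + alpha by rewrite -natr1; ring.
rewrite !lin_rec.
have -> : cos (n%:R * t) = cos (n.+1%:R * t) * cos t + sin (n.+1%:R * t) * sin t.
  by rewrite -cosB; congr cos; rewrite -natr1; ring.
have -> : sin (n%:R * t) = sin (n.+1%:R * t) * cos t - cos (n.+1%:R * t) * sin t.
  by rewrite -sinB; congr sin; rewrite -natr1; ring.
have := cos2Dsin2 t.
move: (cos (n.+1%:R * t)) (sin (n.+1%:R * t)) (lin _ (_ + alpha)) (lin _ (_ + alpha))
  (lin z.1 (n%:R * alpha)) (lin z.2 (n%:R * alpha)) => C S A1 B1 A0 B0 h.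
apply/eqP; rewrite -subr_eq0; apply/eqP.
transitivity ((A0 * C + B0 * S) * (1 - (cos t ^+ 2 + sin t ^+ 2))); last first.
  by rewrite h subrr mulr0.
ring.
Qed.

Definition slow_form alpha z n t := amp_cos alpha (n%:R * alpha) z t * cos (n%:R * t)
  + amp_sin alpha (n%:R * alpha) z t * sin (n%:R * t) - amp_cos alpha 0 z t.

(** Expanding the products leaves just the frequencies 0, 1, n and n + 1, the form to which the
    bound by 6 applies. *)
Lemma slow_formE alpha z n t : slow_form alpha z n t =
  - lin z.1 alpha + osc 1 z.1.1 z.2.1 t
  + osc n%:R (lin z.1 (n%:R * alpha + alpha)) (lin z.2 (n%:R * alpha + alpha)) t
  + osc n.+1%:R (- lin z.1 (n%:R * alpha)) (- lin z.2 (n%:R * alpha)) t.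
Proof.
rewrite /slow_form /amp_cos /amp_sin /osc mul1r add0r.
have -> : n.+1%:R * t = n%:R * t + t by rewrite -natr1; ring.
have lin0 x : lin x 0 = x.1 by rewrite /lin cos0 sin0; ring.
rewrite !lin0 cosD sinD; ring.
Qed.

(** Cut the interval into pieces of length 1 / (n + 1). The phase of the top frequency moves by at
    most 1/2 from the midpoint of a piece, well below pi / 2, so each piece has at most 6 zeros. The
    bound does not depend on the size of [z]. *)
Lemma slow_form_at_most alpha z n (p h : R) : (1 < n)%N -> 0 <= h ->
  (lin z.1 (n%:R * alpha) != 0) || (lin z.2 (n%:R * alpha) != 0) ->
  exists k, at_most (`[p, p + h[ `&` [set t | slow_form alpha z n t = 0]) k /\
    k%:R <= 6 * h * n.+1%:R + 6.
Proof.
move=> n1 h0 top; have N0 : 0 < n.+1%:R :> R by rewrite ltr0n.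
pose m := Num.truncn (h * n.+1%:R).
have /andP[m1 m2] : m%:R <= h * n.+1%:R < m.+1%:R.
  by apply: truncn_itv; rewrite mulr_ge0// ltW.
pose q i : R := p + i%:R / n.+1%:R.
pose F i := `[q i, q i.+1[ `&` [set t | slow_form alpha z n t = 0].
have F6 i : at_most (F i) 6.
  apply: (@at_most_sub _ _ (`[q i, q i.+1[ `&` [set t | - lin z.1 alpha + osc 1 z.1.1 z.2.1 t
    + osc n%:R (lin z.1 (n%:R * alpha + alpha)) (lin z.2 (n%:R * alpha + alpha)) t
    + osc n.+1%:R (- lin z.1 (n%:R * alpha)) (- lin z.2 (n%:R * alpha)) t = 0])).
    by move=> t [tq /=]; rewrite slow_formE.
  apply: (@osc_sum_at_most6 _ _ _ _ _ _ _ _ _ (p + (i%:R + 1 / 2) / n.+1%:R)) => //.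
  - exact: interval_is_interval.
  - by rewrite !oppr_eq0.
  - move=> t /=; rewrite in_itv/= /q => /andP[t1 t2].
    apply: (@lt_le_trans _ _ 1); last exact: pihalf_ge1.
    have -> : n.+1%:R * (t - (p + (i%:R + 1 / 2) / n.+1%:R)) =
      (t - p) * n.+1%:R - (i%:R + 1 / 2) by field; rewrite gt_eqF.
    move: t1 t2; rewrite -lerBrDl -ltrBlDl ler_pdivrMr// ltr_pdivlMr//.
    rewrite -[i.+1%:R]natr1 => t1 t2.
    by rewrite ltr_norml; apply/andP; split; lra.
exists (m.+1 * 6)%N; split; last by rewrite natrM -natr1; lra.
apply: at_most_sub (at_most_bigcup F6) => t [/=].
rewrite in_itv/= => /andP[pt th] Gt.
have y0 : 0 <= (t - p) * n.+1%:R by rewrite mulr_ge0 ?(ltW N0)//; lra.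
have /andP[] := truncn_itv y0; set i := Num.truncn _ => i1 i2; exists i => /=.
  rewrite -(ltr_nat R) (le_lt_trans i1)// (le_lt_trans _ m2)//.
  by rewrite ler_pM2r//; lra.
split => //; rewrite /= in_itv/= /q; apply/andP; split.
  by rewrite -lerBrDl ler_pdivrMr.
by rewrite -ltrBlDl ltr_pdivlMr.
Qed.

Lemma abs_cos_le1 (t : R) : `|cos t| <= 1.
Proof. by rewrite ler_norml cos_geN1 cos_le1. Qed.

Lemma abs_sin_le1 (t : R) : `|sin t| <= 1.
Proof. by rewrite ler_norml sin_geN1 sin_le1. Qed.

Lemma lipschitz_of_derive (f df : R -> R) (K : R) (a b : R) :
  (forall u : R, is_derive u 1 f (df u)) -> (forall u, `|df u| <= K) ->
  `|f a - f b| <= K * `|a - b|.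
Proof.
move=> dfE dfK; wlog ab : a b / a <= b.
  move=> W; case: (leP a b) => [|/ltW]; first exact: W.
  by rewrite (distrC (f a)) (distrC a); exact: W.
have dfab u : u \in `]a, b[ -> is_derive u 1 f (df u) by move=> _; exact: dfE.
have fc : {within `[a, b], continuous f}.
  by apply: derivable_within_continuous => u _; have [] := dfE u.
have [c _ h] := MVT_segment ab dfab fc.
by rewrite distrC h normrM (distrC a) ler_wpM2r.
Qed.

Lemma cos_lip (a b : R) : `|cos a - cos b| <= `|a - b|.
Proof.
rewrite -[leRHS]mul1r; apply: (lipschitz_of_derive (df := fun u => - sin u)).
by move=> u; rewrite normrN abs_sin_le1.
Qed.

Lemma sin_lip (a b : R) : `|sin a - sin b| <= `|a - b|.
Proof.
rewrite -[leRHS]mul1r; apply: (lipschitz_of_derive (df := cos)) => //.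
exact: abs_cos_le1.
Qed.

Definition bounded4 z (K : R) :=
  [/\ `|z.1.1| <= K, `|z.1.2| <= K, `|z.2.1| <= K & `|z.2.2| <= K].

Lemma abs_mul_le (u v a : R) : `|u| <= a -> `|v| <= 1 -> `|u * v| <= a.
Proof. by move=> ua v1; rewrite normrM (le_trans _ ua)// ler_piMr. Qed.

Lemma abs_le_mul (u v a b : R) : `|u| <= a -> `|v| <= b -> `|u * v| <= a * b.
Proof. by move=> ua v1; rewrite normrM ler_pM. Qed.

Lemma lin_bound x beta (K : R) : `|x.1| <= K -> `|x.2| <= K -> `|lin x beta| <= 2 * K.
Proof.
move=> /abs_mul_le/(_ (abs_cos_le1 beta)) + /abs_mul_le/(_ (abs_sin_le1 beta)).
by rewrite /lin !ler_norml => /andP[? ?] /andP[? ?]; apply/andP; split; lra.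
Qed.

Lemma comb3_close (u v w c s e : R) : `|u| <= 2 * e -> `|v| <= e -> `|w| <= e ->
  `|c| <= 1 -> `|s| <= 1 -> `|u - v * c - w * s| <= 4 * e.
Proof.
move=> hu hv hw hc hs; move: hu (abs_mul_le hv hc) (abs_mul_le hw hs).
by rewrite !ler_norml => /andP[? ?] /andP[? ?] /andP[? ?]; apply/andP; split; lra.
Qed.

Section bounds.
Variables (z : (R * R) * (R * R)) (K : R).
Hypothesis zK : bounded4 z K.

Let lin1 beta : `|lin z.1 beta| <= 2 * K.
Proof. by case: zK => *; exact: lin_bound. Qed.

Let lin2 beta : `|lin z.2 beta| <= 2 * K.
Proof. by case: zK => *; exact: lin_bound. Qed.

Let comb (u v w c s : R) : `|u| <= 2 * K -> `|v| <= 2 * K -> `|w| <= 2 * K ->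
  `|c| <= 1 -> `|s| <= 1 -> `|u - v * c - w * s| <= 6 * K.
Proof.
move=> hu hv hw hc hs; move: hu (abs_mul_le hv hc) (abs_mul_le hw hs).
by rewrite !ler_norml => /andP[? ?] /andP[? ?] /andP[? ?]; apply/andP; split; lra.
Qed.

Lemma amp_cos_bound alpha beta t : `|amp_cos alpha beta z t| <= 6 * K.
Proof. by apply: comb => //; [exact: abs_cos_le1|exact: abs_sin_le1]. Qed.

Lemma amp_sin_bound alpha beta t : `|amp_sin alpha beta z t| <= 6 * K.
Proof.
have -> : amp_sin alpha beta z t = lin z.2 (beta + alpha) - lin z.2 beta * cos t
  - lin z.1 beta * (- sin t) by rewrite /amp_sin; ring.
by apply: comb => //; rewrite ?normrN; [exact: abs_cos_le1|exact: abs_sin_le1].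
Qed.

Definition damp_cos (beta t : R) := lin z.1 beta * sin t - lin z.2 beta * cos t.
Definition damp_sin (beta t : R) := lin z.1 beta * cos t + lin z.2 beta * sin t.

Lemma is_derive_amp_cos alpha beta (t : R) :
  is_derive t 1 (amp_cos alpha beta z) (damp_cos beta t).
Proof. by rewrite /amp_cos; apply: is_derive_eq; rewrite /damp_cos /GRing.scale/=; ring. Qed.

Lemma is_derive_amp_sin alpha beta (t : R) :
  is_derive t 1 (amp_sin alpha beta z) (damp_sin beta t).
Proof. by rewrite /amp_sin; apply: is_derive_eq; rewrite /damp_sin /GRing.scale/=; ring. Qed.

Lemma damp_cos_bound beta t : `|damp_cos beta t| <= 4 * K.
Proof.
rewrite /damp_cos; move: (abs_mul_le (lin1 beta) (abs_sin_le1 t)) (abs_mul_le (lin2 beta) (abs_cos_le1 t)).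
by rewrite !ler_norml => /andP[? ?] /andP[? ?]; apply/andP; split; lra.
Qed.

Lemma damp_sin_bound beta t : `|damp_sin beta t| <= 4 * K.
Proof.
rewrite /damp_sin; move: (abs_mul_le (lin1 beta) (abs_cos_le1 t)) (abs_mul_le (lin2 beta) (abs_sin_le1 t)).
by rewrite !ler_norml => /andP[? ?] /andP[? ?]; apply/andP; split; lra.
Qed.

Lemma amp_cos_lip alpha beta s t : `|amp_cos alpha beta z s - amp_cos alpha beta z t| <= 4 * K * `|s - t|.
Proof.
exact: (@lipschitz_of_derive _ _ (4 * K) s t (is_derive_amp_cos alpha beta) (damp_cos_bound beta)).
Qed.

Lemma amp_sin_lip alpha beta s t : `|amp_sin alpha beta z s - amp_sin alpha beta z t| <= 4 * K * `|s - t|.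
Proof.
exact: (@lipschitz_of_derive _ _ (4 * K) s t (is_derive_amp_sin alpha beta) (damp_sin_bound beta)).
Qed.

Lemma sqr_diff_le (u v b d : R) : `|u| <= b -> `|v| <= b -> `|u - v| <= d ->
  `|u ^+ 2 - v ^+ 2| <= 2 * b * d.
Proof.
move=> ub vb uvd; rewrite subr_sqr mulrC; apply: abs_le_mul => //.
by apply: le_trans (ler_normD _ _) _; lra.
Qed.

(** Each of the three squares contributes 2 (6 K) (4 K) = 48 K^2. *)
Lemma disc_lip alpha beta s t :
  `|disc alpha beta z s - disc alpha beta z t| <= 144 * K ^+ 2 * `|s - t|.
Proof.
have h1 := sqr_diff_le (amp_cos_bound alpha beta s) (amp_cos_bound alpha beta t) (amp_cos_lip alpha beta s t).
have h2 := sqr_diff_le (amp_sin_bound alpha beta s) (amp_sin_bound alpha beta t) (amp_sin_lip alpha beta s t).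
have h3 := sqr_diff_le (amp_cos_bound alpha 0 s) (amp_cos_bound alpha 0 t) (amp_cos_lip alpha 0 s t).
have e : 2 * (6 * K) * (4 * K * `|s - t|) = 48 * K ^+ 2 * `|s - t| by ring.
move: h1 h2 h3; rewrite !e !ler_norml /disc => /andP[? ?] /andP[? ?] /andP[? ?].
by apply/andP; split; lra.
Qed.

(** Allows n alpha to be replaced by a fixed angle, uniformly in [t]. The square taken at the angle
    0 cancels, and each of the other two contributes 2 (6 K) (8 K) = 96 K^2. *)
Lemma disc_close alpha beta beta' t (k : R) : 0 <= k ->
  `|cos beta - cos beta'| <= k -> `|sin beta - sin beta'| <= k ->
  `|disc alpha beta z t - disc alpha beta' z t| <= 192 * K ^+ 2 * k.
Proof.
move=> k0 ck sk.
have ckD : `|cos (beta + alpha) - cos (beta' + alpha)| <= 2 * k.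
  rewrite !cosD; move: (abs_mul_le ck (abs_cos_le1 alpha)) (abs_mul_le sk (abs_sin_le1 alpha)).
  rewrite !mulrBl !ler_norml => /andP[? ?] /andP[? ?]; apply/andP; split; lra.
have skD : `|sin (beta + alpha) - sin (beta' + alpha)| <= 2 * k.
  rewrite !sinD; move: (abs_mul_le sk (abs_cos_le1 alpha)) (abs_mul_le ck (abs_sin_le1 alpha)).
  rewrite !mulrBl !ler_norml => /andP[? ?] /andP[? ?]; apply/andP; split; lra.
have lin_close x b b' k' : `|x.1| <= K -> `|x.2| <= K -> `|cos b - cos b'| <= k' ->
    `|sin b - sin b'| <= k' -> `|lin x b - lin x b'| <= 2 * K * k'.
  move=> x1 x2 c s; rewrite /lin; move: (abs_le_mul x1 c) (abs_le_mul x2 s).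
  rewrite !mulrBr !ler_norml => /andP[? ?] /andP[? ?]; apply/andP; split; lra.
have [z1 z2 z3 z4] := zK.
have l1 := lin_close _ _ _ _ z1 z2 ck sk.
have l2 := lin_close _ _ _ _ z3 z4 ck sk.
have l3 := lin_close _ _ _ _ z1 z2 ckD skD.
have l4 := lin_close _ _ _ _ z3 z4 ckD skD.
have e4 : 8 * K * k = 4 * (2 * K * k) by ring.
have e2 : 2 * K * (2 * k) = 2 * (2 * K * k) by ring.
rewrite e2 in l3 l4.
have hC : `|amp_cos alpha beta z t - amp_cos alpha beta' z t| <= 8 * K * k.
  rewrite e4; apply: le_trans (comb3_close l3 l1 l2 (abs_cos_le1 t) (abs_sin_le1 t)).
  by rewrite le_eqVlt; apply/orP; left; apply/eqP; congr `|_|; rewrite /amp_cos; ring.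
have hS : `|amp_sin alpha beta z t - amp_sin alpha beta' z t| <= 8 * K * k.
  have s1 : `|- sin t| <= 1 by rewrite normrN abs_sin_le1.
  rewrite e4; apply: le_trans (comb3_close l4 l2 l1 (abs_cos_le1 t) s1).
  by rewrite le_eqVlt; apply/orP; left; apply/eqP; congr `|_|; rewrite /amp_sin; ring.
have h1 := sqr_diff_le (amp_cos_bound alpha beta t) (amp_cos_bound alpha beta' t) hC.
have h2 := sqr_diff_le (amp_sin_bound alpha beta t) (amp_sin_bound alpha beta' t) hS.
have e : 2 * (6 * K) * (8 * K * k) = 96 * K ^+ 2 * k by ring.
move: h1 h2; rewrite !e !ler_norml /disc => /andP[g1 g2] /andP[g3 g4].
by apply/andP; split; lra.
Qed.

End bounds.

End two_frequency.

(** * Zeros in cells, classified by the size and sign of the discriminant *)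

Section cells.
Variable R : realType.
Implicit Types (z : (R * R) * (R * R)) (alpha beta t p h K : R).

Lemma twopi_gt0 : 0 < 2 * pi :> R.
Proof. by rewrite mulr_gt0// pi_gt0. Qed.

Definition unif : probability R R :=
  distribution (uniform_prob twopi_gt0 : probability (measurableTypeR R) R) (@to_real R).

Lemma unif_itv p q : 0 <= p -> p <= q -> q <= 2 * pi ->
  unif `[p, q[%classic = ((q - p) / (2 * pi))%:E.
Proof.
move=> p0 pq q2; transitivity (uniform_prob twopi_gt0 `[p, q[%classic) => //.
rewrite /uniform_prob.
rewrite (eq_integral (fun=> ((2 * pi)^-1)%:E)); last first.
  move=> x /set_mem; rewrite /= in_itv/= => /andP[px xq]; rewrite /uniform_pdf subr0.
  by rewrite (le_trans p0 px) (le_trans (ltW xq) q2).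
rewrite integral_cst//= lebesgue_measure_itv/= lte_fin.
have [lt|] := ltP p q; first by rewrite -EFinB -EFinM mulrC.
by move=> qp; rewrite mule0 (@le_anti _ _ p q) ?pq// subrr mul0r.
Qed.

Lemma measurable_lin d (T : measurableType d) (f g : T -> R) (beta : R) :
  measurable_fun setT f -> measurable_fun setT g ->
  measurable_fun setT (fun w => lin (f w, g w) beta).
Proof.
by move=> mf mg; apply: measurable_funD; apply: measurable_funM.
Qed.

Lemma measurable_cos_comp d (T : measurableType d) (f : T -> R) :
  measurable_fun setT f -> measurable_fun setT (fun w => cos (f w)).
Proof.
move=> mf; apply: (measurableT_comp (f := cos)) => //.
by apply: continuous_measurable_fun => x; exact: continuous_cos.
Qed.

Lemma measurable_sin_comp d (T : measurableType d) (f : T -> R) :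
  measurable_fun setT f -> measurable_fun setT (fun w => sin (f w)).
Proof.
move=> mf; apply: (measurableT_comp (f := sin)) => //.
by apply: continuous_measurable_fun => x; exact: continuous_sin.
Qed.

Lemma measurable_disc_comp d (T : measurableType d) (f : T -> (R * R) * (R * R)) (g : T -> R)
    alpha beta : measurable_fun setT f -> measurable_fun setT g ->
  measurable_fun setT (fun w => disc alpha beta (f w) (g w)).
Proof.
move=> mf mg.
have m1 : measurable_fun setT (fun w => (f w).1) by apply: measurableT_comp mf.
have m2 : measurable_fun setT (fun w => (f w).2) by apply: measurableT_comp mf.
have m11 : measurable_fun setT (fun w => (f w).1.1) by apply: measurableT_comp m1.
have m12 : measurable_fun setT (fun w => (f w).1.2) by apply: measurableT_comp m1.
have m21 : measurable_fun setT (fun w => (f w).2.1) by apply: measurableT_comp m2.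
have m22 : measurable_fun setT (fun w => (f w).2.2) by apply: measurableT_comp m2.
have l1 b : measurable_fun setT (fun w => lin (f w).1 b) by exact: measurable_lin.
have l2 b : measurable_fun setT (fun w => lin (f w).2 b) by exact: measurable_lin.
have mc := measurable_cos_comp mg; have ms := measurable_sin_comp mg.
have mC b : measurable_fun setT (fun w => amp_cos alpha b (f w) (g w)).
  by apply: measurable_funB; [apply: measurable_funB => //|]; exact: measurable_funM.
have mS b : measurable_fun setT (fun w => amp_sin alpha b (f w) (g w)).
  by apply: measurable_funB; [apply: measurable_funD => //|]; exact: measurable_funM.
apply: measurable_funB; first apply: measurable_funD.
- exact: measurable_funX.
- exact: measurable_funX.
- exact: measurable_funX.
Qed.

Lemma measurable_set_lt d (T : measurableType d) (f g : T -> R) :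
  measurable_fun setT f -> measurable_fun setT g -> measurable [set w | f w < g w].
Proof.
move=> mf mg; have mB := measurable_fun_ltr mf mg.
by rewrite -[X in measurable X]setTI; exact: (mB measurableT [set true]).
Qed.

Lemma measurable_disc_pos alpha beta z : measurable [set t | 0 < disc alpha beta z t].
Proof.
apply: measurable_set_lt => //.
exact: measurable_disc_comp.
Qed.

Lemma measurable_disc_small alpha beta z (e : R) :
  measurable [set t | `|disc alpha beta z t| < e].
Proof.
apply: measurable_set_lt => //.
by apply: measurableT_comp => //; exact: measurable_disc_comp.
Qed.

Definition unifr (S : set R) : R := fine (unif S).

Lemma unifr_ge0 S : 0 <= unifr S.
Proof. exact: fine_ge0. Qed.

Lemma unif_fin S : measurable S -> unif S \is a fin_num.
Proof. by move=> mS; exact: fin_num_measure. Qed.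

Lemma unifr_le S S' : measurable S -> measurable S' -> S `<=` S' -> unifr S <= unifr S'.
Proof.
by move=> mS mS' SS'; apply: fine_le; rewrite ?unif_fin//; apply: le_measure => //; exact/mem_set.
Qed.

Lemma unifrU S S' : measurable S -> measurable S' -> S `&` S' = set0 ->
  unifr (S `|` S') = unifr S + unifr S'.
Proof.
by move=> mS mS' SS'; rewrite /unifr measureU// fineD ?unif_fin.
Qed.

Lemma unifr_itv p q : 0 <= p -> p <= q -> q <= 2 * pi ->
  unifr `[p, q[%classic = (q - p) / (2 * pi).
Proof. by move=> *; rewrite /unifr unif_itv. Qed.

Lemma two_piK (x y : R) : 2 * x * (y / (2 * pi)) = x * y / pi.
Proof.
have : pi != 0 :> R by rewrite gt_eqF ?pi_gt0.
by move: (pi : R) => P P0; field.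
Qed.

(** Three cases, by the discriminant at the left end. Above 2 eta, the cell is good and has n h / pi
    = 2 n u zeros up to 2. Below -2 eta, it has none. In between, the whole cell lies in the set
    measured by [b], and the Rolle bound is charged to [b]. The condition with 600 keeps both the
    oscillation of the discriminant and the cross terms of [cD] below eta / 2; those with 16 and 24
    split [cn] into two halves. *)
Lemma cell_count alpha betas z K (eta h c p : R) (n : nat) :
  bounded4 z K -> 0 <= K -> 0 < eta -> 0 < h -> h <= 1 -> 0 <= p -> p + h <= 2 * pi ->
  0 < c -> 2 * c ^+ 2 <= eta -> 600 * K ^+ 2 * h <= eta -> 16 * K * h <= c ->
  24 * K < n%:R * c -> (1 < n)%N ->
  (forall t, `|disc alpha (n%:R * alpha) z t - disc alpha betas z t| <= eta) ->
  (lin z.1 (n%:R * alpha) != 0) || (lin z.2 (n%:R * alpha) != 0) ->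
  let Z := `[p, p + h[ `&` [set t | slow_form alpha z n t = 0] in
  let u := unifr (`[p, p + h[ `&` [set t | 0 < disc alpha betas z t]) in
  let b := unifr (`[p, p + h[ `&` [set t | `|disc alpha betas z t| < 3 * eta]) in
  exists k l, [/\ at_most Z k, at_least Z l,
    k%:R <= 2 * n%:R * u + 96 * n%:R * b + 6
    & 2 * n%:R * u - 2 * n%:R * b - 2 <= l%:R].
Proof.
move=> zK K0 eta0 h0 h1 p0 p2 c0 c2 hK hc nc n1 close top Z u b.
have pi0 := @pi_gt0 R.
have N0 : 0 < n%:R :> R by rewrite ltr0n ltnW.
have mJ : measurable (`[p, p + h[ : set R) by [].
have uJ : unifr `[p, p + h[%classic = h / (2 * pi).
  by rewrite unifr_itv ?lerDl ?(ltW h0)// [p + h]addrC addrK.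
have u0 : 0 <= u by exact: unifr_ge0.
have b0 : 0 <= b by exact: unifr_ge0.
have ule : u <= h / (2 * pi).
  by rewrite -uJ; apply: unifr_le => //; apply: measurableI => //; exact: measurable_disc_pos.
have Jp t : p <= t <= p + h -> `|t - p| <= h.
  by move=> /andP[g1 g2]; rewrite ler_norml; clear - g1 g2; apply/andP; split; lra.
have lipD beta t : p <= t <= p + h ->
    `|disc alpha beta z t - disc alpha beta z p| <= eta / 2.
  move=> tJ; apply: le_trans (disc_lip zK alpha beta t p) _.
  apply: le_trans (ler_wpM2l _ (Jp _ tJ)) _; first by rewrite mulr_ge0// exprn_ge0.
  have : 0 <= K ^+ 2 * h by rewrite mulr_ge0 ?exprn_ge0// ltW.
  by move: hK; rewrite -!mulrA; clear; lra.
have close_p := close p.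
have [Dp|Dp] := lerP (2 * eta) (disc alpha betas z p).
  have Dn : eta <= disc alpha (n%:R * alpha) z p.
    by move: close_p; rewrite ler_norml => /andP[g1 g2]; clear - Dp g1 g2; lra.
  have uE : u = h / (2 * pi).
    rewrite -uJ /u; congr unifr; apply/seteqP; split => [t []//|t tJ]; split => //=.
    have /(lipD betas): p <= t <= p + h.
      by move: tJ; rewrite /= in_itv/= => /andP[-> /ltW ->].
    by rewrite ler_norml => /andP[g1 g2]; clear - eta0 Dp g1 g2; lra.
  have zC := amp_cos_bound zK alpha 0 p.
  have clip (f : R -> R) : (forall s t, `|f s - f t| <= 4 * K * `|s - t|) ->
      forall t, p <= t <= p + h -> `|f t - f p| <= 4 * K * h.
    by move=> hf t tJ; rewrite (le_trans (hf _ _))// ler_wpM2l ?mulr_ge0// Jp.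
  have cD : c ^+ 2 + (`|amp_cos alpha 0 z p| + 3 * (4 * K * h)) ^+ 2 <=
      amp_cos alpha (n%:R * alpha) z p ^+ 2 + amp_sin alpha (n%:R * alpha) z p ^+ 2.
    rewrite sqrrD real_normK ?num_real//.
    have e1 : `|amp_cos alpha 0 z p| * (3 * (4 * K * h)) *+ 2 <= 144 * K ^+ 2 * h.
      apply: (@le_trans _ _ ((6 * K) * (3 * (4 * K * h)) *+ 2)).
        by rewrite lerMn2r/= ler_wpM2r// !mulr_ge0// ltW.
      by rewrite le_eqVlt; apply/orP; left; apply/eqP; ring.
    have e2 : (3 * (4 * K * h)) ^+ 2 <= 144 * K ^+ 2 * h.
      rewrite (_ : _ ^+ 2 = 144 * K ^+ 2 * h * h); last by ring.
      by apply: ler_piMr => //; apply: mulr_ge0 (ltW h0); apply: mulr_ge0; [exact: ler0n|exact: exprn_ge0].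
    have e3 : 600 * K ^+ 2 * h = 600 * (K ^+ 2 * h) by ring.
    have e4 : 144 * K ^+ 2 * h = 144 * (K ^+ 2 * h) by ring.
    move: Dn; rewrite /disc; move: e1 e2 hK; rewrite e3 e4.
    by move: (K ^+ 2 * h) => w; clear - c2 eta0; lra.
  have cn : 2 * (4 * K * h) * n%:R + 3 * (4 * K) < n%:R * c.
    have : 16 * K * h * n%:R <= c * n%:R by rewrite ler_wpM2r// ltW.
    by move: nc; rewrite [n%:R * c]mulrC; clear; lra.
  have [k [l [hk kle hl lle]]] := good_cell_zeros (ltnW n1) h0
    (is_derive_amp_cos z alpha (n%:R * alpha)) (is_derive_amp_sin z alpha (n%:R * alpha))
    (is_derive_amp_cos z alpha 0)
    (clip _ (amp_cos_lip zK alpha (n%:R * alpha))) (clip _ (amp_sin_lip zK alpha (n%:R * alpha)))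
    (clip _ (amp_cos_lip zK alpha 0))
    (fun t _ => damp_cos_bound zK (n%:R * alpha) t) (fun t _ => damp_sin_bound zK (n%:R * alpha) t)
    (fun t _ => damp_cos_bound zK 0 t) c0 cD cn.
  exists k, l; split => //; rewrite uE.
  - apply: (le_trans kle).
    have -> : 2 * n%:R * (h / (2 * pi)) = n%:R * h / pi by exact: two_piK.
    have : 0 <= n%:R * b by rewrite mulr_ge0// ltW.
    by clear; lra.
  - apply: le_trans lle.
    have -> : 2 * n%:R * (h / (2 * pi)) = n%:R * h / pi by exact: two_piK.
    have : 0 <= n%:R * b by rewrite mulr_ge0// ltW.
    by clear; lra.
have [Dm|Dm] := lerP (disc alpha betas z p) (- (2 * eta)).
  have Dn t : p <= t <= p + h -> disc alpha (n%:R * alpha) z t < 0.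
    move=> tJ; move: (close t) (lipD betas t tJ).
    rewrite !ler_norml => /andP[g1 g2] /andP[g3 g4]; clear - eta0 Dm g1 g2 g3 g4; lra.
  have uE : u = 0.
    rewrite /u (_ : _ `&` _ = set0) ?/unifr ?measure0//.
    rewrite -subset0 => t [/=]; rewrite in_itv/= => /andP[pt /ltW tp] D0.
    have /(lipD betas) : p <= t <= p + h by rewrite pt tp.
    by rewrite ler_norml => /andP[g1 g2]; clear - eta0 Dm g1 g2 D0; lra.
  exists 0%N, 0%N; split; last 2 first.
  - by rewrite uE mulr0 add0r addr_ge0// !mulr_ge0// ltW.
  - rewrite uE mulr0 sub0r; have : 0 <= n%:R * b by rewrite mulr_ge0// ltW.
    by lra.
  - move=> [//|t s] _ /(_ t (mem_head _ _))[/=]; rewrite in_itv/= => /andP[pt /ltW tp].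
    have /Dn : p <= t <= p + h by rewrite pt tp.
    rewrite /slow_form /disc.
    move: (amp_cos _ _ _ _) (amp_sin _ _ _ _) (amp_cos _ _ _ _) => V B A D0 /eqP.
    rewrite subr_eq0 => /eqP VE; exfalso.
    (* Cauchy-Schwarz applied to V = A cos(nt) + B sin(nt), which holds at a zero. *)
    have : V ^+ 2 <= A ^+ 2 + B ^+ 2.
      rewrite -VE -subr_ge0; have := cos2Dsin2 (n%:R * t) => cs.
      rewrite (_ : _ - _ = (A * sin (n%:R * t) - B * cos (n%:R * t)) ^+ 2) ?sqr_ge0//.
      apply/eqP; rewrite -subr_eq0; apply/eqP.
      transitivity ((A ^+ 2 + B ^+ 2) * (1 - (cos (n%:R * t) ^+ 2 + sin (n%:R * t) ^+ 2))).
        by ring.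
      by rewrite cs subrr mulr0.
    by clear - D0; lra.
  - exact: at_least0.
have bE : b = h / (2 * pi).
  rewrite -uJ /b; congr unifr; apply/seteqP; split => [t []//|t tJ]; split => //=.
  have /(lipD betas): p <= t <= p + h.
    by move: tJ; rewrite /= in_itv/= => /andP[-> /ltW ->].
  rewrite ler_norml ltr_norml => /andP[g1 g2].
  by clear - g1 g2 Dp Dm eta0; apply/andP; split; lra.
have [k [hk kle]] := slow_form_at_most p n1 (ltW h0) top.
exists k, 0%N; split => //; last 2 first.
- apply: (le_trans kle); rewrite bE.
  have n2 : n.+1%:R <= 2 * n%:R :> R by rewrite -natr1 mulr_natl mulr2n lerD2l ler1n ltnW.
  (* From n + 1 <= 2n the left side is at most 12 n h, that is 24 pi times n h / (2 pi), and pi <=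
     4. *)
  have : 6 * h * n.+1%:R <= 96 * n%:R * (h / (2 * pi)).
    apply: (@le_trans _ _ (6 * h * (2 * n%:R))); first by rewrite ler_wpM2l// mulr_ge0// ltW.
    rewrite (_ : 96 * n%:R * _ = 48 * n%:R * h / pi); last by rewrite -two_piK; ring.
    rewrite ler_pdivlMr//; have p4 : pi <= 4 :> R by have := @pihalf_lt2 R; clear; lra.
    have : n%:R * h * pi <= n%:R * h * 4 by rewrite ler_wpM2l// mulr_ge0// ltW.
    by clear; lra.
  have : 0 <= n%:R * u by rewrite mulr_ge0// ltW.
  by clear; lra.
- have : n%:R * u <= n%:R * b by rewrite ler_wpM2l ?(ltW N0)// bE.
  by rewrite /=; clear; lra.
- exact: at_least0.
Qed.

Lemma unifr_split (S : set R) (a b c : R) : a <= b -> b <= c -> measurable S ->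
  unifr (`[a, c[%classic `&` S) = unifr (`[a, b[%classic `&` S) + unifr (`[b, c[%classic `&` S).
Proof.
move=> ab bc mS; rewrite -unifrU; [|exact: measurableI|exact: measurableI|].
  rewrite -setIUl; congr (unifr (_ `&` _)); apply/seteqP; split => t /=; rewrite !in_itv/=.
    move=> /andP[at_ tc]; case: (ltP t b) => tb; [left|right]; rewrite ?at_ ?tc//.
  by move=> [/andP[-> tb]|/andP[bt ->]]; rewrite ?(lt_le_trans tb)// (le_trans ab)//.
rewrite -subset0 => t [[]]; rewrite /= !in_itv/= => /andP[_ tb] _ [/andP[bt _] _].
by have := lt_le_trans tb bt; rewrite ltxx.
Qed.

(** The rounding errors add up to a multiple of [M], which is chosen without reference to [n]. *)
Lemma cells_count alpha betas z K (eta h c : R) (n M : nat) :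
  bounded4 z K -> 0 <= K -> 0 < eta -> 0 < h -> h <= 1 -> M%:R * h <= 2 * pi ->
  0 < c -> 2 * c ^+ 2 <= eta -> 600 * K ^+ 2 * h <= eta -> 16 * K * h <= c ->
  24 * K < n%:R * c -> (1 < n)%N ->
  (forall t, `|disc alpha (n%:R * alpha) z t - disc alpha betas z t| <= eta) ->
  (lin z.1 (n%:R * alpha) != 0) || (lin z.2 (n%:R * alpha) != 0) ->
  let Z := `[0, M%:R * h[ `&` [set t | slow_form alpha z n t = 0] in
  let u := unifr (`[0, M%:R * h[ `&` [set t | 0 < disc alpha betas z t]) in
  let b := unifr (`[0, M%:R * h[ `&` [set t | `|disc alpha betas z t| < 3 * eta]) in
  exists k l, [/\ at_most Z k, at_least Z l,
    k%:R <= 2 * n%:R * u + 96 * n%:R * b + 6 * M%:R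
    & 2 * n%:R * u - 2 * n%:R * b - 2 * M%:R <= l%:R].
Proof.
move=> zK K0 eta0 h0 h1 Mh c0 c2 hK hc nc n1 close top.
elim: M Mh => [|M IH] Mh.
  exists 0%N, 0%N; rewrite mul0r set_itvco0 !set0I /unifr measure0 /= !mulr0 !addr0 oppr0.
  split => //; [|exact: at_least0|by rewrite !addr0].
  by move=> [//|t s] _ /(_ t (mem_head _ _)).
have SM : M.+1%:R * h = M%:R * h + h by rewrite -natr1 mulrDl mul1r.
have Mh' : M%:R * h <= 2 * pi by rewrite (le_trans _ Mh)// SM lerDl ltW.
have [k [l [hk hl kle lle]]] := IH Mh'.
have p0 : 0 <= M%:R * h by rewrite mulr_ge0// ltW.
have [|k' [l' [hk' hl' kle' lle']]] := @cell_count alpha betas z K eta h c (M%:R * h) n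
  zK K0 eta0 h0 h1 p0 _ c0 c2 hK hc nc n1 close top; first by rewrite -SM.
have ZE : `[0, M.+1%:R * h[ `&` [set t | slow_form alpha z n t = 0] =
  (`[0, M%:R * h[ `&` [set t | slow_form alpha z n t = 0]) `|`
  (`[M%:R * h, M%:R * h + h[ `&` [set t | slow_form alpha z n t = 0]).
  rewrite -setIUl SM; congr (_ `&` _); apply/seteqP; split => t /=; rewrite !in_itv/=.
    by move=> /andP[t0 tc]; case: (ltP t (M%:R * h)) => tb; [left|right]; rewrite ?t0 ?tc.
  by move=> [/andP[-> tb]|/andP[bt ->]]; rewrite ?(lt_trans tb) ?ltrDl// (le_trans p0).
have ph : M%:R * h <= M%:R * h + h by rewrite lerDl ltW.
have sp1 := unifr_split p0 ph (measurable_disc_pos alpha betas z).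
have sp2 := unifr_split p0 ph (measurable_disc_small alpha betas z (3 * eta)).
exists (k + k')%N, (l + l')%N; rewrite ZE SM; split.
- exact: at_mostU.
- apply: at_leastU => //.
  rewrite -subset0 => t [[]]; rewrite /= !in_itv/= => /andP[_ tb] _ [/andP[bt _] _].
  by have := lt_le_trans tb bt; rewrite ltxx.
- rewrite natrD -natr1 sp1 sp2.
  by move: kle kle'; rewrite -!mulrA !mulrDr; clear; lra.
- rewrite natrD -natr1 sp1 sp2.
  by move: lle lle'; rewrite -!mulrA !mulrDr; clear; lra.
Qed.

End cells.

(** * From the telescoped sum back to the original one *)

Section zero_count.
Variable R : realType.
Implicit Types (z : (R * R) * (R * R)) (alpha beta t K : R).

Lemma at_least_setD (S Q : set R) (l m : nat) :
  at_least S l -> at_most (S `&` Q) m -> at_least (S `\` Q) (l - m).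
Proof.
move=> [s [us hs ls]] h; exists [seq x <- s | ~~ `[< Q x >]]; split.
- exact: filter_uniq.
- by move=> x; rewrite mem_filter => /andP[/asboolPn nQ /hs].
- rewrite size_filter leq_subLR (leq_trans ls)//.
  rewrite -(count_predC (fun x => `[< Q x >])) leq_add2r -size_filter.
  apply: h; first exact: filter_uniq.
  by move=> x; rewrite mem_filter => /andP[/asboolP Qx /hs].
Qed.

Lemma at_most1_inj (S : set R) : (forall x y : R, S x -> S y -> x = y) -> at_most S 1.
Proof.
move=> h [//|x [//|y s]] /= /andP[]; rewrite inE negb_or => /andP[/eqP xy _] _ hs.
by exfalso; apply: xy; apply: h; apply: hs; rewrite !inE eqxx ?orbT.
Qed.

Lemma cos_eq_at_most2 (y : R) : at_most (`[0, 2 * pi[ `&` [set t | cos t = y]) 2.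
Proof.
have inj (a b : R) : 0 <= a <= pi -> 0 <= b <= pi -> cos a = cos b -> a = b.
  by move=> ha hb; apply: (can_in_inj (@cosK R)); rewrite in_itv.
apply: (@at_most_sub _ _ ((`[0, pi] `&` [set t | cos t = y]) `|` (`]pi, 2 * pi[ `&` [set t | cos t = y]))).
  move=> t [/=]; rewrite in_itv/= => /andP[t0 t2] ct.
  by case: (leP t pi) => tp; [left|right]; split => //=; rewrite in_itv/= ?t0 ?tp.
rewrite -[2%N]/(1 + 1)%N; apply: at_mostU; apply: at_most1_inj => a b [/=]; rewrite in_itv/= => ha ca.
  by move=> [/=]; rewrite in_itv/= => hb cb; apply: inj => //; rewrite ca cb.
move=> [/=]; rewrite in_itv/= => hb cb.
have c2 (t : R) : cos (2 * pi - t) = cos t.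
  by rewrite -cosN opprB mulr_natl cosB cos2pi sin2pi mulr1 mulr0 addr0.
suff : 2 * pi - a = 2 * pi - b by lra.
apply: inj; rewrite ?c2 ?ca ?cb//.
- by move/andP: ha => [? ?]; apply/andP; split; lra.
- by move/andP: hb => [? ?]; apply/andP; split; lra.
Qed.

Definition zero_set alpha z n := `[0, 2 * pi] `&` [set t | trig_sum alpha z n t = 0].

(** Every zero of the sum is a zero of the telescoped form; the extra 1 is the endpoint 2 pi, which
    the half-open cells omit. *)
Lemma zero_set_upper alpha z n k :
  at_most (`[0, 2 * pi[ `&` [set t | slow_form alpha z n t = 0]) k ->
  at_most (zero_set alpha z n) (k + 1).
Proof.
move=> h; apply: (@at_most_sub _ _ ((`[0, 2 * pi[ `&` [set t | slow_form alpha z n t = 0]) `|` [set 2 * pi])).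
  move=> t [/=]; rewrite in_itv/= => /andP[t0 t2] ft.
  case: (ltgtP t (2 * pi)) t2 => // [lt _|-> _]; last by right.
  left; split; rewrite /= ?in_itv/= ?t0//.
  by rewrite /slow_form -trig_sum_telescope ft mulr0.
by apply: at_mostU => //; apply: at_most1_inj => x y -> ->.
Qed.

(** The telescoping factor cos(alpha) - cos(t) creates at most two spurious zeros per turn. *)
Lemma zero_set_lower alpha z n l :
  at_least (`[0, 2 * pi[ `&` [set t | slow_form alpha z n t = 0]) l ->
  at_least (zero_set alpha z n) (l - 2).
Proof.
move=> h.
apply: (@at_least_sub _ ((`[0, 2 * pi[ `&` [set t | slow_form alpha z n t = 0])
   `\` [set t | cos t = cos alpha])); last first.
  apply: (at_least_setD h); apply: (at_most_sub _ (@cos_eq_at_most2 (cos alpha))).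
  by move=> t [[]].
move=> t [[/= tJ]]; rewrite /slow_form -trig_sum_telescope => /eqP.
rewrite !mulf_eq0 pnatr_eq0/= subr_eq0 => /orP[/eqP -> //|/eqP ft] _; split => //=.
by move: tJ; rewrite !in_itv/= => /andP[-> /ltW ->].
Qed.

(** A crude bound with no restriction on the size of [z], meant for the rare event that the
    coordinates are large. *)
Lemma zero_set_at_most alpha z n : (1 < n)%N ->
  (lin z.1 (n%:R * alpha) != 0) || (lin z.2 (n%:R * alpha) != 0) ->
  exists k, at_most (zero_set alpha z n) k /\ k%:R <= 100 * n%:R :> R.
Proof.
move=> n1 top; have tp := ltW (twopi_gt0 R).
have [k [hk kle]] := slow_form_at_most 0 n1 tp top.
exists (k + 1)%N; split; first by apply: zero_set_upper; rewrite add0r in hk.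
have n2 : 2 <= n%:R :> R by rewrite ler_nat.
have p4 : pi <= 4 :> R by have := @pihalf_lt2 R; lra.
have : pi * n.+1%:R <= 4 * n.+1%:R :> R by rewrite ler_wpM2r.
by rewrite natrD; move: kle; rewrite -natr1; nra.
Qed.

Lemma exists_mesh (T a b : R) : 0 < T -> 0 <= a -> 0 <= b ->
  exists (M : nat) (h : R), [/\ 0 < h, h <= 1, M%:R * h = T, a * h <= 1 & b * h <= 1].
Proof.
move=> T0 a0 b0; pose B := T + a * T + b * T.
have aT : 0 <= a * T by rewrite mulr_ge0// ltW.
have bT : 0 <= b * T by rewrite mulr_ge0// ltW.
have B0 : 0 <= B by rewrite /B !addr_ge0// ltW.
have /andP[_ /ltW BM] := truncn_itv B0.
pose M := (Num.truncn B).+1; rewrite -/M in BM; rewrite /B in BM.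
have M0 : 0 < M%:R :> R by rewrite ltr0n.
exists M, (T / M%:R); split.
- by rewrite divr_gt0.
- by rewrite ler_pdivrMr// mul1r; lra.
- by rewrite mulrC divfK// gt_eqF.
- by rewrite mulrA ler_pdivrMr// mul1r; lra.
- by rewrite mulrA ler_pdivrMr// mul1r; lra.
Qed.

(** The constants depend only on [alpha], [K] and [eta], hence are uniform in the random point [z]
    and in [beta]. This is what permits integration over [z]. *)
Lemma zero_set_count alpha K (eta : R) : 0 <= K -> 0 < eta ->
  exists kappa C : R, exists n0 : nat, 0 < kappa /\ forall n beta z, (n0 <= n)%N ->
  bounded4 z K ->
  `|cos (n%:R * alpha) - cos beta| <= kappa -> `|sin (n%:R * alpha) - sin beta| <= kappa ->
  (lin z.1 (n%:R * alpha) != 0) || (lin z.2 (n%:R * alpha) != 0) ->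
  let u := unifr (`[0, 2 * pi[ `&` [set t | 0 < disc alpha beta z t]) in
  let b := unifr (`[0, 2 * pi[ `&` [set t | `|disc alpha beta z t| < 3 * eta]) in
  exists k l, [/\ at_most (zero_set alpha z n) k, at_least (zero_set alpha z n) l,
    k%:R <= 2 * n%:R * u + 96 * n%:R * b + C
    & 2 * n%:R * u - 2 * n%:R * b - C <= l%:R].
Proof.
move=> K0 eta0; have tp := twopi_gt0 R.
pose c := Num.sqrt (eta / 2) : R.
have c0 : 0 < c by rewrite sqrtr_gt0 divr_gt0.
have c2 : 2 * c ^+ 2 <= eta.
  have e0 : 0 <= eta / 2 by rewrite divr_ge0// ltW.
  by rewrite sqr_sqrtr//; lra.
have K2 : 0 <= K ^+ 2 by exact: exprn_ge0.
have a0 : 0 <= 600 * K ^+ 2 / eta by apply: divr_ge0 (ltW eta0); lra.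
have b0 : 0 <= 16 * K / c by apply: divr_ge0 (ltW c0); lra.
have Mh (M : nat) (h : R) : M%:R * h = 2 * pi -> M%:R * h <= 2 * pi by move=> ->.
have [M [h [h0 h1 hM hK hc]]] := exists_mesh tp a0 b0.
rewrite mulrAC ler_pdivrMr// mul1r in hK.
rewrite mulrAC ler_pdivrMr// mul1r in hc.
(* The tolerance makes the bound of [disc_close] at most [eta], the summand 1 keeping the
   denominator positive for K = 0. The summand 2 of the second constant covers the endpoint 2 pi and
   the two spurious zeros. The rank ensures 24 K < n c. *)
exists (eta / (192 * K ^+ 2 + 1)), (6 * M%:R + 2), (maxn 2 (Num.truncn (24 * K / c)).+1).
have k0 : 0 < 192 * K ^+ 2 + 1 by lra.
have kappa0 : 0 < eta / (192 * K ^+ 2 + 1) by exact: divr_gt0.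
split=> //.
move=> n beta z; rewrite geq_max => /andP[n1 nn] zK cc ss top u b.
have nc : 24 * K < n%:R * c.
  rewrite -ltr_pdivrMr//.
  have /andP[_ hh] : (Num.truncn (24 * K / c))%:R <= 24 * K / c < (Num.truncn (24 * K / c)).+1%:R.
    by apply: truncn_itv; rewrite divr_ge0 ?(ltW c0)// mulr_ge0.
  by apply: lt_le_trans hh _; rewrite ler_nat.
have close t : `|disc alpha (n%:R * alpha) z t - disc alpha beta z t| <= eta.
  apply: le_trans (disc_close zK alpha t (ltW kappa0) cc ss) _.
  by rewrite mulrA ler_pdivrMr// [leLHS]mulrC ler_pM2l// lerDl.
have := @cells_count R alpha beta z K eta h c n M zK K0 eta0 h0 h1 (Mh _ _ hM) c0 c2 hK hc nc n1 close top.
rewrite hM => -[k [l [hk hl kle lle]]].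
exists (k + 1)%N, (l - 2)%N; split.
- exact: zero_set_upper.
- exact: zero_set_lower.
- by rewrite natrD; move: kle; rewrite -/u -/b; clear; lra.
- have : l%:R - 2 <= (l - 2)%:R :> R.
    by rewrite lerBlDr -natrD ler_nat addnC -leq_subLR.
  by move: lle; rewrite -/u -/b; have := ler0n R M; clear; lra.
Qed.

End zero_count.

(** * Multiples of 1 / (m + 1) modulo 2 pi *)

Section kronecker.
Variable R : realType.
Implicit Types alpha beta e : R.

(** Dirichlet's pigeonhole: among M + 1 multiples reduced modulo 2 pi, two fall in the same one of M
    boxes. *)
Lemma small_multiple alpha e : 0 < e -> exists (q : nat) (p : int),
  (0 < q)%N /\ `|q%:R * alpha - p%:~R * (2 * pi)| < e.
Proof.
move=> e0; have tp : 0 < 2 * pi :> R by rewrite mulr_gt0// pi_gt0.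
pose M := (Num.truncn (2 * pi / e)).+1.
have M0 : 0 < M%:R :> R by rewrite ltr0n.
have Me : 2 * pi / M%:R < e.
  rewrite ltr_pdivrMr// [e * _]mulrC -ltr_pdivrMr//.
  by have /andP[_] := truncn_itv (ltW (divr_gt0 tp e0)).
pose y (i : nat) : R := i%:R * alpha / (2 * pi).
pose fr i : R := y i - (Num.floor (y i))%:~R.
have fr01 i : 0 <= fr i < 1.
  have := Num.Theory.floor_itv (y i); rewrite rmorphD/= => /andP[? ?].
  by rewrite /fr subr_ge0 ltrBlDl; apply/andP.
have fM i : 0 <= fr i * M%:R by have /andP[? _] := fr01 i; rewrite mulr_ge0// ltW.
have boxP (i : 'I_M.+1) : (Num.truncn (fr i * M%:R) < M)%N.
  have /andP[_ h] := fr01 i; rewrite -(ltr_nat R).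
  have /andP[tl _] := truncn_itv (fM i); apply: le_lt_trans tl _.
  by rewrite -[ltRHS]mul1r ltr_pM2r.
pose box i : 'I_M := Ordinal (boxP i).
have [inj|] := boolP (injectiveb box).
  by have := leq_card box (elimT (injectiveP _) inj); rewrite !card_ord ltnn.
move=> /injectivePn[i [j ij bij]].
wlog lt : i j ij bij / (i < j)%N.
  move=> W; case: (ltngtP i j) => [lt|lt|eq].
  - exact: (W i j).
  - by apply: (W j i) => //; rewrite eq_sym.
  - by move/eqP: ij; case; exact: val_inj.
exists (j - i)%N, (Num.floor (y j) - Num.floor (y i))%R; split; first by rewrite subn_gt0.
have close : `|fr j - fr i| < M%:R^-1.
  have := congr1 val bij => /= tij.
  have /andP[a1 a2] := truncn_itv (fM i); have /andP[b1 b2] := truncn_itv (fM j).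
  move: a1 a2 b1 b2; rewrite tij -natr1 => a1 a2 b1 b2.
  rewrite -[ltRHS]mul1r ltr_pdivlMr// -{1}(gtr0_norm M0) -normrM mulrBl ltr_norml.
  by apply/andP; split; lra.
have -> : (j - i)%:R * alpha - (Num.floor (y j) - Num.floor (y i))%:~R * (2 * pi) =
    (fr j - fr i) * (2 * pi).
  have yE k : k%:R * alpha = y k * (2 * pi) by rewrite /y divfK// gt_eqF.
  by rewrite natrB ?(ltnW lt)// rmorphB/= mulrBl !yE /fr; ring.
rewrite normrM (gtr0_norm tp); apply: lt_trans Me.
by rewrite mulrC ltr_pM2l.
Qed.

(** Equality would write pi as a quotient of integers; this is why [alpha] is taken rational. *)
Lemma multiple_neq0 (m q : nat) (p : int) : (0 < q)%N ->
  q%:R * m.+1%:R^-1 - p%:~R * (2 * pi) != 0 :> R.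
Proof.
move=> q0; apply/eqP => /eqP; rewrite subr_eq0 => /eqP e.
have m0 : m.+1%:R != 0 :> R by rewrite pnatr_eq0.
have qn : q%:R != 0 :> R by rewrite pnatr_eq0 -lt0n.
have [p0|p0] := eqVneq p 0.
  by move/eqP: e; rewrite p0 mul0r mulf_eq0 invr_eq0 (negbTE m0) (negbTE qn).
apply: (@pi_irrationnal R); apply/rationalP.
have p0' : p%:~R != 0 :> R by rewrite intr_eq0.
have piE : pi = q%:R / (p%:~R * (2 * m.+1)%:R) :> R.
  have qE : q%:R = p%:~R * (2 * pi) * m.+1%:R :> R by rewrite -e divfK.
  rewrite qE natrM (_ : p%:~R * (2 * pi) * m.+1%:R = pi * (p%:~R * (2 * m.+1%:R))); last by ring.
  by rewrite mulfK// !mulf_neq0.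
case: p e p0 p0' piE => p e p0 p0' piE.
  exists q%:Z, (p * (2 * m.+1))%N; by rewrite piE !natrM.
exists (- q%:Z), (p.+1 * (2 * m.+1))%N.
by rewrite piE NegzE rmorphN rmorphN/= mulNr invrN mulrN mulNr !natrM.
Qed.

Lemma cos_sin_addz beta (k : int) :
  cos (beta + k%:~R * (2 * pi)) = cos beta /\ sin (beta + k%:~R * (2 * pi)) = sin beta.
Proof.
have hn (b : R) (n : nat) : cos (b + n%:R * (2 * pi)) = cos b /\ sin (b + n%:R * (2 * pi)) = sin b.
  elim: n b => [|n IH] b; first by rewrite mul0r addr0.
  have -> : b + n.+1%:R * (2 * pi) = (b + 2 * pi) + n%:R * (2 * pi) by rewrite -natr1; ring.
  have [-> ->] := IH (b + 2 * pi).
  by rewrite (mulr_natl pi 2) cosD sinD cos2pi sin2pi !mulr1 !mulr0 subr0 addr0.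
case: k => n; first exact: hn.
rewrite NegzE rmorphN/=; have [h1 h2] := hn (beta + - n.+1%:R * (2 * pi)) n.+1.
by rewrite -h1 -h2 mulNr subrK.
Qed.

Lemma multiples_dense (m N : nat) beta e : 0 < e -> exists n, (N <= n)%N /\
  `|cos (n%:R * m.+1%:R^-1) - cos beta| <= e /\ `|sin (n%:R * m.+1%:R^-1) - sin beta| <= e.
Proof.
move=> e0; pose alpha : R := m.+1%:R^-1; rewrite -/alpha.
suff [n [k [nN h]]] : exists n : nat, exists k : int, (N <= n)%N /\
    `|n%:R * alpha - (beta + k%:~R * (2 * pi))| <= e.
  exists n; split => //; have [<- <-] := cos_sin_addz beta k.
  by split; apply: le_trans h; [exact: cos_lip|exact: sin_lip].
have tp : 0 < 2 * pi :> R by rewrite mulr_gt0// pi_gt0.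
have [q [p [q0 qp]]] := small_multiple alpha e0.
have d0 := multiple_neq0 m p q0; rewrite -/alpha in d0.
set d := (X in `|X| < e) in qp; rewrite -/d in d0.
have stepE k : (N + k * q)%:R * alpha = N%:R * alpha + k%:R * d + (p * k%:Z)%:~R * (2 * pi).
  by rewrite natrD natrM rmorphM/= /d; ring.
(* Starting from N alpha, steps of size |d| < e in the direction of [d] reach, up to one step, any
   lift of [beta] lying at a distance [x] in that direction. *)
have key (j : int) (x : R) : 0 <= x -> x * Num.sg d = beta + j%:~R * (2 * pi) - N%:R * alpha ->
  exists n : nat, exists k : int, (N <= n)%N /\ `|n%:R * alpha - (beta + k%:~R * (2 * pi))| <= e.
  move=> x0 xE; pose k := Num.truncn (x / `|d|).
  exists (N + k * q)%N, (j + p * k%:Z); split; first exact: leq_addr.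
  have dn : 0 < `|d| by rewrite normr_gt0.
  have /andP[k1 k2] := truncn_itv (divr_ge0 x0 (ltW dn)).
  rewrite -/k ler_pdivlMr// in k1; rewrite -/k ltr_pdivrMr// -natr1 in k2.
  have -> : (N + k * q)%:R * alpha - (beta + (j + p * k%:Z)%:~R * (2 * pi)) =
      Num.sg d * (k%:R * `|d| - x).
    have -> : Num.sg d * (k%:R * `|d| - x) = k%:R * (Num.sg d * `|d|) - x * Num.sg d by ring.
    by rewrite -numEsg stepE xE rmorphD/=; ring.
  rewrite normrM normr_sg d0 mul1r; apply: le_trans (ltW qp).
  by rewrite ler_norml; apply/andP; split; lra.
(* In full turns, the position of the start relative to [beta]. Its floor designates the nearest
   lift at or below the start, for negative [d]; the next integer designates one above it, for
   positive [d]. *)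
pose w := (N%:R * alpha - beta) / (2 * pi).
have wE : w * (2 * pi) = N%:R * alpha - beta by rewrite /w divfK// gt_eqF.
have := Num.Theory.floor_itv w; rewrite rmorphD/= => /andP[w1 w2].
case: (ltgtP d 0) d0 => // dd _.
- apply: (key (Num.floor w) ((w - (Num.floor w)%:~R) * (2 * pi))).
    by rewrite mulr_ge0 ?subr_ge0// ltW.
  by rewrite ltr0_sg// mulrBl wE; ring.
- apply: (key (Num.floor w + 1) (((Num.floor w + 1)%:~R - w) * (2 * pi))).
    by rewrite mulr_ge0 ?(ltW tp)// subr_ge0 rmorphD/= ltW.
  by rewrite gtr0_sg// mulrBl wE; ring.
Qed.

End kronecker.

(** * The probability of a positive discriminant *)

Section null_sets.
Local Open Scope ereal_scope.
Context d1 d2 (T1 : measurableType d1) (T2 : measurableType d2) (R : realType).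

Lemma product_measureE2 (m1 : {sigma_finite_measure set T1 -> \bar R})
    (m2 : {sigma_finite_measure set T2 -> \bar R}) (A : set (T1 * T2)) : measurable A ->
  (m1 \x m2) A = \int[m2]_y m1 (ysection A y).
Proof.
move=> mA; have := indic_fubini_tonelli m1 m2 mA.
by rewrite indic_fubini_tonelli_FE// indic_fubini_tonelli_GE.
Qed.

Lemma product_measure_null2 (m1 : {sigma_finite_measure set T1 -> \bar R})
    (m2 : {sigma_finite_measure set T2 -> \bar R}) (A : set (T1 * T2)) (N : set T2) :
  measurable A -> measurable N -> m2 N = 0 ->
  (forall y, ~ N y -> m1 (ysection A y) = 0) -> (m1 \x m2) A = 0.
Proof.
move=> mA mN N0 h; rewrite product_measureE2// -(integral0 m2 setT).
apply: ge0_ae_eq_integral => //; first exact: measurable_fun_ysection.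
by exists N; split => // x /= nx; apply: contrapT => xN; apply: nx => _; exact: h.
Qed.

Lemma measure_indic (mu : {measure set T1 -> \bar R}) (A : set T1) : measurable A ->
  mu A = \int[mu]_x (\1_A x)%:E.
Proof. by move=> mA; rewrite integral_indic// setIT. Qed.

Lemma cvg_prob_pos (P : probability T1 R) (f_ : nat -> T1 -> R) (f : T1 -> R) :
  (forall n, measurable_fun setT (f_ n)) -> measurable_fun setT f ->
  (forall x, f_ ^~ x @ \oo --> f x) -> P [set x | f x = 0%R] = 0 ->
  P [set x | (0 < f_ n x)%R] @[n --> \oo] --> P [set x | (0 < f x)%R].
Proof.
move=> mf_ mf cf f0.
have mp (g : T1 -> R) : measurable_fun setT g -> measurable [set x | (0 < g x)%R].
  by move=> mg; apply: measurable_set_lt.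
have PE (g : T1 -> R) : measurable_fun setT g ->
    P [set x | (0 < g x)%R] = \int[P]_x (\1_[set x | (0 < g x)%R] x)%:E.
  by move=> mg; rewrite integral_indic ?setIT//; exact: mp.
have mi (g : T1 -> R) : measurable_fun setT g ->
    measurable_fun setT (fun x => (\1_[set x | (0 < g x)%R] x)%:E : \bar R).
  by move=> mg; apply/measurable_EFinP; exact/measurable_indic/mp.
rewrite PE//; under eq_fun do rewrite PE//.
have [] // := @dominated_convergence _ _ _ P setT measurableT
  (fun n x => (\1_[set x | (0 < f_ n x)%R] x)%:E) (fun x => (\1_[set x | (0 < f x)%R] x)%:E) (cst 1).
- by move=> n; exact: mi.
- exact: mi.
- exists [set x | f x = 0%R]; split => //.
    by rewrite -[X in measurable X]setTI; exact: (mf measurableT [set 0%R]).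
  move=> x /= nx; apply: contrapT => fx0; apply: nx => _.
  apply: cvg_near_cst.
  have := cf x; have [fx|fx] := ltrP 0%R (f x).
    move=> /cvgrPdist_lt /(_ _ fx); apply: filterS => n hn.
    rewrite !indicE !mem_set//=; move: hn; rewrite ltr_norml => /andP[? ?]; lra.
  have {}fx : (0 < - f x)%R by rewrite oppr_gt0 lt_neqAle fx andbT; exact/eqP.
  move=> /cvgrPdist_lt /(_ _ fx); apply: filterS => n hn.
  rewrite !indicE !memNset//=; move: hn; rewrite ltr_norml => /andP[? ?]; apply/negP; rewrite -leNgt; lra.
- exact: finite_measure_integrable_cst.
- apply: aeW => x n _; rewrite indicE lee_fin; case: (_ \in _) => /=; rewrite ?normr1 ?normr0//.
Qed.

End null_sets.

(** Typing the product as a probability lets products be nested and lemmas on probabilities apply to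
    them. *)
Definition prod_prob d1 d2 (T1 : measurableType d1) (T2 : measurableType d2) (R : realType)
    (P : probability T1 R) (Q : probability T2 R) : probability (T1 * T2)%type R := (P \x Q)%E.

Section prod_prob.
Local Open Scope ereal_scope.
Context d1 d2 (T1 : measurableType d1) (T2 : measurableType d2) (R : realType).
Variables (P : probability T1 R) (Q : probability T2 R).

Lemma prod_probE1 (A : set (T1 * T2)) : prod_prob P Q A = \int[P]_x Q (xsection A x).
Proof. by []. Qed.

Lemma prod_probE2 (A : set (T1 * T2)) : measurable A ->
  prod_prob P Q A = \int[Q]_y P (ysection A y).
Proof. exact: product_measureE2. Qed.

Lemma prod_prob_null1 (A : set (T1 * T2)) : measurable A ->
  (forall x, Q (xsection A x) = 0) -> prod_prob P Q A = 0.
Proof.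
by move=> mA h; rewrite prod_probE1 -(integral0 P setT); apply: eq_integral => x _; exact: h.
Qed.

Lemma integral_prod_prob1 (F : T1 * T2 -> \bar R) : measurable_fun setT F -> (forall z, 0 <= F z) ->
  \int[prod_prob P Q]_z F z = \int[P]_x \int[Q]_y F (x, y).
Proof. by move=> mF F0; exact: (@fubini_tonelli1 _ _ _ _ R P Q F mF F0). Qed.

End prod_prob.

(** Regroups (x1, x2), (y1, y2) into (x1, y1), (x2, y2) by exchanging the two middle variables. At
    angle pi / 2 the discriminant separates the variables in this second grouping. *)
Lemma prod_prob4_swap d (T : measurableType d) (R : realType) (P : probability T R)
    (F : (T * T) * (T * T) -> \bar R) :
  measurable_fun setT F -> (forall z, 0 <= F z)%E ->
  (\int[prod_prob (prod_prob P P) (prod_prob P P)]_z F z =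
  \int[prod_prob P P]_u \int[prod_prob P P]_v F ((u.1, v.1), (u.2, v.2)))%E.
Proof.
move=> mF F0.
have mG : measurable_fun setT (fun x => \int[prod_prob P P]_y F (x, y))%E.
  exact: (measurable_fun_fubini_tonelli_F _ mF).
have G0 x : (0 <= \int[prod_prob P P]_y F (x, y))%E by exact: integral_ge0.
rewrite (integral_prod_prob1 _ _ mF F0) (integral_prod_prob1 _ _ mG G0).
have mperm : measurable_fun setT (fun w : (T * T) * (T * T) => F ((w.1.1, w.2.1), (w.1.2, w.2.2))).
  apply: (measurableT_comp mF).
  by apply: measurable_fun_pair; apply: measurable_fun_pair;
    apply: measurableT_comp => //; apply: measurableT_comp.
rewrite [RHS]integral_prod_prob1; last 2 first.
- exact: (measurable_fun_fubini_tonelli_F _ mperm).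
- by move=> x; exact: integral_ge0.
apply: eq_integral => x1 _.
have mx1 : measurable_fun setT (fun w : (T * T) * T => F ((x1, w.1.1), (w.1.2, w.2))).
  apply: (measurableT_comp mF); apply: measurable_fun_pair.
    by apply: measurable_fun_pair => //; apply: measurableT_comp.
  by apply: measurable_fun_pair => //; apply: measurableT_comp.
transitivity (\int[P]_x2 \int[P]_y1 \int[P]_y2 F ((x1, x2), (y1, y2)))%E.
  apply: eq_integral => x2 _; rewrite integral_prod_prob1//.
  exact: (measurableT_comp mF (measurable_pair1 (x1, x2))).
rewrite (fubini_tonelli (fun w => \int[P]_y2 F ((x1, w.1), (w.2, y2)))%E); last 2 first.
- exact: (measurable_fun_fubini_tonelli_F _ mx1).
- by move=> w; exact: integral_ge0.
apply: eq_integral => y1 _.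
rewrite (@integral_prod_prob1 _ _ _ _ _ P P (fun v => F ((x1, v.1), (y1, v.2))))//.
apply: (measurableT_comp mF); apply: measurable_fun_pair.
  by apply: measurable_fun_pair.
by apply: measurable_fun_pair.
Qed.

Section positive_discriminant.
Variable R : realType.
Implicit Types (z : (R * R) * (R * R)) (alpha beta t K : R).

Definition gauss2 : probability (R * R)%type R := prod_prob (gauss R) (gauss R).
Definition gauss4 : probability ((R * R) * (R * R))%type R := prod_prob gauss2 gauss2.
Definition gauss4_unif : probability (((R * R) * (R * R)) * R)%type R := prod_prob gauss4 (unif R).

Lemma gauss_set1 (x : R) : gauss R [set x] = 0%E.
Proof.
transitivity (normal_prob 0 1 [set x] : \bar R) => //.
move/null_content_dominatesP: (@normal_prob_dominates R 0 1); apply => //.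
exact: lebesgue_measure_set1.
Qed.

(** If [r] is a root, Vieta's relation gives the other one as - l / k - r, so the set is contained
    in two points. *)
Lemma gauss_quadratic (k l m : R) : k != 0 -> gauss R [set y | k * y ^+ 2 + l * y + m = 0] = 0%E.
Proof.
move=> k0.
have mS : measurable [set y : R | k * y ^+ 2 + l * y + m = 0].
  rewrite -[X in measurable X]setTI.
  have mf : measurable_fun setT (fun y : R => k * y ^+ 2 + l * y + m).
    by apply: measurable_funD => //; apply: measurable_funD; apply: measurable_funM.
  exact: (mf measurableT [set 0]).
have [[r /= hr]|hn] := pselect ([set y | k * y ^+ 2 + l * y + m = 0] !=set0); last first.
  rewrite (_ : [set y | _] = set0) ?measure0//; apply: contrapT => h; apply: hn.
  exact/set0P/eqP.
apply/eqP; rewrite -measure_le0.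
apply: (@le_trans _ _ (gauss R ([set r] `|` [set - (l / k) - r]))).
  apply: (@le_measure _ _ _ (gauss R)); [exact: mem_set|exact/mem_set/measurableU|].
  move=> y /= hy; have : (y - r) * (y - (- (l / k) - r)) = 0.
    apply: (mulfI k0); rewrite mulr0.
    transitivity ((k * y ^+ 2 + l * y + m) - (k * r ^+ 2 + l * r + m)); last by rewrite hy hr subrr.
    by field.
  by move/eqP; rewrite mulf_eq0 !subr_eq0 => /orP[] /eqP; [left|right].
apply: le_trans (measureU2 _ _ _) _ => //.
by rewrite [X in (X + _)%E](gauss_set1 r) [X in (_ + X)%E](gauss_set1 (- (l / k) - r)) adde0.
Qed.

Lemma unif_null (A : set R) : measurable A -> finite_set (`[0, 2 * pi] `&` A) -> unif R A = 0%E.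
Proof.
move=> mA fA; transitivity (uniform_prob (twopi_gt0 R) A) => //.
rewrite /uniform_prob integral_uniform_pdf; apply: null_set_integral.
- by apply: measurableI.
- apply: measurable_funTS; apply/measurable_EFinP; exact: measurable_uniform_pdf.
- by rewrite setIC; apply/countable_lebesgue_measure0/finite_set_countable.
Qed.

Lemma at_most_finite (S : set R) k : at_most S k -> finite_set S.
Proof.
move/(@counting_at_most R); rewrite /counting; case: ifPn => [/asboolP//|_].
by rewrite leye_eq.
Qed.

Lemma measurable_preimage1 d (T : measurableType d) (f : T -> R) (y : R) :
  measurable_fun setT f -> measurable [set x | f x = y].
Proof. by move=> mf; rewrite -[X in measurable X]setTI; exact: (mf measurableT [set y]). Qed.

Lemma unif_cos_eq (y : R) : unif R [set t | cos t = y] = 0%E.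
Proof.
apply: unif_null; first by apply: measurable_preimage1; exact: measurable_cos_comp.
have fin := at_most_finite (@cos_eq_at_most2 R y).
apply: (@sub_finite_set _ _ ((`[0, 2 * pi[ `&` [set t | cos t = y]) `|` [set 2 * pi])).
  move=> t [/=]; rewrite !in_itv/= => /andP[t0]; rewrite le_eqVlt => /predU1P[->|t2] ct.
    by right.
  by left; split; rewrite //= t0 t2.
by rewrite finite_setU; split.
Qed.

(* [disc] is quadratic in [z.2.2], with the leading coefficient of the hypothesis. *)
Lemma gauss4_disc_eq0 alpha beta t :
  (sin beta * cos t - sin (beta + alpha)) ^+ 2 + (sin beta * sin t) ^+ 2 != 0 ->
  gauss4 [set z | disc alpha beta z t = 0] = 0%E.
Proof.
set k := (X in X != 0) => k0.
apply: prod_prob_null1.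
  by apply: measurable_preimage1; exact: measurable_disc_comp.
move=> x; apply: prod_prob_null1.
  by apply: measurable_xsection; apply: measurable_preimage1; exact: measurable_disc_comp.
move=> y1.
pose A0 := lin x (beta + alpha) - lin x beta * cos t - y1 * cos beta * sin t.
pose B0 := y1 * cos (beta + alpha) + lin x beta * sin t - y1 * cos beta * cos t.
pose V0 := lin x alpha - x.1 * cos t - y1 * sin t.
rewrite (_ : xsection _ _ = [set y2 | k * y2 ^+ 2 + (2 * B0 * (sin (beta + alpha) - sin beta * cos t)
   - 2 * A0 * (sin beta * sin t)) * y2 + (A0 ^+ 2 + B0 ^+ 2 - V0 ^+ 2) = 0]).
  exact: gauss_quadratic.
rewrite !xsectionE; apply/seteqP; split => y2 /= <-;
  rewrite /disc /amp_cos /amp_sin /lin /k /A0 /B0 /V0 /lin /= add0r cos0 sin0; ring.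
Qed.

(** Outside the null set cos t = 1 or -1, where sin t is nonzero, a vanishing leading coefficient
    forces sin beta = 0 and then sin(beta + alpha) = 0. *)
Lemma gauss4_unif_disc_eq0 alpha beta : (sin beta != 0) || (sin (beta + alpha) != 0) ->
  gauss4_unif [set w | disc alpha beta w.1 w.2 = 0] = 0%E.
Proof.
move=> h; have mcos (y : R) : measurable [set t : R | cos t = y].
  by apply: measurable_preimage1; exact: measurable_cos_comp.
apply: (product_measure_null2 (N := [set t | cos t = 1] `|` [set t | cos t = - 1])).
- by apply: measurable_preimage1; exact: measurable_disc_comp.
- exact: measurableU.
- apply/eqP; rewrite -measure_le0; apply: le_trans (measureU2 _ _ _) _ => //.
  by rewrite [X in (X + _)%E](unif_cos_eq 1) [X in (_ + X)%E](unif_cos_eq (- 1)) adde0.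
move=> t nt; rewrite (_ : ysection _ _ = [set z | disc alpha beta z t = 0]); last exact: ysectionE.
apply: gauss4_disc_eq0; apply/eqP => /eqP.
rewrite paddr_eq0 ?sqr_ge0// !sqrf_eq0 mulf_eq0 => /andP[/eqP e /orP[/eqP s0|/eqP st]].
  by move: h e; rewrite s0 eqxx/= mul0r sub0r => h /eqP; rewrite oppr_eq0 (negbTE h).
apply: nt; have := cos2Dsin2 t; rewrite st expr0n addr0 => /eqP.
by rewrite sqrf_eq1 => /orP[] /eqP ct; [left|right].
Qed.

Definition prob_pos alpha beta : R := fine (gauss4_unif [set w | 0 < disc alpha beta w.1 w.2]).

Lemma prob_pos_cvg (a b : nat -> R) alpha beta :
  (sin beta != 0) || (sin (beta + alpha) != 0) ->
  a n @[n --> \oo] --> alpha -> b n @[n --> \oo] --> beta ->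
  prob_pos (a n) (b n) @[n --> \oo] --> prob_pos alpha beta.
Proof.
move=> h ca cb; apply: fine_cvg; rewrite fineK; last by apply: fin_num_measure; apply: measurable_set_lt => //; exact: measurable_disc_comp.
apply: cvg_prob_pos => //.
- by move=> n; exact: measurable_disc_comp.
- exact: measurable_disc_comp.
- move=> [z t] /=.
  have ct (u : nat -> R) (v : R) : u n @[n --> \oo] --> v -> cos (u n) @[n --> \oo] --> cos v.
    by move=> uv; apply: (cvg_comp _ _ uv); exact: continuous_cos.
  have st (u : nat -> R) (v : R) : u n @[n --> \oo] --> v -> sin (u n) @[n --> \oo] --> sin v.
    by move=> uv; apply: (cvg_comp _ _ uv); exact: continuous_sin.
  have ll (u : nat -> R) (v : R) x : u n @[n --> \oo] --> v -> lin x (u n) @[n --> \oo] --> lin x v.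
    move=> uv; apply: cvgD; apply: cvgM; [exact: cvg_cst|exact: ct|exact: cvg_cst|exact: st].
  have cab : b n + a n @[n --> \oo] --> beta + alpha by exact: cvgD.
  have lab x := ll _ _ x cab.
  have lb x := ll _ _ x cb.
  have amc (u : nat -> R) (v : R) : u n @[n --> \oo] --> v -> amp_cos (a n) (u n) z t @[n --> \oo] --> amp_cos alpha v z t.
    move=> uv; apply: cvgB; first apply: cvgB.
    - by apply: ll; exact: cvgD.
    - by apply: cvgM; [exact: ll|exact: cvg_cst].
    - by apply: cvgM; [exact: ll|exact: cvg_cst].
  have ams : amp_sin (a n) (b n) z t @[n --> \oo] --> amp_sin alpha beta z t.
    apply: cvgB; first apply: cvgD.
    - exact: lab.
    - by apply: cvgM; [exact: lb|exact: cvg_cst].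
    - by apply: cvgM; [exact: lb|exact: cvg_cst].
  have sq (u : nat -> R) (v : R) : u n @[n --> \oo] --> v -> u n ^+ 2 @[n --> \oo] --> v ^+ 2.
    by move=> uv; apply: cvgM.
  apply: cvgB; first apply: cvgD; apply: sq; [exact: amc|exact: ams|].
  by apply: amc; exact: cvg_cst.
- exact: gauss4_unif_disc_eq0.
Qed.

(** At the angle 0 the terms A and V coincide, so the discriminant is the square B^2. *)
Lemma prob_pos0 alpha : sin alpha != 0 -> prob_pos alpha 0 = 1.
Proof.
move=> s0; have m0 : measurable [set w | disc alpha 0 w.1 w.2 = 0].
  by apply: measurable_preimage1; exact: measurable_disc_comp.
rewrite /prob_pos (_ : [set w | _] = ~` [set w | disc alpha 0 w.1 w.2 = 0]).
  rewrite probability_setC// gauss4_unif_disc_eq0 ?sube0//.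
  by rewrite add0r s0 orbT.
apply/seteqP; split => w /=; first by move=> + e; rewrite e ltxx.
rewrite /disc addrAC subrr add0r lt0r sqr_ge0 andbT => h; exact/eqP.
Qed.

(** For each [t] with cos t different from 1, positivity says that the square of a standard Gaussian
    linear form in (x1, y1) is smaller than the squared norm of the independent pair (x2, y2).
    Conditionally on the form X this has probability exp(-X^2 / 2), whose mean is 1 / sqrt(2),
    whatever [t]. *)
Lemma prob_pos_pihalf : prob_pos 0 (pi / 2) = (Num.sqrt 2)^-1.
Proof.
have mD : measurable [set w : _ * R | 0 < disc 0 (pi / 2) w.1 w.2].
  by apply: measurable_set_lt => //; exact: measurable_disc_comp.
suff h : gauss4_unif [set w | 0 < disc 0 (pi / 2) w.1 w.2] = ((Num.sqrt 2)^-1)%:E.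
  by rewrite /prob_pos h.
rewrite [LHS]product_measureE2//.
rewrite -[RHS]mule1 -(@probability_setT _ _ _ (unif R)) -integral_cst//.
apply: ge0_ae_eq_integral => //.
- exact: measurable_fun_ysection.
- by move=> t _; rewrite lee_fin invr_ge0.
exists [set t | cos t = 1]; split.
- by apply: measurable_preimage1; exact: measurable_cos_comp.
- exact: unif_cos_eq.
move=> t /= nt; apply: contrapT => ct; apply: nt => _.
have k0 : 0 < 2 * (1 - cos t).
  by rewrite mulr_gt0// subr_gt0 lt_neqAle cos_le1 andbT; exact/eqP.
(* The modulus of 1 - exp(it); dividing by it makes ([c], [s]) a unit vector. *)
pose q := Num.sqrt (2 * (1 - cos t)).
have q0 : 0 < q by rewrite sqrtr_gt0.
have q2 : q ^+ 2 = 2 * (1 - cos t) by rewrite sqr_sqrtr// ltW.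
pose c := (1 - cos t) / q; pose s := - sin t / q.
have cs : c ^+ 2 + s ^+ 2 = 1.
  rewrite /c /s !expr_div_n sqrrN q2.
  have -> : sin t ^+ 2 = (1 - cos t) * (1 + cos t) by rewrite sin2cos2; ring.
  by have := lt0r_neq0 k0; rewrite mulf_eq0 negb_or => /andP[_ ?]; field.
pose S (z : (R * R) * (R * R)) := (c * z.1.1 + s * z.2.1) ^+ 2 < z.1.2 ^+ 2 + z.2.2 ^+ 2.
have mS : measurable [set z | S z].
  have m1 : measurable_fun setT (fun w : (R * R) * (R * R) => w.1) by apply: measurable_fst.
  have m2 : measurable_fun setT (fun w : (R * R) * (R * R) => w.2) by apply: measurable_snd.
  have m11 := measurableT_comp (@measurable_fst _ _ R R) m1.
  have m12 := measurableT_comp (@measurable_snd _ _ R R) m1.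
  have m21 := measurableT_comp (@measurable_fst _ _ R R) m2.
  have m22 := measurableT_comp (@measurable_snd _ _ R R) m2.
  apply: measurable_set_lt.
    apply: measurable_funX; apply: measurable_funD; exact: measurable_funM.
  by apply: measurable_funD; exact: measurable_funX.
rewrite ysectionE (_ : _ @^-1` _ = [set z | S z]); last first.
  have DE z : disc 0 (pi / 2) z t =
      q ^+ 2 * (z.1.2 ^+ 2 + z.2.2 ^+ 2 - (c * z.1.1 + s * z.2.1) ^+ 2).
    have e : q ^+ 2 * (c * z.1.1 + s * z.2.1) ^+ 2 = ((1 - cos t) * z.1.1 - sin t * z.2.1) ^+ 2.
      by rewrite /c /s -exprMn; congr (_ ^+ 2); field; rewrite gt_eqF.
    rewrite mulrBr e q2 /disc /amp_cos /amp_sin /lin !addr0 cos_pihalf sin_pihalf cos0 sin0.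
    transitivity ((z.1.2 ^+ 2 + z.2.2 ^+ 2) * (1 - 2 * cos t + (cos t ^+ 2 + sin t ^+ 2)) -
      ((1 - cos t) * z.1.1 - sin t * z.2.1) ^+ 2); first by ring.
    by rewrite cos2Dsin2; ring.
  by apply/seteqP; split => z; rewrite /= DE pmulr_rgt0 ?exprn_gt0// subr_gt0.
pose F (z : (R * R) * (R * R)) : \bar R :=
  (\1_[set r | (c * z.1.1 + s * z.2.1) ^+ 2 < r] (z.1.2 ^+ 2 + z.2.2 ^+ 2))%:E.
have mF : measurable_fun setT F.
  by apply/measurable_EFinP; exact: (measurable_indic mS).
have F0 z : (0 <= F z)%E by rewrite lee_fin.
transitivity (\int[gauss4]_z F z)%E; first exact: (measure_indic gauss4 mS).
transitivity (\int[gauss2]_u \int[gauss2]_v F ((u.1, v.1), (u.2, v.2)))%E.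
  exact: (prod_prob4_swap (gauss R) mF F0).
transitivity (\int[gauss2]_u (expR (- (c * u.1 + s * u.2) ^+ 2 / 2))%:E)%E.
  by apply: eq_integral => u _; exact: (gauss2_tail (c * u.1 + s * u.2)).
transitivity (\int[gauss R]_x (expR (- x ^+ 2 / 2))%:E)%E; last exact: gauss_exp_half.
apply: (gauss2_linear (g := fun x => (expR (- x ^+ 2 / 2))%:E) cs) => [|x]; last by rewrite lee_fin expR_ge0.
apply/measurable_EFinP; apply: measurableT_comp => //.
by apply: measurable_funM => //; apply: measurable_funN; exact: measurable_funX.
Qed.

End positive_discriminant.

(** * Events of small probability *)

Section small_probability.
Context d (T : measurableType d) (R : realType) (P : probability T R).

Lemma cvg_prob0_witness (S : nat -> set T) (e : R) : 0 < e -> (forall n, measurable (S n)) ->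
  P (S n) @[n --> \oo] --> 0%E -> exists n, (P (S n) <= e%:E)%E.
Proof.
move=> e0 mS /fine_cvg /cvgr0_norm_lt /(_ _ e0) [n _ /(_ n (leqnn n)) /= hn].
exists n; rewrite -[P _]fineK ?fin_num_measure// lee_fin.
exact: le_trans (ler_norm _) (ltW hn).
Qed.

(** Apply [cvg_prob_pos] to 1 / (n + 1) - |f|, whose limit -|f| is never positive and vanishes on a
    null set only. *)
Lemma prob_small (f : T -> R) (e : R) : 0 < e -> measurable_fun setT f ->
  P [set x | f x = 0] = 0%E -> exists2 eta : R, 0 < eta & (P [set x | `|f x| < eta]%R <= e%:E)%E.
Proof.
move=> e0 mf f0.
have mg n : measurable_fun setT (fun x => n.+1%:R^-1 - `|f x|).
  by apply: measurable_funB => //; exact: measurableT_comp.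
have mh : measurable_fun setT (fun x => - `|f x|).
  by apply: measurable_funN; exact: measurableT_comp.
have := @cvg_prob_pos _ _ _ P (fun n x => n.+1%:R^-1 - `|f x|) (fun x => - `|f x|) mg mh.
rewrite (_ : [set x | 0 < - `|f x|] = set0) ?measure0; last first.
  by rewrite -subset0 => x /=; rewrite oppr_gt0 normr_lt0.
move=> h; have [|||n hn] := cvg_prob0_witness e0 _ (h _ _).
- by move=> n; exact: measurable_set_lt.
- by move=> x; rewrite -[X in _ --> X]add0r; apply: cvgB; [exact: cvg_harmonic|exact: cvg_cst].
- rewrite -f0; congr (P _); apply/seteqP; split => x /= /eqP.
    by rewrite oppr_eq0 normr_eq0 => /eqP.
  by move/eqP => ->; rewrite normr0 oppr0.
exists n.+1%:R^-1; first by rewrite invr_gt0.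
rewrite (_ : [set x | _] = [set x | 0 < n.+1%:R^-1 - `|f x|])//.
by apply/seteqP; split => x /=; rewrite subr_gt0.
Qed.

(** Apply [cvg_prob_pos] to |f| / (n + 1) - 1, which tends to -1 everywhere. *)
Lemma prob_large (f : T -> R) (e : R) : 0 < e -> measurable_fun setT f ->
  exists2 K : R, 0 < K & (P [set x | K < `|f x|]%R <= e%:E)%E.
Proof.
move=> e0 mf.
have mg n : measurable_fun setT (fun x => n.+1%:R^-1 * `|f x| - 1).
  by apply: measurable_funB => //; apply: measurable_funM => //; exact: measurableT_comp.
have := @cvg_prob_pos _ _ _ P (fun n x => n.+1%:R^-1 * `|f x| - 1) (fun x => - 1) mg.
rewrite (_ : [set x | 0 < - 1] = set0) ?measure0; last first.
  by rewrite -subset0 => x /=; rewrite oppr_gt0 ltr10.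
move=> h; have [||||n hn] := cvg_prob0_witness e0 _ (h _ _ _).
- by move=> n; exact: measurable_set_lt.
- exact: measurable_cst.
- move=> x; rewrite -[X in _ --> X]add0r; apply: cvgB; last exact: cvg_cst.
  by rewrite -(mul0r `|f x|); apply: cvgM; [exact: cvg_harmonic|exact: cvg_cst].
- rewrite (_ : [set x | _] = set0) ?measure0//.
  by rewrite -subset0 => x /= /eqP; rewrite oppr_eq0 oner_eq0.
exists n.+1%:R; first by rewrite ltr0n.
rewrite (_ : [set x | _] = [set x | 0 < n.+1%:R^-1 * `|f x| - 1])//.
by apply/seteqP; split => x /=; rewrite subr_gt0 ltr_pdivlMl// mulr1.
Qed.

End small_probability.

(** * Choice of [alpha] and [beta] *)

Section parameters.
Variable R : realType.
Implicit Types alpha beta eps l : R.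

(** Continuity at (0, pi / 2) is available although sin(alpha) vanishes there, because sin(beta) =
    1. The limit 2 / sqrt(2) = sqrt(2) is below [l]. *)
Lemma exists_small_alpha l delta : Num.sqrt 2 < l -> 0 < delta ->
  exists m : nat, let alpha := m.+1%:R^-1 in alpha < delta /\ 2 * prob_pos alpha (pi / 2) < l.
Proof.
move=> l2 d0.
have h : prob_pos (n.+1%:R^-1) (pi / 2) @[n --> \oo] --> prob_pos (0 : R) (pi / 2).
  apply: prob_pos_cvg; [|exact: cvg_harmonic|exact: cvg_cst].
  by rewrite sin_pihalf oner_eq0.
have e0 : 0 < l / 2 - prob_pos (0 : R) (pi / 2).
  rewrite prob_pos_pihalf subr_gt0 ltr_pdivlMr//.
  by rewrite -[X in _ * X]sqr_sqrtr// expr2 mulrA mulVf ?mul1r// gt_eqF// sqrtr_gt0.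
have A : \forall n \near \oo, (n.+1%:R^-1 : R) < delta.
  by move/cvgr0_norm_lt: (@cvg_harmonic R) => /(_ _ d0); apply: filterS => n /=; exact: le_lt_trans (ler_norm _).
have B : \forall n \near \oo, 2 * prob_pos (n.+1%:R^-1 : R) (pi / 2) < l.
  move/cvgrPdist_lt: h => /(_ _ e0); apply: filterS => n /=.
  move: (prob_pos 0 _) (prob_pos (n.+1%:R^-1) _) => x y.
  by rewrite ltr_norml => /andP[? ?]; lra.
case: A => N1 _ A; case: B => N2 _ B; exists (maxn N1 N2); split.
  by apply: A; rewrite /= leq_maxl.
by apply: B; rewrite /= leq_maxr.
Qed.

Lemma sin_neq0_small alpha : 0 < alpha <= 1 -> sin alpha != 0.
Proof.
move=> /andP[a0 a1]; rewrite gt_eqF//; apply: sin_gt0_pi; rewrite a0/=.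
by apply: le_lt_trans a1 _; have := @pi_ge2 R; lra.
Qed.

Lemma sin_neq0_or alpha beta : sin alpha != 0 -> (sin beta != 0) || (sin (beta + alpha) != 0).
Proof.
move=> sa; have [s0|//] := eqVneq (sin beta) 0; rewrite /= sinD s0 mul0r add0r mulf_neq0//.
by apply/eqP => c0; have := cos2Dsin2 beta; rewrite s0 c0 expr0n addr0 => /esym/eqP; rewrite oner_eq0.
Qed.

(** The function equals 2 at beta = 0 and is below [l] at pi / 2. *)
Lemma exists_beta l alpha : 0 < alpha <= 1 -> l <= 2 -> 2 * prob_pos alpha (pi / 2) < l ->
  exists beta, 2 * prob_pos alpha beta = l.
Proof.
move=> ha l2 pl; have sa := sin_neq0_small ha.
have nz beta := sin_neq0_or beta sa.
have ct : continuous (fun beta => 2 * prob_pos alpha beta).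
  move=> beta; apply: cvgM; first exact: cvg_cst.
  apply/(@cvg_nbhsP _ R^o) => u cu; apply: prob_pos_cvg => //; exact: cvg_cst.
have [|||b _ hb] := @IVT R (fun beta => 2 * prob_pos alpha beta) 0 (pi / 2) l.
- by rewrite divr_ge0// pi_ge0.
- exact: continuous_subspaceT.
- rewrite prob_pos0// mulr1 /Num.min /Num.max; case: ifP => ?; apply/andP; split; lra.
by exists b.
Qed.

End parameters.

(** * The law of the entries *)

Section gaussian_law.
Local Open Scope ereal_scope.
Variable R : realType.
Local Notation gauss := (gauss R).

Lemma ge0_integral_gauss_opp (f : R -> \bar R) : measurable_fun setT f -> (forall x, 0 <= f x) ->
  \int[gauss]_x f (- x)%R = \int[gauss]_x f x.
Proof.
move=> mf f0.
have mN : measurable_fun setT (fun u : R => (- u)%R) by exact: measurable_funN.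
have mfN : measurable_fun setT (fun x : R => f (- x)%R) by exact: measurableT_comp.
have mg : measurable_fun setT (fun x => f x * (@normal_pdf R 0 1 x)%:E).
  by apply: emeasurable_funM => //; exact: measurable_phiE.
have g0 x : 0 <= f x * (@normal_pdf R 0 1 x)%:E by rewrite mule_ge0// lee_fin normal_pdf_ge0.
rewrite (ge0_integral_gauss mfN (fun x => f0 (- x)%R)) (ge0_integral_gauss mf f0).
rewrite (ge0_integral_opp mg g0).
by apply: eq_integral => x _; rewrite !phiE sqrrN.
Qed.

Lemma normal_prob_affine (m s : R) (A : set R) : (0 < s)%R -> measurable A ->
  normal_prob m s A = gauss [set u | A (s * u + m)%R].
Proof.
move=> s0 mA.
have mA' : measurable [set u : R | A (s * u + m)%R].
  by rewrite -[X in measurable X]setTI; exact: (measurable_affine s m).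
have mi (B : set R) : measurable B -> measurable_fun setT (fun x => (\1_B x)%:E : \bar R).
  by move=> mB; apply/measurable_EFinP; exact: measurable_indic.
rewrite (measure_indic gauss)// ge0_integral_gauss//; last exact: mi.
have mg : measurable_fun setT (fun x : R => (\1_A x)%:E * (normal_pdf m s x)%:E : \bar R).
  apply: emeasurable_funM; first exact: mi.
  by apply/measurable_EFinP; exact: measurable_normal_pdf.
have g0 (x : R) : 0 <= (\1_A x)%:E * (normal_pdf m s x)%:E.
  by rewrite mule_ge0// lee_fin normal_pdf_ge0.
transitivity (\int[@leb R]_x ((\1_A x)%:E * (normal_pdf m s x)%:E)).
  rewrite /normal_prob integral_mkcond.
  transitivity (\int[@lebesgue_measure R]_x ((\1_A x)%:E * (normal_pdf m s x)%:E)).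
    apply: eq_integral => x _; rewrite patchE indicE.
    by case: (x \in A); rewrite ?mul1e ?mul0e.
  by apply/esym; exact: (ge0_integral_pushforward (@measurable_to_real R)).
rewrite (@ge0_integral_affine R s m _ s0 mg g0) -ge0_integralZl//; last 2 first.
- exact: (measurableT_comp mg (measurable_affine s m)).
- by rewrite lee_fin ltW.
apply: eq_integral => x _; rewrite muleCA; congr (_ * _); rewrite -EFinM; congr EFin.
rewrite normal_pdfE ?gt_eqF// phiE /normal_fun addrK exprMn mulrA.
have -> : (- (s ^+ 2 * x ^+ 2) / (s ^+ 2 *+ 2) = - x ^+ 2 / 2)%R by field; rewrite gt_eqF.
congr (_ * _)%R; rewrite /normal_peak expr1n mul1r -mulrnAr sqrtrM ?sqr_ge0//.
by rewrite sqrtr_sqr gtr0_norm// invfM mulrA divff ?mul1r// gt_eqF.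
Qed.

Lemma normal_prob_opp (m s : R) : normal_prob m (- s) = normal_prob m s.
Proof.
apply/funext => A; apply: eq_integral => x _; congr EFin.
have [->|s0] := eqVneq s 0%R; first by rewrite oppr0.
rewrite !normal_pdfE ?oppr_eq0//.
by rewrite /normal_peak /normal_fun sqrrN.
Qed.

Context d (T : measurableType d) (P : probability T R).

(** One affine form for all cases: a Dirac mass is s = 0, and a negative parameter is replaced by
    its absolute value, the density depending on its square only. *)
Lemma gaussian_rvE (X : T -> R) : gaussian_rv P X -> exists m s : R, forall A, measurable A ->
  P (X @^-1` A) = gauss [set u | A (s * u + m)%R].
Proof.
move=> [m [s h]]; exists m, `|s|%R => A mA; rewrite h//.
have [->|s0] := eqVneq s 0%R.
  rewrite normr0 (_ : [set u | _] = if m \in A then setT else set0).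
    rewrite diracE; case: (m \in A); rewrite ?probability_setT ?measure0//.
  apply/seteqP; split => u /=; rewrite mul0r add0r.
    by move=> /mem_set ->.
  by case: ifPn => // /set_mem.
transitivity (normal_prob m `|s|%R A); last by apply: normal_prob_affine; rewrite ?normr_gt0.
by have [ss|ss] := ltrP 0%R s; [rewrite gtr0_norm|rewrite ler0_norm ?normal_prob_opp].
Qed.

Lemma ge0_integral_gaussian_rv (X : T -> R) (m s : R) : measurable_fun setT X ->
  (forall A, measurable A -> P (X @^-1` A) = gauss [set u | A (s * u + m)%R]) ->
  forall f : R -> \bar R, measurable_fun setT f -> (forall x, 0 <= f x) ->
  \int[P]_w f (X w) = \int[gauss]_u f (s * u + m)%R.
Proof.
move=> mX h f mf f0.
transitivity (\int[image_measure P mX]_x f x).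
  by apply/esym; exact: (ge0_integral_pushforward mX).
transitivity (\int[image_measure gauss (measurable_affine s m)]_x f x).
  by apply: eq_measure_integral => A mA _; exact: h.
exact: (ge0_integral_pushforward (measurable_affine s m)).
Qed.

Lemma gauss_affine_second_moment (m s : R) :
  \int[gauss]_u ((s * u + m) ^+ 2)%:E = (s ^+ 2 + m ^+ 2)%:E.
Proof.
have mq (a b : R) : measurable_fun setT (fun u : R => ((a * u + b) ^+ 2)%:E).
  by apply/measurable_EFinP; apply: measurable_funX; exact: measurable_affine.
have q0 (a b u : R) : 0 <= ((a * u + b) ^+ 2)%:E by rewrite lee_fin sqr_ge0.
pose I := \int[gauss]_u ((s * u + m) ^+ 2)%:E.
have IN : \int[gauss]_u ((- s * u + m) ^+ 2)%:E = I.
  rewrite /I -(ge0_integral_gauss_opp (mq s m) (q0 s m)).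
  by apply: eq_integral => u _; rewrite mulrN mulNr.
(* Averaging over u and -u cancels the cross term, so only non-negative functions are integrated. *)
have : I + I = (2 * (s ^+ 2 + m ^+ 2))%:E.
  rewrite -{1}IN -ge0_integralD//.
  transitivity (\int[gauss]_u ((2 * s ^+ 2)%:E * (u ^+ 2)%:E + (2 * m ^+ 2)%:E)).
    by apply: eq_integral => u _; rewrite -EFinM -!EFinD; congr EFin; ring.
  have m2 : measurable_fun setT (fun u : R => (u ^+ 2)%:E).
    by apply/measurable_EFinP; exact: measurable_funX.
  have u20 (u : R) : 0 <= (u ^+ 2)%:E by rewrite lee_fin sqr_ge0.
  have s20 : 0 <= (2 * s ^+ 2)%:E by rewrite lee_fin mulr_ge0// sqr_ge0.
  have m20 : 0 <= (2 * m ^+ 2)%:E by rewrite lee_fin mulr_ge0// sqr_ge0.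
  have ms : measurable_fun setT (fun u : R => (2 * s ^+ 2)%:E * (u ^+ 2)%:E).
    exact: emeasurable_funM.
  have mc : measurable_fun [set: R] (fun=> (2 * m ^+ 2)%:E) by exact: measurable_cst.
  rewrite (ge0_integralD gauss measurableT (fun u _ => mule_ge0 s20 (u20 u)) ms (fun u _ => m20) mc).
  rewrite (ge0_integralZl gauss measurableT m2 (fun u _ => u20 u) s20).
  rewrite gauss_second_moment mule1 integral_cst//.
  rewrite [X in _ + _ * X](_ : _ = 1); last exact: probability_setT.
  by rewrite mule1 -EFinD; congr EFin; ring.
rewrite -/I; clear IN; case: I => [r|//|//]; rewrite -EFinD => -[] r2; congr EFin; lra.
Qed.

End gaussian_law.

Section mean.
Context d (T : measurableType d) (R : realType) (P : probability T R).
Implicit Types (f g : T -> R) (r q k : R).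

(** Integrability travels with the value, since an equality between expectations does not by itself
    provide it. *)
Definition has_mean f r := P.-integrable setT (EFin \o f) /\ (\int[P]_w (f w)%:E = r%:E)%E.

Lemma eq_has_mean f g r q : f =1 g -> r = q -> has_mean f r -> has_mean g q.
Proof. by move=> /funext -> ->. Qed.

Lemma has_meanD f g r q : has_mean f r -> has_mean g q -> has_mean (fun w => f w + g w) (r + q).
Proof.
move=> [fi fr] [gi gq]; split.
  by rewrite (_ : EFin \o _ = (EFin \o f) \+ (EFin \o g))%E//; exact: integrableD.
by rewrite EFinD -fr -gq -integralD_EFin.
Qed.

Lemma has_meanZ f r k : has_mean f r -> has_mean (fun w => k * f w) (k * r).
Proof.
move=> [fi fr]; split.
  by rewrite (_ : EFin \o _ = (fun w => k%:E * (EFin \o f) w)%E)//; exact: integrableZl.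
by rewrite EFinM -fr -integralZl.
Qed.

Lemma has_mean_cst k : has_mean (fun=> k) k.
Proof.
split; first exact: finite_measure_integrable_cst.
rewrite integral_cst//; transitivity (k%:E * 1)%E; last by rewrite mule1.
by congr (_ * _)%E; exact: probability_setT.
Qed.

Lemma has_mean_bounded f k : measurable_fun setT f -> (forall w, `|f w| <= k) -> exists r, has_mean f r.
Proof.
move=> mf fk; have fi : P.-integrable setT (EFin \o f).
  have [ki _] := has_mean_cst k; apply: (le_integrable measurableT _ _ ki).
    exact/measurable_EFinP.
  by move=> w _; rewrite /= lee_fin (le_trans (fk w))// ler_norm.
exists (fine (\int[P]_w (f w)%:E)%E); split => //.
by rewrite fineK//; exact: integrable_fin_num.
Qed.

Lemma has_mean_of_sq f r : measurable_fun setT f ->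
  (\int[P]_w (f w * f w)%:E = r%:E)%E -> has_mean (fun w => f w * f w) r.
Proof.
move=> mf h; split => //; apply/integrableP; split.
  by apply/measurable_EFinP; exact: measurable_funM.
under eq_integral => w _ do rewrite /= ger0_norm ?sqr_ge0// -?expr2 ?sqr_ge0//.
rewrite (eq_integral (fun w => (f w * f w)%:E)) ?h ?ltry//.
Qed.

(** Integrability follows from |fg| <= f^2 + g^2. *)
Lemma has_mean_of_mul f g r a b : measurable_fun setT f -> measurable_fun setT g ->
  has_mean (fun w => f w * f w) a -> has_mean (fun w => g w * g w) b ->
  (\int[P]_w (f w * g w)%:E = r%:E)%E -> has_mean (fun w => f w * g w) r.
Proof.
move=> mf mg fa gb h; split => //; have [fg _] := has_meanD fa gb.
apply: (le_integrable measurableT _ _ fg).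
  by apply/measurable_EFinP; exact: measurable_funM.
move=> w _; rewrite /= lee_fin -!expr2 [leRHS]ger0_norm ?addr_ge0 ?sqr_ge0// ler_norml.
have := sqr_ge0 (f w + g w); have := sqr_ge0 (f w - g w).
have := sqr_ge0 (f w); have := sqr_ge0 (g w).
by move: (f w) (g w) => x y *; apply/andP; split; nra.
Qed.

Lemma has_mean_sq3 f g h (a b c u v w' x y z : R) :
  has_mean (fun w => f w * f w) a -> has_mean (fun w => g w * g w) b ->
  has_mean (fun w => h w * h w) c -> has_mean (fun w => f w * g w) u ->
  has_mean (fun w => f w * h w) v -> has_mean (fun w => g w * h w) w' ->
  has_mean (fun w => (x * f w + y * g w + z * h w) ^+ 2)
    (x ^+ 2 * a + y ^+ 2 * b + z ^+ 2 * c + 2 * x * y * u + 2 * x * z * v + 2 * y * z * w').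
Proof.
move=> ha hb hc hu hv hw.
have := has_meanD (has_meanD (has_meanD (has_meanD (has_meanD (has_meanZ (x ^+ 2) ha)
  (has_meanZ (y ^+ 2) hb)) (has_meanZ (z ^+ 2) hc)) (has_meanZ (2 * x * y) hu))
  (has_meanZ (2 * x * z) hv)) (has_meanZ (2 * y * z) hw).
by congr (has_mean _ _); apply: funext => t; ring.
Qed.

(** The mean is read off from two second moments: those of f + 1 and f differ by 1 + 2m, hence m =
    0. This keeps all integrands non-negative. The sign of the scale is immaterial by symmetry of
    [gauss]. *)
Lemma gaussian_rv_centered f (s2 : R) : measurable_fun setT f -> gaussian_rv P f -> 0 <= s2 ->
  has_mean (fun w => f w ^+ 2) s2 -> has_mean (fun w => (f w + 1) ^+ 2) (s2 + 1) ->
  forall F : R -> \bar R, measurable_fun setT F -> (forall x, 0 <= F x)%E ->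
  (\int[P]_w F (f w) = \int[gauss R]_u F (Num.sqrt s2 * u)%R)%E.
Proof.
move=> mf gf s20 [_ h0] [_ h1] F mF F0.
have [m [s hE]] := gaussian_rvE gf.
have e0 := ge0_integral_gaussian_rv mf hE.
have msq (c : R) : measurable_fun setT (fun x : R => ((x + c) ^+ 2)%:E).
  by apply/measurable_EFinP; apply: measurable_funX; exact: measurable_funD.
have sq0 (c x : R) : (0 <= ((x + c) ^+ 2)%:E)%E by rewrite lee_fin sqr_ge0.
have h0' : s ^+ 2 + m ^+ 2 = s2.
  apply: EFin_inj; rewrite -h0 -gauss_affine_second_moment.
  have := e0 _ (msq 0) (sq0 0).
  under eq_integral do rewrite addr0.
  by move=> ->; apply: eq_integral => u _; rewrite addr0.
have h1' : s ^+ 2 + (m + 1) ^+ 2 = s2 + 1.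
  apply: EFin_inj; rewrite -h1 -gauss_affine_second_moment.
  by rewrite (e0 _ (msq 1) (sq0 1)); apply: eq_integral => u _; rewrite addrA.
have m0 : m = 0 by move: h0' h1'; rewrite sqrrD1; lra.
rewrite (e0 _ mF F0); rewrite m0 expr0n addr0 in h0' *.
have -> : Num.sqrt s2 = `|s| by rewrite -h0' sqrtr_sqr.
case: (ger0P s) => _; first by apply: eq_integral => u _; rewrite addr0.
have mFs : measurable_fun setT (fun u : R => F (- s * u)).
  by apply: (measurableT_comp mF); exact: measurable_funM.
rewrite -(ge0_integral_gauss_opp mFs)//.
by apply: eq_integral => u _; rewrite addr0 mulrNN.
Qed.

End mean.

(** * The Gaussian coordinates of one process *)

Section coordinates.
Context d (T : measurableType d) (R : realType) (P : probability T R).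
Variables (alpha : R) (a : nat -> {RV P >-> R}).

Definition dirac_pair_covariance := forall k l, (0 < k)%N -> (0 < l)%N ->
  ('E_P[a k \* a l] = (cos ((k%:R - l%:R) * alpha))%:E)%E.

(* Cramer's rule for [x1, x2] in [a k = x1 * cos (k * alpha) + x2 * sin (k * alpha)], [k = 1, 2]. *)
Definition coord1 (w : T) := (a 1%N w * sin (2 * alpha) - a 2%N w * sin alpha) / sin alpha.
Definition coord2 (w : T) := (a 2%N w * cos alpha - a 1%N w * cos (2 * alpha)) / sin alpha.
Definition coords (w : T) := (coord1 w, coord2 w).

Hypotheses (ga : gaussian_process a) (ca : centered_process a) (va : dirac_pair_covariance).
Hypothesis sa : sin alpha != 0.

Let mulE k l : (0 < k)%N -> (0 < l)%N ->
  (\int[P]_w (a k w * a l w)%:E = (cos ((k%:R - l%:R) * alpha))%:E)%E.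
Proof. by move=> k0 l0; rewrite -va// unlock. Qed.

Let sqE k : (0 < k)%N -> has_mean P (fun w => a k w * a k w) 1.
Proof.
move=> k0; apply: has_mean_of_sq => //.
by rewrite mulE// subrr mul0r cos0.
Qed.

Let covE k l : (0 < k)%N -> (0 < l)%N ->
  has_mean P (fun w => a k w * a l w) (cos (k%:R * alpha) * cos (l%:R * alpha) +
    sin (k%:R * alpha) * sin (l%:R * alpha)).
Proof.
move=> k0 l0; apply: (has_mean_of_mul _ _ (sqE k0) (sqE l0)) => //.
by rewrite mulE// mulrBl cosB.
Qed.

Let meanE k : (0 < k)%N -> has_mean P (fun w => a k w * 1) 0.
Proof.
move=> k0; apply: (@has_mean_of_mul _ _ _ _ (a k) (fun=> 1) 0 1 1) => //.
- exact: sqE.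
- by rewrite mulr1; exact: has_mean_cst.
- transitivity 'E_P[a k]%E; last exact: ca.
  by rewrite unlock; apply: eq_integral => w _; rewrite mulr1.
Qed.

(** As cos((k - l) alpha) is the scalar product of the unit vectors at the angles k alpha and l
    alpha, the second moment of a combination of entries is the squared length of the same
    combination of those vectors. *)
Lemma mean_sq_comb3 k l m (x y z : R) : (0 < k)%N -> (0 < l)%N -> (0 < m)%N ->
  has_mean P (fun w => (x * a k w + y * a l w + z * a m w) ^+ 2)
    ((x * cos (k%:R * alpha) + y * cos (l%:R * alpha) + z * cos (m%:R * alpha)) ^+ 2 +
     (x * sin (k%:R * alpha) + y * sin (l%:R * alpha) + z * sin (m%:R * alpha)) ^+ 2).
Proof.
move=> k0 l0 m0.
have := has_mean_sq3 x y z (covE k0 k0) (covE l0 l0) (covE m0 m0) (covE k0 l0) (covE k0 m0) (covE l0 m0).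
by congr (has_mean _ _ _); ring.
Qed.

Lemma mean_sq_comb1 (x y : R) :
  has_mean P (fun w => (x * a 1%N w + y * a 2%N w + 1) ^+ 2)
    ((x * cos alpha + y * cos (2 * alpha)) ^+ 2 +
     (x * sin alpha + y * sin (2 * alpha)) ^+ 2 + 1).
Proof.
have h1 : has_mean P (fun=> 1 * 1) 1 by rewrite mulr1; exact: has_mean_cst.
apply: eq_has_mean (has_mean_sq3 x y 1 (covE (ltn0Sn 0) (ltn0Sn 0)) (covE (ltn0Sn 1) (ltn0Sn 1)) h1
  (covE (ltn0Sn 0) (ltn0Sn 1)) (meanE (ltn0Sn 0)) (meanE (ltn0Sn 1))).
  by move=> w /=; rewrite mulr1.
by rewrite !mul1r; ring.
Qed.

(** The unit vector at angle k alpha is [u] times the one at alpha plus [v] times the one at 2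
    alpha. The corresponding combination of entries has second moment 0, hence vanishes almost
    surely. *)
Lemma coords_lin k : (0 < k)%N -> {ae P, forall w, a k w = lin (coords w) (k%:R * alpha)}.
Proof.
move=> k0; pose u := sin (2 * alpha - k%:R * alpha) / sin alpha.
pose v := sin (k%:R * alpha - alpha) / sin alpha.
have linE w : a k w - lin (coords w) (k%:R * alpha) = 1 * a k w + - u * a 1%N w + - v * a 2%N w.
  rewrite /lin /coords /coord1 /coord2 /= /u /v !sinB mul1r; field; exact: sa.
have [] := mean_sq_comb3 1 (- u) (- v) k0 (ltn0Sn 0) (ltn0Sn 1).
have c0 : 1 * cos (k%:R * alpha) + - u * cos (1 * alpha) + - v * cos (2 * alpha) = 0.
  have -> : cos (k%:R * alpha) = cos (k%:R * alpha) * (sin (2 * alpha) * cos alpha - cos (2 * alpha) * sin alpha) / sin alpha.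
    by rewrite -sinB (_ : 2 * alpha - alpha = alpha) ?mulfK//; ring.
  by rewrite mul1r /u /v !sinB mul1r; field; exact: sa.
have s0 : 1 * sin (k%:R * alpha) + - u * sin (1 * alpha) + - v * sin (2 * alpha) = 0.
  have -> : sin (k%:R * alpha) = sin (k%:R * alpha) * (sin (2 * alpha) * cos alpha - cos (2 * alpha) * sin alpha) / sin alpha.
    by rewrite -sinB (_ : 2 * alpha - alpha = alpha) ?mulfK//; ring.
  by rewrite mul1r /u /v !sinB mul1r; field; exact: sa.
rewrite c0 s0 expr0n addr0 => hi h0.
have mf : measurable_fun setT (fun w => ((1 * a k w + - u * a 1%N w + - v * a 2%N w) ^+ 2)%:E : \bar R).
  by case/integrableP: hi.
have := (ae_eq_integral_abs P measurableT mf).1.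
under eq_integral => w _ do rewrite gee0_abs ?lee_fin ?sqr_ge0//.
move=> /(_ h0); apply: filterS => w /(_ I) /= -[/eqP].
by rewrite sqrf_eq0 -linE subr_eq0 => /eqP.
Qed.

Lemma measurable_coord1 : measurable_fun setT coord1.
Proof.
by apply: measurable_funM => //; apply: measurable_funB; exact: measurable_funM.
Qed.

Lemma measurable_coord2 : measurable_fun setT coord2.
Proof.
by apply: measurable_funM => //; apply: measurable_funB; exact: measurable_funM.
Qed.

Lemma measurable_coords : measurable_fun setT coords.
Proof.
by apply: measurable_fun_pair; [exact: measurable_coord1|exact: measurable_coord2].
Qed.

(** A linear form in the coordinates is one in the first two entries, hence Gaussian, centered, of
    variance s1^2 + s2^2; the same form has this law under the standard plane Gaussian. *)
Lemma coords_linear (s1 s2 : R) (F : R -> \bar R) : measurable_fun setT F -> (forall x, 0 <= F x)%E ->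
  (\int[P]_w F (s1 * coord1 w + s2 * coord2 w)%R = \int[gauss2 R]_z F (s1 * z.1 + s2 * z.2)%R)%E.
Proof.
move=> mF F0.
pose d1 := (s1 * sin (2 * alpha) - s2 * cos (2 * alpha)) / sin alpha.
pose d2 := (s2 * cos alpha - s1 * sin alpha) / sin alpha.
have fE w : s1 * coord1 w + s2 * coord2 w = d1 * a 1%N w + d2 * a 2%N w.
  by rewrite /coord1 /coord2 /d1 /d2; field; exact: sa.
have key : sin (2 * alpha) * cos alpha - cos (2 * alpha) * sin alpha = sin alpha.
  by rewrite -sinB; congr sin; ring.
have s1E : d1 * cos alpha + d2 * cos (2 * alpha) = s1.
  transitivity (s1 * (sin (2 * alpha) * cos alpha - cos (2 * alpha) * sin alpha) / sin alpha).
    by rewrite /d1 /d2; field; exact: sa.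
  by rewrite key mulfK.
have s2E : d1 * sin alpha + d2 * sin (2 * alpha) = s2.
  transitivity (s2 * (sin (2 * alpha) * cos alpha - cos (2 * alpha) * sin alpha) / sin alpha).
    by rewrite /d1 /d2; field; exact: sa.
  by rewrite key mulfK.
have mf : measurable_fun setT (fun w => d1 * a 1%N w + d2 * a 2%N w).
  by apply: measurable_funD; exact: measurable_funM.
have gf : gaussian_rv P (fun w => d1 * a 1%N w + d2 * a 2%N w).
  have [m [s h]] := ga 2 (fun k => if k == 1%N then d1 else d2).
  exists m, s => A mA; rewrite -(h A mA); congr (P _); apply/seteqP; split => w /=;
    by rewrite big_nat_recr//= big_nat1.
have sq0 : 0 <= s1 ^+ 2 + s2 ^+ 2 by rewrite addr_ge0 ?sqr_ge0.
have h0 : has_mean P (fun w => (d1 * a 1%N w + d2 * a 2%N w) ^+ 2) (s1 ^+ 2 + s2 ^+ 2).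
  apply: eq_has_mean (mean_sq_comb3 d1 d2 0 (ltn0Sn 0) (ltn0Sn 1) (ltn0Sn 0)).
    by move=> w; rewrite mul0r addr0.
  by rewrite mul1r !mul0r !addr0 s1E s2E.
have h1 : has_mean P (fun w => (d1 * a 1%N w + d2 * a 2%N w + 1) ^+ 2) (s1 ^+ 2 + s2 ^+ 2 + 1).
  by have := mean_sq_comb1 d1 d2; rewrite s1E s2E.
under eq_integral do rewrite fE.
rewrite (gaussian_rv_centered mf gf sq0 h0 h1 mF F0).
set q := Num.sqrt _; have q2 : q ^+ 2 = s1 ^+ 2 + s2 ^+ 2 by rewrite sqr_sqrtr.
have [q0|q0] := eqVneq q 0.
  have : s1 ^+ 2 + s2 ^+ 2 == 0 by rewrite -q2 q0 expr0n.
  rewrite paddr_eq0 ?sqr_ge0// !sqrf_eq0 => /andP[/eqP -> /eqP ->].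
  rewrite q0; under eq_integral do rewrite mul0r.
  under [RHS]eq_integral do rewrite !mul0r addr0.
  rewrite !integral_cst//; congr (_ * _)%E.
  by transitivity (1 : \bar R)%E; [|apply/esym]; exact: probability_setT.
have mFq : measurable_fun setT (fun u : R => F (q * u)).
  by apply: (measurableT_comp mF); exact: measurable_funM.
rewrite -(@gauss2_linear R (s1 / q) (s2 / q) (fun u => F (q * u)) _ mFq (fun=> F0 _)).
  apply: eq_integral => z _; congr F; rewrite mulrDr.
  by congr (_ + _); rewrite mulrA mulrCA divff// mulr1.
by rewrite !expr_div_n -mulrDl q2 divff// -q2 expf_neq0.
Qed.

(** Equality of characteristic functions in real form, the phase [c] standing for the imaginary
    part. Adding 1 makes the cosine non-negative. *)
Lemma coords_cos (s1 s2 c : R) : exists r,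
  has_mean P (fun w => cos (s1 * coord1 w + s2 * coord2 w + c)) r /\
  has_mean (gauss2 R) (fun z => cos (s1 * z.1 + s2 * z.2 + c)) r.
Proof.
have mc1 : measurable_fun setT (fun w => cos (s1 * coord1 w + s2 * coord2 w + c)).
  apply: measurable_cos_comp; apply: measurable_funD => //; apply: measurable_funD.
    by apply: measurable_funM => //; exact: measurable_coord1.
  by apply: measurable_funM => //; exact: measurable_coord2.
have mc2 : measurable_fun setT (fun z : R * R => cos (s1 * z.1 + s2 * z.2 + c)).
  by apply: measurable_cos_comp; apply: measurable_funD => //; apply: measurable_funD;
    apply: measurable_funM.
have [r hr] := has_mean_bounded P mc1 (fun w => abs_cos_le1 _).
have [q hq] := has_mean_bounded (gauss2 R) mc2 (fun w => abs_cos_le1 _).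
exists r; split => //; suff -> : r = q by [].
have [_ hr1] := has_meanD hr (has_mean_cst P 1).
have [_ hq1] := has_meanD hq (has_mean_cst (gauss2 R) 1).
have mF : measurable_fun setT (fun x : R => (cos (x + c) + 1)%:E).
  by apply/measurable_EFinP; apply: measurable_funD => //; apply: measurable_cos_comp; exact: measurable_funD.
have F0 x : (0 <= (cos (x + c) + 1)%:E)%E.
  by rewrite lee_fin; have := cos_geN1 (x + c); lra.
have := coords_linear s1 s2 mF F0.
rewrite hr1 hq1 => -[]; exact: addIr.
Qed.

End coordinates.

(** * Approximation of indicators of quadrants by trigonometric polynomials *)

Section trigonometric_functions.
Variable R : realType.
Implicit Types f g : R * R -> R.

(** Trigonometric polynomials in two variables with arbitrary real frequencies; the phase provides
    sines and constants. Product-to-sum formulas make them an algebra. *)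
Inductive trig_fun : (R * R -> R) -> Prop :=
| trig_cos s1 s2 c : trig_fun (fun z => cos (s1 * z.1 + s2 * z.2 + c))
| trig_add f g : trig_fun f -> trig_fun g -> trig_fun (fun z => f z + g z)
| trig_scale k f : trig_fun f -> trig_fun (fun z => k * f z).

Lemma eq_trig_fun f g : f =1 g -> trig_fun f -> trig_fun g.
Proof. by move=> /funext ->. Qed.

Lemma trig_cst k : trig_fun (fun=> k).
Proof.
apply: (eq_trig_fun _ (trig_scale k (trig_cos 0 0 0))) => z.
by rewrite !mul0r !addr0 cos0 mulr1.
Qed.

Lemma trig_mul f g : trig_fun f -> trig_fun g -> trig_fun (fun z => f z * g z).
Proof.
move=> + tg; elim=> [s1 s2 c|f1 f2 _ IH1 _ IH2|k f1 _ IH].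
- elim: tg => [u1 u2 v|g1 g2 _ IH1 _ IH2|k g1 _ IH].
  + apply: (eq_trig_fun _ (trig_scale (2^-1) (trig_add
      (trig_cos (s1 + u1) (s2 + u2) (c + v)) (trig_cos (s1 - u1) (s2 - u2) (c - v))))) => z.
    have -> : (s1 + u1) * z.1 + (s2 + u2) * z.2 + (c + v) =
      (s1 * z.1 + s2 * z.2 + c) + (u1 * z.1 + u2 * z.2 + v) by ring.
    have -> : (s1 - u1) * z.1 + (s2 - u2) * z.2 + (c - v) =
      (s1 * z.1 + s2 * z.2 + c) - (u1 * z.1 + u2 * z.2 + v) by ring.
    by rewrite cosD cosB; field.
  + by apply: (eq_trig_fun _ (trig_add IH1 IH2)) => z; rewrite mulrDr.
  + by apply: (eq_trig_fun _ (trig_scale k IH)) => z; rewrite mulrCA.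
- by apply: (eq_trig_fun _ (trig_add IH1 IH2)) => z; rewrite mulrDl.
- by apply: (eq_trig_fun _ (trig_scale k IH)) => z; rewrite mulrA.
Qed.

(* The iterates of [v |-> (3 v - v ^ 3) / 2] converge to the sign on [-1, 1]. *)
Definition sharpen (v : R) := (3 * v - v ^+ 3) / 2.

Lemma sharpenN v : sharpen (- v) = - sharpen v.
Proof. by rewrite /sharpen; field. Qed.

Lemma trig_sharpen f n : trig_fun f -> trig_fun (fun z => iter n sharpen (f z)).
Proof.
move=> tf; elim: n => [//|n IH].
apply: (eq_trig_fun _ (trig_add (trig_scale (3 / 2) IH)
  (trig_scale (- 2^-1) (trig_mul IH (trig_mul IH IH))))) => z.
by rewrite iterS; move: (iter n _ _) => u; rewrite /sharpen; field.
Qed.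

Lemma iter_sharpenN n v : iter n sharpen (- v) = - iter n sharpen v.
Proof. by elim: n => [//|n IH]; rewrite !iterS IH sharpenN. Qed.

(** One has 1 - sharpen(u) = (1 - u)(1 - u (1 + u) / 2). Since the iterates stay above [v], each
    step contracts the distance to 1 by at least 1 - v / 2. *)
Lemma iter_sharpen_pos n v : 0 < v <= 1 ->
  v <= iter n sharpen v <= 1 /\ 1 - iter n sharpen v <= (1 - v / 2) ^+ n.
Proof.
move=> /andP[v0 v1]; elim: n => [|n [/andP[h1 h2] h3]].
  by rewrite expr0 lexx v1; split => //=; lra.
rewrite iterS; move: (iter n sharpen v) h1 h2 h3 => u h1 h2 h3.
have u0 : 0 < u by exact: lt_le_trans h1.
have e1 : sharpen u - u = u * (1 - u ^+ 2) / 2 by rewrite /sharpen; field.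
have e2 : 1 - sharpen u = (1 - u) * (1 - u * (1 + u) / 2) by rewrite /sharpen; field.
have u2 : 0 <= 1 - u ^+ 2 by rewrite subr_ge0 expr_le1// ltW.
have p1 : 0 <= u * (1 - u ^+ 2) by rewrite mulr_ge0// ltW.
have p2 : 0 <= 1 - u * (1 + u) / 2 by nra.
have p3 : 1 - u * (1 + u) / 2 <= 1 - v / 2 by nra.
have p4 : 0 <= (1 - u) * (1 - u * (1 + u) / 2) by rewrite mulr_ge0// subr_ge0.
split; first by apply/andP; split; lra.
by rewrite e2 exprSr ler_pM// subr_ge0.
Qed.

Lemma iter_sharpen_cvg v : `|v| <= 1 -> iter n sharpen v @[n --> \oo] --> Num.sg v.
Proof.
wlog v0 : v / 0 < v.
  move=> W v1; case: (ltgtP v 0) => [vn|vp|->].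
  - rewrite -[v]opprK sgrN; under eq_fun do rewrite iter_sharpenN.
    by apply: cvgN; apply: W; rewrite ?oppr_gt0// normrN.
  - exact: W.
  - rewrite sgr0 (_ : (fun n => _) = fun=> 0); first exact: cvg_cst.
    by apply/funext => n; elim: n => [//|n IH]; rewrite iterS IH /sharpen mulr0 expr0n subr0 mul0r.
rewrite gtr0_norm// gtr0_sg// => v1.
have q1 : `|1 - v / 2| < 1 by rewrite ltr_norml; apply/andP; split; lra.
apply: (@squeeze_cvgr _ _ _ _ (fun n => 1 - (1 - v / 2) ^+ n) (fun=> 1)).
- apply: nearW => n; have [] := @iter_sharpen_pos n v _; first by rewrite v0 v1.
  by move=> /andP[_ ->] h; rewrite andbT; lra.
- rewrite -[X in _ --> X]subr0; apply: cvgB; first exact: cvg_cst.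
  exact: cvg_expr.
- exact: cvg_cst.
Qed.

Lemma iter_sharpen_bound n v : `|v| <= 1 -> `|iter n sharpen v| <= 1.
Proof.
move=> v1; case: (ltgtP v 0) => [vn|vp|->].
- have [] := @iter_sharpen_pos n (- v) _.
    by move: v1; rewrite ltr0_norm// => ->; rewrite oppr_gt0 vn.
  rewrite iter_sharpenN => /andP[h1 h2] _; rewrite ler_norml; apply/andP; split; lra.
- have [] := @iter_sharpen_pos n v _; first by move: v1; rewrite gtr0_norm// => ->; rewrite vp.
  move=> /andP[h1 h2] _; rewrite ler_norml; apply/andP; split; lra.
- suff -> : iter n sharpen 0 = 0 by rewrite normr0.
  by elim: n => [//|n IH]; rewrite iterS IH /sharpen mulr0 expr0n subr0 mul0r.
Qed.

(** Once the half period of the sine exceeds |x - a|, its sign is that of x - a, so the sequence is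
    eventually constant. *)
Lemma sg_sin_cvg (x a : R) :
  Num.sg (sin (n.+1%:R^-1 * (x - a))) @[n --> \oo] --> Num.sg (x - a).
Proof.
apply: cvg_near_cst; move: (x - a) => y.
have cy : (fun n : nat => n.+1%:R^-1 * `|y|) @ \oo --> (0 : R).
  by rewrite -(mul0r `|y|); apply: cvgM; [exact: cvg_harmonic|exact: cvg_cst].
have : \forall n \near \oo, n.+1%:R^-1 * `|y| < pi.
  move/cvgr0_norm_lt: cy => /(_ _ (pi_gt0 R)); apply: filterS => n /=.
  exact: le_lt_trans (ler_norm _).
apply: filterS => n /=; have n0 : 0 < n.+1%:R^-1 :> R by rewrite invr_gt0.
case: (ltgtP y 0) => [yn|yp|-> _].
- rewrite ltr0_norm// => h; rewrite (ltr0_sg yn) ltr0_sg// -oppr_gt0 -sinN -mulrN.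
  by apply: sin_gt0_pi; rewrite h mulr_gt0// oppr_gt0.
- rewrite gtr0_norm// => h; rewrite (gtr0_sg yp) gtr0_sg//.
  by apply: sin_gt0_pi; rewrite h mulr_gt0.
- by rewrite mulr0 sin0.
Qed.

(** Without the shift the value at x = a would be 1/2; approaching [a] from the right yields the
    open ray exactly. *)
Lemma sg_shift_cvg (x a : R) :
  (1 + Num.sg (x - (a + n.+1%:R^-1))) / 2 @[n --> \oo] --> (\1_`]a, +oo[ x : R).
Proof.
apply: cvg_near_cst; have [ax|xa] := ltrP a x; last first.
  apply: nearW => n; rewrite indicE memNset ?ltr0_sg/= ?addrN ?mul0r//.
    by rewrite subr_lt0; apply: le_lt_trans xa _; rewrite ltrDl.
  by rewrite in_itv/= andbT; apply/negP; rewrite -leNgt.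
have d0 : 0 < x - a by rewrite subr_gt0.
have := @cvg_harmonic R => /cvgr0_norm_lt /(_ _ d0); apply: filterS => n /= /(le_lt_trans (ler_norm _)) hn.
rewrite indicE mem_set/= ?in_itv/= ?ax// gtr0_sg; last by rewrite opprD addrA subr_gt0.
by rewrite -[1 + 1]/(2%:R) divff.
Qed.

End trigonometric_functions.

Section law.
Context d (T : measurableType d) (R : realType) (P : probability T R).
Variables (Q : probability (R * R)%type R) (X : T -> R * R).
Hypothesis mX : measurable_fun setT X.
Hypothesis XQ : forall s1 s2 c : R, exists r,
  has_mean P (fun w => cos (s1 * (X w).1 + s2 * (X w).2 + c)) r /\
  has_mean Q (fun z => cos (s1 * z.1 + s2 * z.2 + c)) r.

Definition same_mean (f : R * R -> R) := exists r, has_mean P (f \o X) r /\ has_mean Q f r.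

(* Equality of means passes from cosines to trigonometric polynomials, then by dominated
   convergence to signs of sines, to signs, and to indicators of quadrants. *)
Lemma same_mean_trig f : trig_fun f -> same_mean f.
Proof.
elim=> [s1 s2 c|f1 f2 _ [r [h1 h2]] _ [r' [h1' h2']]|k f1 _ [r [h1 h2]]].
- exact: XQ.
- by exists (r + r'); split; exact: has_meanD.
- by exists (k * r); split; exact: has_meanZ.
Qed.

Lemma has_mean_lim d' (T' : measurableType d') (P' : probability T' R) (f_ : nat -> T' -> R)
    (f : T' -> R) (r_ : nat -> R) :
  (forall n, has_mean P' (f_ n) (r_ n)) -> (forall n w, `|f_ n w| <= 1) ->
  (forall w, f_ ^~ w @ \oo --> f w) -> measurable_fun setT f ->
  exists r, has_mean P' f r /\ r_ @ \oo --> r.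
Proof.
move=> hf f1 cf mf.
have cfE w : (f_ n w)%:E @[n --> \oo] --> (f w)%:E.
  by apply: cvg_EFin; [exact: nearW|exact: cf].
have [fi _ cI] := @dominated_convergence _ _ _ P' setT measurableT (fun n w => (f_ n w)%:E)
  (fun w => (f w)%:E) (cst 1%E) (fun n => measurable_int _ (hf n).1)
  ((measurable_EFinP _ _).2 mf)
  (aeW _ (fun w _ => cfE w))
  (has_mean_cst P' 1).1 (aeW _ (fun w n _ => f1 n w)).
exists (fine (\int[P']_w (f w)%:E)%E); split.
  by split => //; rewrite fineK//; exact: integrable_fin_num.
have -> : r_ = fine \o (fun n => \int[P']_w (f_ n w)%:E)%E.
  by apply/funext => n /=; rewrite (hf n).2.
by apply: fine_cvg; rewrite fineK//; exact: integrable_fin_num.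
Qed.

Lemma same_mean_lim (f_ : nat -> R * R -> R) (f : R * R -> R) :
  (forall n, same_mean (f_ n)) -> (forall n w, `|f_ n w| <= 1) ->
  (forall w, f_ ^~ w @ \oo --> f w) -> measurable_fun setT f -> same_mean f.
Proof.
move=> /choice [r_ hr] f1 cf mf.
have [r [hf cr]] := has_mean_lim (fun n => (hr n).1) (fun n w => f1 n (X w)) (fun w => cf (X w))
  (measurableT_comp mf mX).
have [q [gf cq]] := has_mean_lim (fun n => (hr n).2) f1 cf mf.
by exists r; split => //; rewrite (cvg_unique _ cr cq).
Qed.

Let half (v : R) := (1 + v) / 2.

Let half_bound v : `|v| <= 1 -> 0 <= half v <= 1.
Proof. by rewrite ler_norml /half => /andP[? ?]; apply/andP; split; lra. Qed.

Let prod_half_bound u v : `|u| <= 1 -> `|v| <= 1 -> `|half u * half v| <= 1.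
Proof.
move=> /half_bound /andP[u0 u1] /half_bound /andP[v0 v1].
by rewrite ger0_norm; [exact: mulr_ile1|exact: mulr_ge0].
Qed.

Let half_cvg (u : nat -> R) v : u @ \oo --> v -> half (u n) @[n --> \oo] --> half v.
Proof. by move=> uv; apply: cvgM; [apply: cvgD => //; exact: cvg_cst|exact: cvg_cst]. Qed.

Let measurable_sg (f : R * R -> R) : measurable_fun setT f -> measurable_fun setT (fun z => Num.sg (f z)).
Proof.
move=> mf; rewrite (_ : (fun z => _) = (fun z => \1_[set z | 0 < f z] z - \1_[set z | f z < 0] z)).
  by apply: measurable_funB; apply: measurable_indic; exact: measurable_set_lt.
apply/funext => z; rewrite !indicE.
case: (ltgtP (f z) 0) => h.
- by rewrite ltr0_sg// memNset ?mem_set//= ?sub0r//; apply/negP; rewrite -leNgt ltW.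
- by rewrite gtr0_sg// mem_set// memNset//= ?subr0//; apply/negP; rewrite -leNgt ltW.
- by rewrite h sgr0 !memNset//= ?h ?ltxx// subrr.
Qed.

Let measurable_half (f : R * R -> R) : measurable_fun setT f -> measurable_fun setT (fun z => half (f z)).
Proof. by move=> mf; apply: measurable_funM => //; exact: measurable_funD. Qed.

Let sg_bound (v : R) : `|Num.sg v| <= 1.
Proof. by rewrite normr_sg; case: (v != 0). Qed.

Lemma same_mean_sg_sin (k a b : R) :
  same_mean (fun z => half (Num.sg (sin (k * (z.1 - a)))) * half (Num.sg (sin (k * (z.2 - b))))).
Proof.
have m1 : measurable_fun setT (fun z : R * R => sin (k * (z.1 - a))).
  by apply: measurable_sin_comp; apply: measurable_funM => //; exact: measurable_funB.
have m2 : measurable_fun setT (fun z : R * R => sin (k * (z.2 - b))).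
  by apply: measurable_sin_comp; apply: measurable_funM => //; exact: measurable_funB.
apply: (@same_mean_lim (fun n z => half (iter n (@sharpen R) (sin (k * (z.1 - a)))) *
   half (iter n (@sharpen R) (sin (k * (z.2 - b)))))).
- move=> n; apply: same_mean_trig.
  have t1 : trig_fun (fun z : R * R => sin (k * (z.1 - a))).
    apply: (eq_trig_fun _ (trig_cos k 0 (- k * a - pi / 2))) => z.
    by rewrite -cosBpihalf; congr cos; ring.
  have t2 : trig_fun (fun z : R * R => sin (k * (z.2 - b))).
    apply: (eq_trig_fun _ (trig_cos 0 k (- k * b - pi / 2))) => z.
    by rewrite -cosBpihalf; congr cos; ring.
  have th f : trig_fun f -> trig_fun (fun z => half (f z)).
    move=> tf; apply: (eq_trig_fun _ (trig_scale 2^-1 (trig_add (trig_cst 1) tf))) => z.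
    by rewrite /half mulrC.
  by apply: trig_mul; apply: th; exact: trig_sharpen.
- by move=> n w; apply: prod_half_bound; apply: iter_sharpen_bound; exact: abs_sin_le1.
- by move=> w; apply: cvgM; apply: half_cvg; apply: iter_sharpen_cvg; exact: abs_sin_le1.
- by apply: measurable_funM; apply: measurable_half; exact: measurable_sg.
Qed.

Lemma same_mean_sg (a b : R) :
  same_mean (fun z => half (Num.sg (z.1 - a)) * half (Num.sg (z.2 - b))).
Proof.
apply: (@same_mean_lim (fun n z => half (Num.sg (sin (n.+1%:R^-1 * (z.1 - a)))) *
   half (Num.sg (sin (n.+1%:R^-1 * (z.2 - b)))))).
- by move=> n; exact: same_mean_sg_sin.
- by move=> n w; exact: prod_half_bound.
- by move=> w; apply: cvgM; apply: half_cvg; exact: sg_sin_cvg.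
- by apply: measurable_funM; apply: measurable_half; apply: measurable_sg; exact: measurable_funB.
Qed.

Lemma law_rays (a b : R) : P (X @^-1` (`]a, +oo[ `*` `]b, +oo[)) = Q (`]a, +oo[ `*` `]b, +oo[).
Proof.
have mA : measurable (`]a, +oo[ `*` `]b, +oo[ : set (R * R)) by exact: measurableX.
have [r []] : same_mean (\1_(`]a, +oo[ `*` `]b, +oo[)).
  rewrite (_ : \1__ = fun z => \1_`]a, +oo[ z.1 * \1_`]b, +oo[ z.2); last first.
    by apply/funext => z; rewrite !indicE in_setX -natrM mulnb.
  apply: (@same_mean_lim (fun n z => half (Num.sg (z.1 - (a + n.+1%:R^-1))) *
     half (Num.sg (z.2 - (b + n.+1%:R^-1))))).
  - by move=> n; exact: same_mean_sg.
  - by move=> n w; exact: prod_half_bound.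
  - by move=> w; apply: cvgM; exact: sg_shift_cvg.
  - by apply: measurable_funM; apply: (measurableT_comp (measurable_indic _)).
move=> [_ h1] [_ h2].
rewrite [RHS](measure_indic Q mA) h2 -h1 [LHS](measure_indic P)//.
by rewrite -[X in measurable X]setTI; exact: mX.
Qed.

End law.

(** * From quadrants to all measurable sets *)

Section uniqueness.
Variable R : realType.

Lemma measure_rays_unique (m1 m2 : {measure set R -> \bar R}) :
  (forall a, m1 `]a, +oo[%classic < +oo)%E -> (forall a, m1 `]a, +oo[%classic = m2 `]a, +oo[%classic) ->
  forall A, measurable A -> m1 A = m2 A.
Proof.
move=> fin h A mA.
apply: (measure_unique [set A : set R | exists x, A = `]x, +oo[%classic] (fun k => `](- k%:R), +oo[%classic)) => //.
- exact: RGenOInfty.measurableE.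
- move=> _ _ [x ->] [y ->]; exists (Num.max x y).
  by apply/seteqP; split => z /=; rewrite !in_itv/= !andbT gt_max => /andP.
- by move=> k; exists (- k%:R).
- apply/seteqP; split => // x _; exists (Num.truncn `|x|).+1 => //=; rewrite in_itv/= andbT.
  have /andP[_ h1] := truncn_itv (normr_ge0 x).
  by rewrite ltrNl; apply: le_lt_trans h1; rewrite -normrN ler_norm.
- by move=> _ [x ->].
Qed.

Context d (T : measurableType d) (P : probability T R).

(** One coordinate at a time: with one factor fixed, restriction to its strip gives two measures on
    the line that agree on rays. Rectangles then determine the product measure. *)
Lemma law_of_rays (X : T -> R * R) : measurable_fun setT X ->
  (forall a b, P (X @^-1` (`]a, +oo[ `*` `]b, +oo[)) = gauss2 R (`]a, +oo[ `*` `]b, +oo[)) ->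
  forall A, measurable A -> P (X @^-1` A) = gauss2 R A.
Proof.
move=> mX h A mA.
have mpre B : measurable B -> measurable (X @^-1` B).
  by move=> mB; rewrite -[X in measurable X]setTI; exact: mX.
pose m := image_measure P mX.
have mfst' := @measurable_fst _ _ R R; have msnd' := @measurable_snd _ _ R R.
have mprod (B C : set R) : measurable B -> measurable C -> measurable (B `*` C) by exact: measurableX.
have fin (B : set (R * R)) : measurable B -> (m B < +oo)%E.
  by move=> mB; rewrite -ge0_fin_numE//; apply: fin_num_measure; exact: mpre.
have step1 b (B : set R) : measurable B -> m (B `*` `]b, +oo[) = gauss2 R (B `*` `]b, +oo[).
  move=> mB; have mC : measurable (snd @^-1` `]b, +oo[ : set (R * R)).
    by rewrite -[X in measurable X]setTI; exact: msnd'.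
  apply: (@measure_rays_unique (image_measure (mrestr m mC) mfst')
    (image_measure (mrestr (gauss2 R) mC) mfst')) => //.
    by move=> a; apply: fin; exact: mprod.
  by move=> a; exact: h.
have step2 (B C : set R) : measurable B -> measurable C -> m (B `*` C) = gauss2 R (B `*` C).
  move=> mB mC; have mB' : measurable (fst @^-1` B : set (R * R)).
    by rewrite -[X in measurable X]setTI; exact: mfst'.
  have e (C' : set R) (n : set (R * R) -> \bar R) : n (B `*` C') = n (snd @^-1` C' `&` fst @^-1` B).
    by congr n; apply/seteqP; split => z [].
  rewrite (e _ m) (e _ (gauss2 R)).
  apply: (@measure_rays_unique (image_measure (mrestr m mB') msnd')
    (image_measure (mrestr (gauss2 R) mB') msnd')) => //.
    move=> b; have mI : measurable (`]b, +oo[%classic : set R) by [].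
    by have := fin _ (mprod _ _ mB mI); rewrite (e _ m).
  by move=> b; have := step1 b _ mB; rewrite (e _ m) (e _ (gauss2 R)).
apply/esym; apply: (product_measure_unique (m1 := gauss R) (m2 := gauss R) (m' := m)) => //.
by move=> B C mB mC; rewrite step2//; exact: product_measure1E.
Qed.

(** Independence is stated for the sigma-algebras of the processes; this brings events on the
    coordinates under it. Measurability is checked with the generated sigma-algebra as the structure
    on [T]. *)
Lemma process_measurable (a : nat -> {RV P >-> R}) (f : T -> R * R) (g : R * R -> R * R) :
  measurable_fun setT g -> (forall w, f w = g (a 1%N w, a 2%N w)) ->
  forall A, measurable A -> process_sigma_algebra a (f @^-1` A).
Proof.
move=> mg fE A mA.
pose G := \bigcup_(k in [set k | (0 < k)%N]) preimage_set_system setT (a k) measurable.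
have mak k : (0 < k)%N -> measurable_fun setT (a k : g_sigma_algebraType G -> R).
  move=> k0 _ B mB; apply: sub_sigma_algebra; exists k => //.
  by exists B.
have mpair : measurable_fun setT ((fun w => (a 1%N w, a 2%N w)) : g_sigma_algebraType G -> R * R).
  by apply: measurable_fun_pair; exact: mak.
have := measurableT_comp mg mpair measurableT mA; rewrite setTI.
by rewrite (_ : _ @^-1` A = f @^-1` A)//; apply/seteqP; split => w /=; rewrite fE.
Qed.

End uniqueness.

Section gaussian_coordinates.
Context d (T : measurableType d) (R : realType) (P : probability T R).
Variables (alpha : R) (a b : nat -> {RV P >-> R}).
Hypothesis sa : sin alpha != 0.
Hypothesis hab : gaussian_entries alpha a b.

Definition coords2 (w : T) := (coords alpha a w, coords alpha b w).

Let va : dirac_pair_covariance alpha a.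
Proof. by case: hab => _ _ _ _ h k l k0 l0; case: (h k l k0 l0). Qed.

Let vb : dirac_pair_covariance alpha b.
Proof. by case: hab => _ _ _ _ h k l k0 l0; case: (h k l k0 l0). Qed.

Lemma measurable_coords2 : measurable_fun setT coords2.
Proof. by apply: measurable_fun_pair; exact: measurable_coords. Qed.

Let lawX (c : nat -> {RV P >-> R}) : gaussian_process c -> centered_process c ->
  dirac_pair_covariance alpha c ->
  forall A, measurable A -> P (coords alpha c @^-1` A) = gauss2 R A.
Proof.
move=> gc cc vc; apply: law_of_rays; first exact: measurable_coords.
move=> u v; apply: law_rays; first exact: measurable_coords.
by move=> s1 s2 k; exact: coords_cos.
Qed.

(** Independence factorizes rectangles, and these determine the product measure. *)
Lemma law_coords2 (A : set ((R * R) * (R * R))) : measurable A -> P (coords2 @^-1` A) = gauss4 R A.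
Proof.
move=> mA; have [[ga gb] [ca cb] _ ind _] := hab.
apply/esym; apply: (product_measure_unique (m1 := gauss2 R) (m2 := gauss2 R)
  (m' := image_measure P measurable_coords2)) => //.
move=> B C mB mC; transitivity (P ((coords alpha a @^-1` B) `&` (coords alpha b @^-1` C))) => //.
pose g (z : R * R) := ((z.1 * sin (2 * alpha) - z.2 * sin alpha) / sin alpha,
  (z.2 * cos alpha - z.1 * cos (2 * alpha)) / sin alpha).
have mg : measurable_fun setT g.
  by apply: measurable_fun_pair; apply: measurable_funM => //; apply: measurable_funB; exact: measurable_funM.
rewrite ind; last 2 first.
- exact: (process_measurable mg).
- exact: (process_measurable mg).
by rewrite !lawX.
Qed.

Lemma entries_lin : {ae P, forall w k, (0 < k)%N ->
  a k w = lin (coords2 w).1 (k%:R * alpha) /\ b k w = lin (coords2 w).2 (k%:R * alpha)}.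
Proof.
have [[ga gb] [ca cb] _ ind _] := hab.
apply/ae_foralln => -[|k]; first by apply: aeW.
have ha := coords_lin va sa (ltn0Sn k).
have hb := coords_lin vb sa (ltn0Sn k).
by move: ha hb; apply: filterS2.
Qed.

End gaussian_coordinates.

Lemma infinite_set_unbounded (S : set nat) :
  (forall N, exists2 n, (N <= n)%N & S n) -> infinite_set S.
Proof.
move=> h /finite_seqP [s sE]; have [n sn] := h (\max_(i <- s) i).+1.
rewrite sE /= => ns; have := @leq_bigmax_seq _ s xpredT id n ns isT.
by move=> /(leq_trans sn); rewrite ltnn.
Qed.

(** * The expected number of zeros *)

(* The number of zeros is not known to be measurable: its integral is compared with
   those of measurable functions of the coordinates. *)
Section nonmeasurable_bounds.
Context d (T : measurableType d) (R : realType) (P : probability T R).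
Context d' (Z : measurableType d') (Q : probability Z R) (X : T -> Z).
Hypothesis mX : measurable_fun setT X.
Hypothesis XQ : forall A, measurable A -> P (X @^-1` A) = Q A.

(** The integral of a non-negative function is a supremum over the simple functions below it, so
    monotonicity asks for no measurability. *)
Lemma ge0_le_integral_setT (f g : T -> \bar R) : (forall w, 0 <= f w)%E ->
  (forall w, f w <= g w)%E -> (\int[P]_w f w <= \int[P]_w g w)%E.
Proof.
move=> f0 fg; have g0 w : (0 <= g w)%E by exact: le_trans (fg w).
rewrite !ge0_integralTE//; apply: ge_ereal_sup => _ [h hf <-].
by apply: ereal_sup_ubound; exists h => // w; exact: le_trans (hf w) (fg w).
Qed.

Lemma integral_law (f : Z -> \bar R) : measurable_fun setT f -> (forall z, 0 <= f z)%E ->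
  (\int[P]_w f (X w) = \int[Q]_z f z)%E.
Proof.
move=> mf f0; transitivity (\int[image_measure P mX]_z f z)%E.
  by apply/esym; exact: (ge0_integral_pushforward mX).
by apply: eq_measure_integral => A mA _; exact: XQ.
Qed.

Lemma integral_le_mean (f : T -> \bar R) (U : Z -> R) (r : R) :
  (forall w, 0 <= f w)%E -> (forall z, 0 <= U z) -> has_mean Q U r ->
  {ae P, forall w, f w <= (U (X w))%:E}%E -> (\int[P]_w f w <= r%:E)%E.
Proof.
move=> f0 U0 [Ui Ur] [N [mN N0 fN]].
have mU : measurable_fun setT (fun z => (U z)%:E : \bar R) by case/integrableP: Ui.
have mUX : measurable_fun setT (fun w => (U (X w))%:E : \bar R) by exact: (measurableT_comp mU mX).
rewrite -Ur -integral_law//.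
(* An infinite value on the null set turns the almost sure bound into a pointwise one without
   changing the integral. *)
pose g w : \bar R := if w \in N then +oo%E else (U (X w))%:E.
have g0 w : (0 <= g w)%E by rewrite /g; case: ifP => // _; rewrite lee_fin.
have mg : measurable_fun setT g.
  apply: measurable_fun_ifT => //.
  by apply: (measurable_fun_bool true); rewrite setTI (_ : _ @^-1` _ = N)//;
    apply/seteqP; split => w /=; [move/set_mem|move/mem_set].
rewrite (@ge0_ae_eq_integral _ _ _ P setT (fun w => (U (X w))%:E) g)//; last 2 first.
- by move=> w _; rewrite lee_fin.
- exists N; split => // w /= h; apply: contrapT => wN; apply: h => _.
  by rewrite /g memNset.
apply: ge0_le_integral_setT => // w; rewrite /g.
have [|wN] := boolP (w \in N); first by rewrite leey.
by apply: contrapT => h; move/negP: wN; apply; apply/mem_set/fN.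
Qed.

Lemma integral_ge_mean (f : T -> \bar R) (L : Z -> R) (r : R) :
  (forall w, 0 <= f w)%E -> has_mean Q L r ->
  {ae P, forall w, (L (X w))%:E <= f w}%E -> (r%:E <= \int[P]_w f w)%E.
Proof.
move=> f0 [Li Lr] [N [mN N0 fN]].
have mL : measurable_fun setT L by apply/measurable_EFinP; case/integrableP: Li.
(* The lower bound may be negative, while the comparison requires non-negative functions. Truncation
   can only increase its mean. *)
pose M z := Num.max (L z) 0.
have mM : measurable_fun setT (fun z => (M z)%:E : \bar R).
  by apply/measurable_EFinP; exact: measurable_maxr.
have M0 z : 0 <= M z by rewrite le_max lexx orbT.
apply: (@le_trans _ _ (\int[Q]_z (M z)%:E)%E).
  rewrite -Lr; apply: le_integral => //.
    apply: (le_integrable measurableT mM _ Li) => z _; rewrite /= lee_fin.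
    rewrite /M /Num.max; case: ifP => _; by rewrite ?normr0.
  by move=> z _; rewrite lee_fin le_max lexx.
have mMX : measurable_fun setT (fun w => (M (X w))%:E : \bar R) by exact: (measurableT_comp mM mX).
have ME0 z : (0 <= (M z)%:E)%E by rewrite lee_fin.
rewrite -(integral_law mM ME0).
pose g w : \bar R := if w \in N then 0%E else (M (X w))%:E.
have g0 w : (0 <= g w)%E by rewrite /g; case: ifP => // _; rewrite lee_fin.
have mg : measurable_fun setT g.
  apply: measurable_fun_ifT => //.
  by apply: (measurable_fun_bool true); rewrite setTI (_ : _ @^-1` _ = N)//;
    apply/seteqP; split => w /=; [move/set_mem|move/mem_set].
rewrite (@ge0_ae_eq_integral _ _ _ P setT (fun w => (M (X w))%:E) g)//; last first.
  exists N; split => // w /= h; apply: contrapT => wN; apply: h => _.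
  by rewrite /g memNset.
apply: ge0_le_integral_setT => // w; rewrite /g.
have [//|wN] := boolP (w \in N).
have : ((L (X w))%:E <= f w)%E.
  by apply: contrapT => h; move/negP: wN; apply; apply/mem_set/fN.
by rewrite /M /Num.max; case: ifP.
Qed.

End nonmeasurable_bounds.

(** * Averaging the zero count over the Gaussian coordinates *)

Section averages.
Variable R : realType.
Implicit Types (alpha beta K : R).

Lemma unifr_circle (S : set R) : measurable S -> unifr (`[0, 2 * pi[ `&` S) = unifr S.
Proof.
move=> mS; have tp := ltW (twopi_gt0 R).
have u1 : unif R `[0, 2 * pi[%classic = 1%E.
  by rewrite unif_itv// subr0 divff// gt_eqF// twopi_gt0.
have uc : unif R (~` `[0, 2 * pi[%classic) = 0%E by rewrite probability_setC// u1 subee.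
have mJ : measurable (`[0, 2 * pi[%classic : set R) by [].
have mC : measurable (~` `[0, 2 * pi[%classic : set R) by exact: measurableC.
rewrite -[in RHS](setTI S) -(setUv `[0, 2 * pi[%classic) setIUl unifrU; last 3 first.
- exact: measurableI.
- exact: measurableI.
- by rewrite setIACA setICr set0I.
suff : unifr (~` `[0, 2 * pi[ `&` S) <= 0.
  by move=> h; rewrite [X in _ + X](_ : _ = 0) ?addr0//; apply/eqP; rewrite eq_le h unifr_ge0.
apply: (@le_trans _ _ (unifr (~` `[0, 2 * pi[%classic))).
  by apply: unifr_le => //; exact: measurableI.
by rewrite /unifr [X in fine X]uc.
Qed.

Lemma has_mean_section d d' (T : measurableType d) (T' : measurableType d') (P : probability T R)
    (Q : probability T' R) (A : set (T * T')) : measurable A ->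
  has_mean P (fun x => fine (Q (xsection A x))) (fine (prod_prob P Q A)).
Proof.
move=> mA.
have fQ x : Q (xsection A x) \is a fin_num by apply: fin_num_measure; exact: measurable_xsection.
have mQ : measurable_fun setT (fun x => Q (xsection A x)) by exact: measurable_fun_xsection.
have e : EFin \o (fun x => fine (Q (xsection A x))) = (fun x => Q (xsection A x)).
  by apply/funext => x /=; rewrite fineK.
split; last first.
  rewrite fineK; last exact: fin_num_measure.
  by rewrite -[X in (integral _ _ X)]/(EFin \o (fun x => fine (Q (xsection A x)))) e.
rewrite e; apply: (le_integrable measurableT mQ _ (has_mean_cst P 1).1) => x _.
rewrite /= gee0_abs// normr1; apply: probability_le1; exact: measurable_xsection.
Qed.

Lemma has_mean_indic d (T : measurableType d) (P : probability T R) (A : set T) : measurable A ->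
  has_mean P (\1_A) (fine (P A)).
Proof.
move=> mA; have [r hr] : exists r, has_mean P (\1_A) r.
  apply: (@has_mean_bounded _ _ _ _ _ 1); first exact: measurable_indic.
  by move=> w; rewrite indicE; case: (_ \in _); rewrite ?normr1 ?normr0.
by have [_] := hr; rewrite -(measure_indic P mA) => ->.
Qed.

(** By rotation invariance the form is a standard Gaussian variable. This ensures almost surely the
    nonzero top coefficient on which the Rolle bound depends. *)
Lemma gauss4_lin_eq0 beta : gauss4 R [set z | lin z.1 beta = 0] = 0%E.
Proof.
have m0 : measurable_fun setT (fun x : R => (\1_[set 0] x)%:E : \bar R).
  by apply/measurable_EFinP; exact: measurable_indic.
have ml : measurable_fun setT (fun x : R * R => lin x beta) by exact: measurable_lin.
have mA : measurable [set z : (R * R) * (R * R) | lin z.1 beta = 0].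
  by apply: measurable_preimage1; exact: (measurableT_comp ml measurable_fst).
have mB : measurable [set x : R * R | lin x beta = 0] by exact: measurable_preimage1.
rewrite [LHS]prod_probE2// -(integral0 (gauss2 R) setT); apply: eq_integral => y _.
rewrite ysectionE (_ : _ @^-1` _ = [set x | lin x beta = 0])//.
rewrite (measure_indic (gauss2 R) mB) -(gauss_set1 (0 : R)) (measure_indic (gauss R) (measurable_set1 0)).
rewrite -(gauss2_linear (cos2Dsin2 beta) m0)//.
apply: eq_integral => x _; rewrite !indicE; congr (_%:R)%:E; congr nat_of_bool.
by apply/idP/idP => /set_mem /= h; apply/mem_set; rewrite /= -h /lin; ring.
Qed.

Definition l1norm4 (z : (R * R) * (R * R)) := `|z.1.1| + `|z.1.2| + `|z.2.1| + `|z.2.2|.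

Lemma measurable_l1norm4 : measurable_fun setT l1norm4.
Proof.
have m1 : measurable_fun setT (fun w : (R * R) * (R * R) => w.1) by apply: measurable_fst.
have m2 : measurable_fun setT (fun w : (R * R) * (R * R) => w.2) by apply: measurable_snd.
have m11 := measurableT_comp (@measurable_fst _ _ R R) m1.
have m12 := measurableT_comp (@measurable_snd _ _ R R) m1.
have m21 := measurableT_comp (@measurable_fst _ _ R R) m2.
have m22 := measurableT_comp (@measurable_snd _ _ R R) m2.
by apply: measurable_funD; [apply: measurable_funD; [apply: measurable_funD|]|]; exact: measurableT_comp.
Qed.

Lemma bounded4_l1norm4 z K : ~ (K < `|l1norm4 z|) -> bounded4 z K.
Proof.
move=> /negP; rewrite -leNgt ger0_norm ?addr_ge0// /l1norm4 /bounded4.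
have := normr_ge0 z.1.1; have := normr_ge0 z.1.2; have := normr_ge0 z.2.1; have := normr_ge0 z.2.2.
move: `|z.1.1| `|z.1.2| `|z.2.1| `|z.2.2| => p q r s s0 r0 q0 p0 h.
by split; lra.
Qed.

Lemma nb_zerosE (a b : nat -> R) alpha z n : (0 < n)%N ->
  (forall k, (0 < k)%N -> a k = lin z.1 (k%:R * alpha) /\ b k = lin z.2 (k%:R * alpha)) ->
  nb_zeros (trig_poly a b n) `[0, 2 * pi] = counting (zero_set alpha z n).
Proof.
move=> n0 h; rewrite /nb_zeros /zero_set; congr counting; apply/seteqP.
have tE t : trig_poly a b n t = (Num.sqrt n%:R)^-1 * trig_sum alpha z n t.
  congr (_ * _); apply: eq_big_nat => k /andP[k1 _].
  by have [-> ->] := h k k1.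
have sn : (Num.sqrt n%:R)^-1 != 0 :> R by rewrite invr_eq0 gt_eqF// sqrtr_gt0 ltr0n.
split=> t [tJ]; rewrite /= tE; split => //.
  by move/eqP: b0; rewrite mulf_eq0 (negbTE sn) => /eqP.
by rewrite /= b0 mulr0.
Qed.

(** The tolerance and the rank precede the probability space, so a single [n] serves all entries.
    Integrating the bounds of [zero_set_count], with [u] of mean [prob_pos], leaves three errors:
    small discriminant, large coordinates, and the constant divided by [n]. *)
Lemma expected_zeros_close alpha beta (eps : R) : sin alpha != 0 ->
  (sin beta != 0) || (sin (beta + alpha) != 0) -> 0 < eps ->
  exists2 kappa : R, 0 < kappa & exists n0 : nat, forall n, (n0 <= n)%N ->
  `|cos (n%:R * alpha) - cos beta| <= kappa -> `|sin (n%:R * alpha) - sin beta| <= kappa ->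
  forall d (T : measurableType d) (P : probability T R) (a b : nat -> {RV P >-> R}),
  gaussian_entries alpha a b ->
  (`| expected_nb_zeros a b n * (n%:R^-1)%:E - (2 * prob_pos alpha beta)%:E | <= eps%:E)%E.
Proof.
move=> sa nz eps0.
(* The two exceptional events are weighted by 96 and 100 in the upper bound: 196 / 256 plus the 1 /
   8 reserved for the constant stays below 1. *)
have e1 : 0 < eps / 16 / 16 by rewrite !divr_gt0.
pose D (w : ((R * R) * (R * R)) * R) := disc alpha beta w.1 w.2.
have mD : measurable_fun setT D by exact: measurable_disc_comp.
have [eta' eta0 small] := prob_small e1 mD (gauss4_unif_disc_eq0 nz).
have [K K0 large] := prob_large (gauss4 R) e1 measurable_l1norm4.
have eta3 : 0 < eta' / 3 by rewrite divr_gt0.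
have [kappa [C [n0 [kappa0 count]]]] := zero_set_count alpha (ltW K0) eta3.
exists kappa => //; pose C' := `|C|.
have C0 : 0 <= C' by exact: normr_ge0.
exists (maxn (maxn n0 2) (Num.truncn (8 * C' / eps)).+1) => n.
rewrite !geq_max => /andP[/andP[n0n n2] nC] cc ss d T P a b hab.
have np : 0 < n%:R :> R by rewrite ltr0n (leq_trans _ n2).
have Cn : C' <= eps / 8 * n%:R.
  have /andP[_ h] : (Num.truncn (8 * C' / eps))%:R <= 8 * C' / eps < (Num.truncn (8 * C' / eps)).+1%:R.
    by apply: truncn_itv; rewrite divr_ge0 ?(ltW eps0)// mulr_ge0.
  have : 8 * C' / eps <= n%:R by rewrite (le_trans (ltW h))// ler_nat.
  by rewrite ler_pdivrMr//; clear; lra.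
pose A := [set w | 0 < D w]; pose B := [set w | `|D w| < eta'].
have mA : measurable A by exact: measurable_set_lt.
have mB : measurable B by apply: measurable_set_lt => //; exact: measurableT_comp.
pose bad := [set z | K < `|l1norm4 z|].
have mbad : measurable bad.
  by apply: measurable_set_lt => //; apply: measurableT_comp => //; exact: measurable_l1norm4.
pose u z := fine (unif R (xsection A z)); pose v z := fine (unif R (xsection B z)).
have hu : has_mean (gauss4 R) u (prob_pos alpha beta) by exact: has_mean_section.
have hv := has_mean_section (gauss4 R) (unif R) mB; rewrite -/v in hv.
have hb := has_mean_indic (gauss4 R) mbad.
set q := fine _ in hv; set r := fine _ in hb.
have qe : q <= eps / 16 / 16 by rewrite -lee_fin fineK//; exact: fin_num_measure.
have re : r <= eps / 16 / 16 by rewrite -lee_fin fineK//; exact: fin_num_measure.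
have u01 z : 0 <= u z <= 1.
  rewrite fine_ge0//= -lee_fin fineK; last by apply: fin_num_measure; exact: measurable_xsection.
  by apply: probability_le1; exact: measurable_xsection.
have v0 z : 0 <= v z by rewrite fine_ge0.
have q0 : 0 <= q by exact: fine_ge0.
have r0 : 0 <= r by exact: fine_ge0.
have uE z : unifr (`[0, 2 * pi[ `&` [set t | 0 < disc alpha beta z t]) = u z.
  by rewrite unifr_circle; [rewrite /u xsectionE|exact: measurable_disc_pos].
have vE z : unifr (`[0, 2 * pi[ `&` [set t | `|disc alpha beta z t| < 3 * (eta' / 3)]) = v z.
  rewrite (_ : 3 * (eta' / 3) = eta'); last by field.
  by rewrite unifr_circle; [rewrite /v xsectionE|exact: measurable_disc_small].
pose X := coords2 alpha a b.
(* On [bad] the upper bound contains the deterministic 100 n, and in [L] the term - 2 n makes the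
   lower bound trivial because u <= 1. Both are measurable in the coordinates. *)
pose U z := 2 * n%:R * u z + 96 * n%:R * v z + C' + 100 * n%:R * \1_bad z.
pose L z := 2 * n%:R * u z + - (2 * n%:R) * v z + - C' + - (2 * n%:R) * \1_bad z.
have hU := has_meanD (has_meanD (has_meanD (has_meanZ (2 * n%:R) hu) (has_meanZ (96 * n%:R) hv))
  (has_mean_cst _ C')) (has_meanZ (100 * n%:R) hb).
have hL := has_meanD (has_meanD (has_meanD (has_meanZ (2 * n%:R) hu) (has_meanZ (- (2 * n%:R)) hv))
  (has_mean_cst _ (- C'))) (has_meanZ (- (2 * n%:R)) hb).
have U0 z : 0 <= U z.
  by rewrite /U !addr_ge0// !mulr_ge0// ?(ltW np)//; case/andP: (u01 z).
have top : {ae P, forall w, lin (X w).1 (n%:R * alpha) != 0}.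
  exists (X @^-1` [set z | lin z.1 (n%:R * alpha) = 0]).
  have mN : measurable [set z : (R * R) * (R * R) | lin z.1 (n%:R * alpha) = 0].
    apply: measurable_preimage1; apply: (measurableT_comp (f := fun x : R * R => lin x (n%:R * alpha))).
      exact: measurable_lin.
    exact: measurable_fst.
  split.
  - by rewrite -[Y in measurable Y]setTI; exact: (measurable_coords2 alpha a b).
  - by rewrite [LHS](law_coords2 sa hab mN) gauss4_lin_eq0.
  - by move=> w /= /negP; rewrite negbK => /eqP.
have lin_ae := entries_lin sa hab.
pose N w := nb_zeros (trig_poly (a ^~ w) (b ^~ w) n) `[0%R, (2 * pi)%R].
have cases w : lin (X w).1 (n%:R * alpha) != 0 ->
    (forall k, (0 < k)%N -> a k w = lin (X w).1 (k%:R * alpha) /\ b k w = lin (X w).2 (k%:R * alpha)) ->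
    ((L (X w))%:E <= N w)%E /\ (N w <= (U (X w))%:E)%E.
  move=> tw lw; rewrite /N (nb_zerosE (ltnW n2) lw).
  have tw' : (lin (X w).1 (n%:R * alpha) != 0) || (lin (X w).2 (n%:R * alpha) != 0) by rewrite tw.
  have /andP[uw0 uw1] := u01 (X w); have vw0 := v0 (X w).
  have [badw|goodw] := pselect (bad (X w)).
    have b1 : \1_bad (X w) = 1 :> R by rewrite indicE mem_set.
    split.
      apply: (@le_trans _ _ 0%E); last exact: (counting_at_least (at_least0 _)).
      rewrite lee_fin /L b1; move: (u (X w)) (v (X w)) uw0 uw1 vw0 => x y x0 x1 y0.
      by clear - x0 x1 y0 np C0; nra.
    have [k [hk kle]] := zero_set_at_most n2 tw'.
    apply: (le_trans (counting_at_most hk)); rewrite lee_fin (le_trans kle)// /U b1 mulr1.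
    by rewrite lerDr !addr_ge0// !mulr_ge0// ltW.
  have b0 : \1_bad (X w) = 0 :> R by rewrite indicE memNset.
  have [k [j [hk hj kle jle]]] := count n beta (X w) n0n (bounded4_l1norm4 goodw) cc ss tw'.
  rewrite uE vE in kle jle.
  have CC : C <= C' by exact: ler_norm.
  split.
    apply: le_trans (counting_at_least hj); rewrite lee_fin (le_trans _ jle)// /L b0; clear - CC; lra.
  apply: (le_trans (counting_at_most hk)); rewrite lee_fin (le_trans kle)// /U b0; clear - CC; lra.
have N0 w : (0 <= N w)%E by exact: (counting_at_least (at_least0 _)).
have up_ae : {ae P, forall w, N w <= (U (X w))%:E}%E.
  by move: top lin_ae; apply: filterS2 => w h1 h2; exact: (cases w h1 h2).2.
have lo_ae : {ae P, forall w, (L (X w))%:E <= N w}%E.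
  by move: top lin_ae; apply: filterS2 => w h1 h2; exact: (cases w h1 h2).1.
have up := integral_le_mean (measurable_coords2 alpha a b) (law_coords2 sa hab) N0 U0 hU up_ae.
have lo := integral_ge_mean (measurable_coords2 alpha a b) (law_coords2 sa hab) N0 hL lo_ae.
rewrite /expected_nb_zeros -/(N _).
move: up lo; change (integral _ _ _) with (\int[P]_w N w)%E.
case: (\int[P]_w N w)%E => [e|//|//]; rewrite !lee_fin => up lo.
rewrite ler_norml.
have eE : e = e / n%:R * n%:R by rewrite divfK// gt_eqF.
have nq : n%:R * q <= n%:R * (eps / 16 / 16) by rewrite ler_wpM2l// ltW.
have nr : n%:R * r <= n%:R * (eps / 16 / 16) by rewrite ler_wpM2l// ltW.
have neps : 0 <= n%:R * eps by rewrite mulr_ge0// ltW.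
move: up lo nq nr neps Cn np; rewrite {1 2}eE.
move: (e / n%:R) (prob_pos alpha beta) (n%:R : R) => f p k.
clear; move=> up lo nq nr neps Cn np.
by apply/andP; split; rewrite -(ler_pM2r np); lra.
Qed.

End averages.

Theorem corollary1p3 (R : realType) (l : R) (hl : Num.sqrt 2 < l <= 2)
    (delta : R) (hdelta : 0 < delta) :
  exists alpha : R, 0 <= alpha < delta /\
    forall eps : R, 0 < eps ->
      infinite_set [set n : nat | (1 <= n)%N /\
        forall (d : measure_display) (T : measurableType d)
          (P : probability T R) (a b : nat -> {RV P >-> R}),
          gaussian_entries alpha a b ->
          (`| expected_nb_zeros a b n * (n%:R^-1)%:E - l%:E | <= eps%:E)%E].
Proof.
move: hl => /andP[l1 l2].
have [m [md ml]] := exists_small_alpha l1 hdelta.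
have m0 : 0 < m.+1%:R^-1 :> R by rewrite invr_gt0.
have m1 : m.+1%:R^-1 <= 1 :> R by rewrite invf_le1// ler1n.
have m01 : 0 < (m.+1%:R^-1 : R) <= 1 by rewrite m0.
have [beta hbeta] := exists_beta m01 l2 ml.
exists m.+1%:R^-1; split; first by rewrite md ltW.
move=> eps eps0; apply: infinite_set_unbounded => N.
have [kappa kappa0 [n0 close]] := expected_zeros_close (sin_neq0_small m01)
  (sin_neq0_or beta (sin_neq0_small m01)) eps0.
(* [alpha] and [beta] were fixed from [l] and [delta] alone; only the tolerance and the rank depend
   on [eps]. Density beyond any rank [N] yields infinitely many [n]. *)
have [n [nN [cc ss]]] := multiples_dense m (maxn N (maxn n0 1)) beta kappa0.
move: nN; rewrite !geq_max => /andP[Nn /andP[n0n n1]].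
exists n => //; split => // d T P a b hab.
by have := close n n0n cc ss d T P a b hab; rewrite hbeta.
Qed.
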